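(* For $\beta\ge3$ let $\boldsymbol u\in K^s$ and $\boldsymbol u_h\in K_h^s$ be the solutions of $$a^s(\boldsymbol u,\boldsymbol v-\boldsymbol u)\ge F(\boldsymbol v-\boldsymbol u)\quad\text{for all }\boldsymbol v\in K^s$$ and $$a^s(\boldsymbol u_h,\boldsymbol v_h-\boldsymbol u_h)\ge F(\boldsymbol v_h-\boldsymbol u_h)\quad\text{for all }\boldsymbol v_h\in K_h^s,$$ respectively. Let $\eta\ge0$ be given by $$\eta^2=\sum_{T\in\mathcal T}\eta(T)^2+\sum_{E\in\mathcal S_\Gamma}\eta(E)^2,\qquad\eta(T)^2=\beta\,\|R_T^{-1}\iota_T^*(L-B\boldsymbol u_h)\|_{V(T)}^2,\qquad\eta(E)^2=\varepsilon^{1/4}\langle\gamma_{\boldsymbol n}\boldsymbol u_h,\gamma_0\boldsymbol u_h\rangle_E.$$ Then there holds the reliability estimate $$|||\boldsymbol u-\boldsymbol u_h|||\le C_{\mathrm{rel}}\,\eta,$$ where the constant $C_{\mathrm{rel}}>0$ is independent of $\Omega$, $\mathcal T$, $\beta$ and $\varepsilon$. In particular, $$\|\boldsymbol u-\boldsymbol u_h\|_{U,1}\le C_{\mathrm{rel},U}\,\eta,\qquad C_{\mathrm{rel},U}:=C_{\mathrm{rel}}C_1,$$ where $C_1>0$ is a constant with $\|\boldsymbol w\|_{U,1}\le C_1|||\boldsymbol w|||$ for all $\boldsymbol w\in U$ that depends only on $\Omega$.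
   Context: Domain and mesh. $0<\varepsilon\le1$. $\Omega\subset\mathbb R^d$ ($d\in\{2,3\}$) is a bounded simply connected Lipschitz domain with boundary $\Gamma=\partial\Omega$ and outer unit normal $\boldsymbol n=\boldsymbol n_\Omega$; $f\in L^2(\Omega)$. $(\cdot,\cdot)$ and $\|\cdot\|$ are the $L^2(\Omega)$ inner product and norm; $\langle\cdot,\cdot\rangle_{\partial\omega}$ is the (extended) $L^2(\partial\omega)$ duality. $\mathcal T$ is a finite conforming mesh of $\Omega$ of open simplices $T$, $\bigcup_{T\in\mathcal T}\overline T=\overline\Omega$; $\boldsymbol n_T$ is the outer unit normal on $\partial T$; $\mathcal S=\{\partial T:T\in\mathcal T\}$; $\mathcal S_\Gamma=\{\partial T\cap\Gamma:T\in\mathcal T\}$. $\nabla_{\mathcal T},\mathrm{div}_{\mathcal T},\Delta_{\mathcal T}$ are the $\mathcal T$-piecewise gradient, divergence, Laplacian. Skeleton spaces. $H^{1/2}(\mathcal S)$ is the set of $\widehat u\in\prod_TH^{1/2}(\partial T)$ for which there is $w\in H^1(\Omega)$ with $\widehat u|_{\partial T}=w|_{\partial T}$ for all $T$; $H^{-1/2}(\mathcal S)$ is the set of $\widehat\sigma\in\prod_TH^{-1/2}(\partial T)$ for which there is $\boldsymbol q\in\boldsymbol H(\mathrm{div},\Omega)$ with $\widehat\sigma|_{\partial T}=(\boldsymbol q\cdot\boldsymbol n_T)|_{\partial T}$ for all $T$. Norms: $\|\widehat u\|_{1/2,\mathcal S}$ is the infimum of $(\|w\|^2+\varepsilon^{1/2}\|\nabla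 w\|^2)^{1/2}$ over all such $w$; $\|\widehat\sigma\|_{-1/2,\mathcal S}$ is the infimum of $(\|\boldsymbol q\|^2+\varepsilon\|\mathrm{div}\,\boldsymbol q\|^2)^{1/2}$ over all such $\boldsymbol q$. Restrictions: $\widehat u|_\Gamma:=w|_\Gamma\in H^{1/2}(\Gamma)$, $\widehat\sigma|_\Gamma:=(\boldsymbol q\cdot\boldsymbol n_\Omega)|_\Gamma\in H^{-1/2}(\Gamma)$ (independent of the chosen $w,\boldsymbol q$). $\langle\widehat u,\boldsymbol\tau\cdot\boldsymbol n\rangle_{\mathcal S}=\sum_T\langle\widehat u|_{\partial T},\boldsymbol\tau\cdot\boldsymbol n_T\rangle_{\partial T}$, $\langle\widehat\sigma,v\rangle_{\mathcal S}=\sum_T\langle\widehat\sigma|_{\partial T},v\rangle_{\partial T}$. For $\widehat v\in H^{1/2}(\Gamma)$, $\|\widehat v\|_{H^{1/2}(\Gamma)}=\inf\{(\|w\|^2+\varepsilon\|\nabla w\|^2)^{1/2}:w\in H^1(\Omega),w|_\Gamma=\widehat v\}$. Trial and test spaces. $U$ is the set of $\boldsymbol u=(u,\boldsymbol\sigma,\rho,\widehat u^a,\widehat u^b,\widehat\sigma^a,\widehat\sigma^b)\in L^2(\Omega)\times L^2(\Omega)^d\times L^2(\Omega)\times H^{1/2}(\mathcal S)\times H^{1/2}(\mathcal S)\times H^{-1/2}(\mathcal S)\times H^{-1/2}(\mathcal S)$ with $\widehat u^a|_\Gamma=\widehat u^b|_\Gamma$. Norm: $\|\boldsymbol u\|_{U,1}^2=\|u\|^2+\|\boldsymbol\sigma\|^2+\varepsilon\|\rho\|^2+\varepsilon^{3/2}\|\widehat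 u^a\|_{1/2,\mathcal S}^2+\varepsilon\|\widehat u^b\|_{1/2,\mathcal S}^2+\varepsilon^{3/2}\|\widehat\sigma^a\|_{-1/2,\mathcal S}^2+\varepsilon^{5/2}\|\widehat\sigma^b\|_{-1/2,\mathcal S}^2$. $V=H^1(\mathcal T)\times\boldsymbol H(\mathrm{div},\mathcal T)\times H^1(\Delta,\mathcal T)$, where $H^1(\mathcal T)$, $\boldsymbol H(\mathrm{div},\mathcal T)$ are the spaces of $L^2$ functions (fields) that are in $H^1(T)$, resp. $\boldsymbol H(\mathrm{div},T)$, on each $T$, and $H^1(\Delta,\mathcal T)=\{w\in H^1(\mathcal T):\Delta w|_T\in L^2(T)\ \forall T\}$; for $\boldsymbol v=(\mu,\boldsymbol\tau,v)\in V$, $\|\boldsymbol v\|_V^2=\varepsilon^{-1}\|\mu\|^2+\|\nabla_{\mathcal T}\mu\|^2+\varepsilon^{-1/2}\|\boldsymbol\tau\|^2+\|\mathrm{div}_{\mathcal T}\boldsymbol\tau\|^2+\|v\|^2+(\varepsilon^{1/2}+\varepsilon)\|\nabla_{\mathcal T}v\|^2+\varepsilon^{3/2}\|\Delta_{\mathcal T}v\|^2$, induced by the inner product $(\cdot,\cdot)_V$. Forms. For $\boldsymbol u\in U$, $\boldsymbol v=(\mu,\boldsymbol\tau,v)\in V$: $b(\boldsymbol u,\boldsymbol v)=(\rho,\mu)+(\boldsymbol\sigma,\nabla_{\mathcal T}\mu)-\langle\widehat\sigma^a,\mu\rangle_{\mathcal S}+\varepsilon^{-1/4}(\boldsymbol\sigma,\boldsymbol\tau)+(u,\mathrm{div}_{\mathcal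 T}\boldsymbol\tau)-\langle\widehat u^a,\boldsymbol\tau\cdot\boldsymbol n\rangle_{\mathcal S}+\varepsilon^{3/4}(\boldsymbol\sigma,\nabla_{\mathcal T}v)-\varepsilon^{3/4}\langle\widehat\sigma^b,v\rangle_{\mathcal S}+(u,v)+\varepsilon^{5/4}(\rho,\Delta_{\mathcal T}v)+\varepsilon^{1/4}(\boldsymbol\sigma,\nabla_{\mathcal T}v)-\varepsilon^{1/2}\langle\widehat u^b,\nabla_{\mathcal T}v\cdot\boldsymbol n\rangle_{\mathcal S}$, $L(\boldsymbol v)=(f,v-\varepsilon^{1/2}\Delta_{\mathcal T}v)$. $B:U\to V'$, $(B\boldsymbol u)(\boldsymbol v)=b(\boldsymbol u,\boldsymbol v)$; $\Theta:U\to V$ is defined by $(\Theta\boldsymbol u,\boldsymbol v)_V=b(\boldsymbol u,\boldsymbol v)$ for all $\boldsymbol v\in V$; $\Theta_\beta=\beta\Theta$. Traces: $\gamma_0\boldsymbol u=\widehat u^a|_\Gamma$, $\gamma_{\boldsymbol n}\boldsymbol u=\widehat\sigma^a|_\Gamma$. Then $a^s(\boldsymbol u,\boldsymbol v)=b(\boldsymbol u,\Theta_\beta\boldsymbol v)+\tfrac12\varepsilon^{1/4}(\langle\gamma_{\boldsymbol n}\boldsymbol u,\gamma_0\boldsymbol v\rangle_\Gamma+\langle\gamma_{\boldsymbol n}\boldsymbol v,\gamma_0\boldsymbol u\rangle_\Gamma)$ and $F(\boldsymbol v)=L(\Theta_\beta\boldsymbol v)$ for $\boldsymbol u,\boldsymbol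 v\in U$. Energy-based norm: $|||\boldsymbol u|||^2=\|B\boldsymbol u\|_{V'}^2+\varepsilon^{-1/2}\|\gamma_0\boldsymbol u\|_{H^{1/2}(\Gamma)}^2$, with $\|\cdot\|_{V'}$ the dual norm of $\|\cdot\|_V$. Orderings and cone. $\widehat v\ge0$ in $H^{1/2}(\Gamma)$ means that $\widehat v$ is the weak $H^{1/2}(\Gamma)$-limit of a sequence of non-negative Lipschitz continuous functions on $\Gamma$. $\widehat\sigma\ge0$ in $H^{-1/2}(\Gamma)$ means $\langle\widehat\sigma,\widehat v\rangle_\Gamma\ge0$ for all $\widehat v\in H^{1/2}(\Gamma)$, $\widehat v\ge0$. $K^s=\{\boldsymbol u\in U:\gamma_0\boldsymbol u\ge0,\gamma_{\boldsymbol n}\boldsymbol u\ge0\}$. Discrete spaces. $U_h$ is the subspace of $U$ of all elements of $P^0(\mathcal T)\times[P^0(\mathcal T)]^d\times P^0(\mathcal T)\times S^1(\mathcal S)\times S^1(\mathcal S)\times P^0(\mathcal S)\times P^0(\mathcal S)$ that belong to $U$ (i.e. satisfy $\widehat u^a|_\Gamma=\widehat u^b|_\Gamma$), where $P^0(\mathcal T)$ are the $\mathcal T$-element-wise constants, $P^0(\mathcal S)\subset H^{-1/2}(\mathcal S)$ consists of those elements that are constant on each facet of each $\partial T$, and $S^1(\mathcal S)\subset H^{1/2}(\mathcal S)$ consists of the globally continuous functions on the skeleton that are affine on each facet. $K_h^s=K^s\cap U_h$. Estimator notation. $V(T)=H^1(T)\times\boldsymbol H(\mathrm{div},T)\times H^1(\Delta,T)$,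 $H^1(\Delta,T)=\{w\in H^1(T):\Delta w\in L^2(T)\}$, with $\|(\mu,\boldsymbol\tau,v)\|_{V(T)}^2=\varepsilon^{-1}\|\mu\|_T^2+\|\nabla\mu\|_T^2+\varepsilon^{-1/2}\|\boldsymbol\tau\|_T^2+\|\mathrm{div}\,\boldsymbol\tau\|_T^2+\|v\|_T^2+(\varepsilon^{1/2}+\varepsilon)\|\nabla v\|_T^2+\varepsilon^{3/2}\|\Delta v\|_T^2$ ($\|\cdot\|_T$ the $L^2(T)$ norm); $R_T:V(T)\to(V(T))'$ is the Riesz isomorphism; $\iota_T:V(T)\to V$ is the canonical embedding (extension by zero) and $\iota_T^*:V'\to(V(T))'$ its dual. $\langle\cdot,\cdot\rangle_E$ is the $L^2(E)$ inner product. *)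

(* Defs.v *)
From HB Require Import structures.
From mathcomp Require Import all_boot all_order all_algebra.
From mathcomp Require Import all_classical all_reals all_analysis.

Set Implicit Arguments.
Unset Strict Implicit.
Unset Printing Implicit Defensive.

Import Order.TTheory GRing.Theory Num.Theory.
Import numFieldNormedType.Exports.

Local Open Scope classical_set_scope.
Local Open Scope ring_scope.

(* The ambient space R^d is 'rV[R]_n.+1, that is d = n.+1.  Functions and
   fields are total functions on R^d; the elements of the spaces below are
   their classes modulo almost everywhere equality on the relevant set, and
   every notion is invariant under that equivalence. *)

Definition measure_rV_display : measure_display -> measure_display.
Proof. exact. Qed.

Section measurable_rV.
Context {d : measure_display} {T : sigmaRingType d} (n : nat).

Let coor : 'I_n -> 'rV[T]_n -> T := fun i x => x ord0 i.

Let rV_set0 : g_sigma_preimage coor set0.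
Proof. exact: sigma_algebra0. Qed.

Let rV_setC A : g_sigma_preimage coor A -> g_sigma_preimage coor (~` A).
Proof. exact: sigma_algebraC. Qed.

Let rV_bigcup (F : _^nat) : (forall i, g_sigma_preimage coor (F i)) ->
  g_sigma_preimage coor (\bigcup_i (F i)).
Proof. exact: sigma_algebra_bigcup. Qed.

(* the product sigma-algebra: on 'rV[R]_n these are the Borel sets *)
HB.instance Definition _ := @isMeasurable.Build (measure_rV_display d)
  ('rV[T]_n) (g_sigma_preimage coor) rV_set0 rV_setC rV_bigcup.

Lemma measurable_coor (i : 'I_n) :
  measurable_fun [set: 'rV[T]_n] (fun x : 'rV[T]_n => x ord0 i).
Proof.
move=> _ Y mY; rewrite setTI; apply: sub_sigma_algebra => /=.
rewrite -bigcup_seq/=; exists i => /=; first by rewrite mem_index_enum.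
by exists Y => //; rewrite setTI.
Qed.

Lemma measurable_fun_rV d' (T' : measurableType d') (f : T' -> 'rV[T]_n) :
  (forall i, measurable_fun [set: T'] (fun x => f x ord0 i)) ->
  measurable_fun [set: T'] f.
Proof.
move=> mf _ A mA; rewrite setTI.
suff: g_sigma_preimage coor `<=` [set B | measurable (f @^-1` B)].
  by move/(_ A mA).
apply: smallest_sub.
- split => //=.
  + by rewrite preimage_set0.
  + by move=> B mB; rewrite setTD preimage_setC; exact: measurableC.
  + by move=> F mF; rewrite preimage_bigcup; exact: bigcup_measurable.
- move=> B; rewrite -bigcup_seq/= => -[i _ [C mC <-]].
  by rewrite setTI; have := mf i measurableT C mC; rewrite setTI.
Qed.
End measurable_rV.

Section lebesgue_rV.
Variable R : realType.

Definition row_cons n (p : R * 'rV[R]_n) : 'rV[R]_n.+1 :=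
  row_mx (const_mx p.1 : 'rV_1) p.2.

Lemma measurable_row_cons n : measurable_fun setT (@row_cons n).
Proof.
apply: measurable_fun_rV => i.
case E : (fintype.split (i : 'I_(1 + n))) => [j|j].
  rewrite (_ : (fun x => _) = fst); first exact: measurable_fst.
  by apply/funext => p; rewrite /row_cons mxE E mxE.
rewrite (_ : (fun x => _) = (fun v : 'rV[R]_n => v ord0 j) \o snd).
  apply: measurableT_comp; last exact: measurable_snd.
  exact: measurable_coor.
by apply/funext => p; rewrite /row_cons mxE E.
Qed.

Definition leb_succ n (m : {measure set 'rV[R]_n -> \bar R}) :
    {measure set 'rV[R]_n.+1 -> \bar R} :=
  measure_function_pushforward__canonical__measure_function_Measure
    (@lebesgue_measure R \x^ m)%E (@measurable_row_cons n).

Fixpoint leb (n : nat) : {measure set 'rV[R]_n -> \bar R} :=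
  match n with
  | 0%N => dirac (0 : 'rV[R]_0)
  | n'.+1 => leb_succ (leb n')
  end.

End lebesgue_rV.

Section sobolev.
Variables (R : realType) (n : nat).

Local Notation E := 'rV[R]_n.+1.
Implicit Types (D : set E) (w f g h : E -> R) (q : E -> E).

Definition dot (x y : E) : R := \sum_i x ord0 i * y ord0 i.

Definition ip D f g : R := \int[leb R n.+1]_(x in D) (f x * g x).

Definition ipv D (p q : E -> E) : R := \int[leb R n.+1]_(x in D) dot (p x) (q x).

Definition L2 D f : Prop :=
  measurable_fun D f /\
  (\int[leb R n.+1]_(x in D) ((f x) ^+ 2)%:E < +oo)%E.

Definition L2v D q : Prop := forall i, L2 D (fun x => q x ord0 i).

Definition pder (i : 'I_n.+1) f : E -> R :=
  fun x => 'D_(delta_mx ord0 i : E) f x.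

Definition grad f : E -> E := fun x => \row_i pder i f x.

Fixpoint Ck (k : nat) f : Prop :=
  match k with
  | 0%N => continuous f
  | k'.+1 => [/\ continuous f,
      forall i x, derivable f x (delta_mx ord0 i : E)
    & forall i, Ck k' (pder i f)]
  end.

Definition test_function D f : Prop :=
  [/\ forall k, Ck k f, compact (closure [set x | f x != 0])
    & closure [set x | f x != 0] `<=` D].

Definition is_wgrad D w q : Prop :=
  L2v D q /\ forall phi, test_function D phi -> forall i,
    ip D w (pder i phi) = - ip D (fun x => q x ord0 i) phi.

Definition is_wdiv D q h : Prop :=
  L2 D h /\ forall phi, test_function D phi ->
    ipv D q (grad phi) = - ip D h phi.

Definition H1 D w : Prop := L2 D w /\ exists q, is_wgrad D w q.

Definition Hdiv D q : Prop := L2v D q /\ exists h, is_wdiv D q h.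

(* Weak derivatives are unique almost everywhere on D, so that the choice made
   by get is immaterial. *)
Definition wgrad D w : E -> E := get [set q | is_wgrad D w q].

Definition wdiv D q : E -> R := get [set h | is_wdiv D q h].

Definition H1Delta D w : Prop := H1 D w /\ Hdiv D (wgrad D w).

(* closure of the test functions in H^1(D), which is the kernel of the trace
   operator of H^1(D) *)
Definition H10 D w : Prop :=
  H1 D w /\ forall e, 0 < e -> exists2 phi, test_function D phi &
    ip D (w - phi) (w - phi)
    + ipv D (wgrad D w - grad phi) (wgrad D w - grad phi) < e.

(* Traces.  H^{1/2}(bdry D) is the image of the trace operator of H^1(D),
   that is H^1(D) / H^1_0(D): an element is represented by any w in H^1(D)
   with that trace, and w1, w2 have the same trace iff H10 D (w1 - w2).
   Likewise a normal trace (q . n_D) on bdry D is represented by q in H(div, D)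
   and acts on the trace of w by the following duality pairing. *)
Definition duality D q w : R := ipv D q (wgrad D w) + ip D (wdiv D q) w.

Definition bdry D : set E := closure D `\` interior D.

(* For w in H^1(D) and g Lipschitz on bdry D: since the trace of a function G
   that is Lipschitz up to the boundary is its restriction, this says that the
   trace of w is g. *)
Definition has_trace D w g : Prop :=
  exists G, [/\ [lipschitz G x | x in closure D],
    {in bdry D, G =1 g} & H10 D (w - G)].

Definition simply_connected D : Prop :=
  forall c : R -> E, {within `[0, 1], continuous c} ->
    (forall a, a \in `[0, 1] -> D (c a)) -> c 0 = c 1 ->
  exists H : R * R -> E,
    [/\ {within `[0, 1] `*` `[0, 1], continuous H},
      forall a b, a \in `[0, 1] -> b \in `[0, 1] -> D (H (a, b)),
      forall b, b \in `[0, 1] -> H (0, b) = c b /\ H (1, b) = c 0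
    & forall a, a \in `[0, 1] -> H (a, 0) = c 0 /\ H (a, 1) = c 0].

(* Near each boundary point z, in orthonormal coordinates y = (x - z) Q with
   y = (y', y_d), the set D is the region above a Lipschitz graph *)
Definition lipschitz_boundary D : Prop :=
  forall z, bdry D z ->
  exists (Q : 'M[R]_n.+1) (r a : R) (psi : 'rV[R]_n -> R),
    [/\ Q *m Q^T = 1%:M, 0 < r /\ 0 < a, [lipschitz psi y | y in setT],
      forall y', `|y'| < r -> `|psi y'| <= a / 2
    & forall x, let y := (x - z) *m Q in
        let y' := col' ord_max y in let yd := y ord0 ord_max in
        `|y'| < r -> `|yd| < a ->
        (D x <-> psi y' < yd) /\ (bdry D x <-> yd = psi y')].

Definition lipschitz_domain D : Prop :=
  [/\ D !=set0 /\ open D, connected D, simply_connected D, bounded_set D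
    & lipschitz_boundary D].

(* the rows are the d + 1 vertices *)
Local Notation simp := 'M[R]_(n.+2, n.+1).

Definition bary (l : 'rV[R]_n.+2) : Prop :=
  (forall k, 0 <= l ord0 k) /\ \sum_k l ord0 k = 1.

Definition nondegenerate (A : simp) : Prop :=
  \matrix_(j < n.+1) (row (lift ord0 j) A - row ord0 A) \in unitmx.

Definition simplex (A : simp) : set E :=
  [set l *m A | l in [set l | bary l /\ forall k, 0 < l ord0 k]].

Definition hull (A : simp) : set E := [set l *m A | l in bary].

(* the (closed) facet opposite to vertex k *)
Definition facet (A : simp) (k : 'I_n.+2) : set E :=
  [set l *m A | l in [set l | bary l /\ l ord0 k = 0]].

Definition hull_common (A B : simp) : set E :=
  [set l *m A | l in [set l | bary l /\
    forall k, l ord0 k != 0 -> exists j, row k A = row j B]].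

Record mesh := Mesh { ntri : nat; vert : 'I_ntri -> simp }.

Implicit Types (Om : set E) (M : mesh).

Definition elt M (i : 'I_(ntri M)) : set E := simplex (vert i).

Definition conforming_mesh Om M : Prop :=
  [/\ forall i, nondegenerate (@vert M i),
    forall i j, i != j -> @elt M i `&` @elt M j = set0,
    forall i j, i != j ->
      hull (@vert M i) `&` hull (@vert M j) = hull_common (vert i) (vert j)
  & \bigcup_(i in [set: 'I_(ntri M)]) closure (elt i) = closure Om].

(* Surface integrals.  The facet of A opposite to vertex k, with vertices
   p_0, ..., p_n, is parametrized over the reference simplex of R^n = R^(d-1)
   by s |-> p_0 + sum_j s_j (p_(j+1) - p_0). *)
Definition ref_simplex : set 'rV[R]_n :=
  [set s | (forall j, 0 <= s ord0 j) /\ \sum_j s ord0 j <= 1].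

Definition facet_jac (A : simp) (k : 'I_n.+2) : 'M[R]_(n, n.+1) :=
  \matrix_(j < n) (row (lift k (lift ord0 j)) A - row (lift k ord0) A).

Definition facet_param (A : simp) (k : 'I_n.+2) (s : 'rV[R]_n) : E :=
  row (lift k ord0) A + s *m facet_jac A k.

Definition facet_integral (A : simp) (k : 'I_n.+2) g : R :=
  Num.sqrt (\det (facet_jac A k *m (facet_jac A k)^T))
  * \int[leb R n]_(s in ref_simplex) g (facet_param A k s).

Definition bdry_integral (A : simp) g : R := \sum_k facet_integral A k g.

(* int_E g for E = (bdry T) /\ (bdry Om), with T the i-th mesh element *)
Definition edge_integral Om M (i : 'I_(ntri M)) g : R :=
  bdry_integral (vert i) (fun x => \1_(bdry Om) x * g x).

Definition Gamma_integral Om M g : R := \sum_(i < ntri M) edge_integral Om i g.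

Definition L2_Gamma Om M g : Prop := forall (i : 'I_(ntri M)) k,
  let gk := fun y : 'rV[R]_n => let x := facet_param (vert i) k y in
                     \1_(bdry Om) x * g x in
  measurable_fun ref_simplex gk /\
  (\int[leb R n]_(y in ref_simplex) ((gk y) ^+ 2)%:E < +oo)%E.

Definition pgrad M w : E -> E := fun x =>
  \sum_(i < ntri M) \1_(elt i) x *: wgrad (elt i) w x.

Definition pdiv M q : E -> R := fun x =>
  \sum_(i < ntri M) \1_(elt i) x * wdiv (elt i) q x.

(* H^{1/2}-norm of the trace of w on the boundary of Om *)
Definition norm_half_Gamma (eps : R) Om w : R :=
  inf [set Num.sqrt (ip Om w' w' + eps * ipv Om (wgrad Om w') (wgrad Om w'))
      | w' in [set w' | H1 Om w' /\ H10 Om (w' - w)]].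

(* The bound makes l well defined on traces, hence an element of the dual of
   H^{1/2}(bdry Om). *)
Definition half_functional eps Om (l : (E -> R) -> R) : Prop :=
  (forall a w1 w2, H1 Om w1 -> H1 Om w2 ->
     l (fun x => a * w1 x + w2 x) = a * l w1 + l w2) /\
  exists C, forall w, H1 Om w -> `|l w| <= C * norm_half_Gamma eps Om w.

(* p is the sequence of nonnegative Lipschitz functions on bdry Om, and W k
   represents p k in H^{1/2}(bdry Om) *)
Definition half_ge0 eps Om w : Prop :=
  exists p W : nat -> E -> R,
    (forall k, [/\ [lipschitz p k x | x in bdry Om],
       forall x, bdry Om x -> 0 <= p k x, H1 Om (W k)
     & has_trace Om (W k) (p k)]) /\
    forall l, half_functional eps Om l -> (fun k => l (W k)) @ \oo --> l w.

Definition mhalf_ge0 eps Om q : Prop :=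
  forall w, H1 Om w -> half_ge0 eps Om w -> 0 <= duality Om q w.

(* (u, sigma, rho, ua, ub, sa, sb).  An element of H^{1/2}(S) is represented by
   a function in H^1(Om) having these traces on the boundaries of the mesh
   elements, an element of H^{-1/2}(S) by a field in H(div, Om) having these
   normal traces. *)
Definition trial : zmodType :=
  ((E -> R) * (E -> E) * (E -> R) * (E -> R) * (E -> R)
   * (E -> E) * (E -> E))%type.

Implicit Types uu vv : trial.

Definition tu uu : E -> R := let: (u, _, _, _, _, _, _) := uu in u.
Definition tsigma uu : E -> E := let: (_, s, _, _, _, _, _) := uu in s.
Definition trho uu : E -> R := let: (_, _, r, _, _, _, _) := uu in r.
Definition tua uu : E -> R := let: (_, _, _, a, _, _, _) := uu in a.
Definition tub uu : E -> R := let: (_, _, _, _, b, _, _) := uu in b.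
Definition tsa uu : E -> E := let: (_, _, _, _, _, a, _) := uu in a.
Definition tsb uu : E -> E := let: (_, _, _, _, _, _, b) := uu in b.

Definition same_trace M w w' : Prop := forall i, H10 (@elt M i) (w - w').

Definition same_ntrace M q q' : Prop := forall i v, H1 (@elt M i) v ->
  duality (elt i) q v = duality (elt i) q' v.

Definition norm_half_S eps Om M w : R :=
  inf [set Num.sqrt (ip Om w' w'
                     + eps `^ (1 / 2) * ipv Om (wgrad Om w') (wgrad Om w'))
      | w' in [set w' | H1 Om w' /\ same_trace M w' w]].

Definition norm_mhalf_S eps Om M q : R :=
  inf [set Num.sqrt (ipv Om q' q' + eps * ip Om (wdiv Om q') (wdiv Om q'))
      | q' in [set q' | Hdiv Om q' /\ same_ntrace M q' q]].

Definition U_space Om uu : Prop :=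
  [/\ L2 Om (tu uu), L2v Om (tsigma uu) & L2 Om (trho uu)] /\
  [/\ H1 Om (tua uu), H1 Om (tub uu), Hdiv Om (tsa uu), Hdiv Om (tsb uu)
    & H10 Om (tua uu - tub uu)].

Definition norm_U1 eps Om M uu : R :=
  Num.sqrt (ip Om (tu uu) (tu uu) + ipv Om (tsigma uu) (tsigma uu)
    + eps * ip Om (trho uu) (trho uu)
    + eps `^ (3 / 2) * norm_half_S eps Om M (tua uu) ^+ 2
    + eps * norm_half_S eps Om M (tub uu) ^+ 2
    + eps `^ (3 / 2) * norm_mhalf_S eps Om M (tsa uu) ^+ 2
    + eps `^ (5 / 2) * norm_mhalf_S eps Om M (tsb uu) ^+ 2).

Local Notation test := ((E -> R) * (E -> E) * (E -> R))%type.

Definition V_loc D (x : test) : Prop :=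
  let: (mu, tau, v) := x in [/\ H1 D mu, Hdiv D tau & H1Delta D v].

Definition V_space Om M (x : test) : Prop :=
  let: (mu, tau, v) := x in
  [/\ L2 Om mu, L2v Om tau, L2 Om v & forall i, V_loc (@elt M i) x].

(* the inner product over D for the gradient gr and the divergence dv, the
   Laplacian being dv \o gr *)
Definition ipV_gen (eps : R) D (gr : (E -> R) -> E -> E)
    (dv : (E -> E) -> E -> R) (x y : test) : R :=
  let: (mu, tau, v) := x in let: (mu', tau', v') := y in
  eps^-1 * ip D mu mu' + ipv D (gr mu) (gr mu')
  + eps `^ (- (1 / 2)) * ipv D tau tau' + ip D (dv tau) (dv tau')
  + ip D v v' + (eps `^ (1 / 2) + eps) * ipv D (gr v) (gr v')
  + eps `^ (3 / 2) * ip D (dv (gr v)) (dv (gr v')).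

Definition ipV eps Om M := ipV_gen eps Om (pgrad M) (pdiv M).

Definition ipV_loc eps D := ipV_gen eps D (wgrad D) (wdiv D).

(* <w, tau . n>_S = skeleton M tau w and <q . n, v>_S = skeleton M q v *)
Definition skeleton M q w : R := \sum_(i < ntri M) duality (elt i) q w.

Definition b_form eps Om M uu (x : test) : R :=
  let: (mu, tau, v) := x in
  ip Om (trho uu) mu + ipv Om (tsigma uu) (pgrad M mu)
  - skeleton M (tsa uu) mu
  + eps `^ (- (1 / 4)) * ipv Om (tsigma uu) tau + ip Om (tu uu) (pdiv M tau)
  - skeleton M tau (tua uu)
  + eps `^ (3 / 4) * ipv Om (tsigma uu) (pgrad M v)
  - eps `^ (3 / 4) * skeleton M (tsb uu) v
  + ip Om (tu uu) v + eps `^ (5 / 4) * ip Om (trho uu) (pdiv M (pgrad M v))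
  + eps `^ (1 / 4) * ipv Om (tsigma uu) (pgrad M v)
  - eps `^ (1 / 2) * skeleton M (pgrad M v) (tub uu).

Definition L_form eps Om M f (x : test) : R :=
  let: (mu, tau, v) := x in
  ip Om f (fun z => v z - eps `^ (1 / 2) * pdiv M (pgrad M v) z).

Definition Theta eps Om M uu : test :=
  get [set t : test | V_space Om M t /\
    forall x, V_space Om M x -> ipV eps Om M t x = b_form eps Om M uu x].

Definition a_form beta eps Om M uu vv : R :=
  b_form eps Om M uu (beta *: Theta eps Om M vv)
  + 1 / 2 * eps `^ (1 / 4)
    * (duality Om (tsa uu) (tua vv) + duality Om (tsa vv) (tua uu)).

Definition F_form beta eps Om M f vv : R :=
  L_form eps Om M f (beta *: Theta eps Om M vv).

Definition dual_norm_V eps Om M (l : test -> R) : R :=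
  sup [set `|l x| | x in [set x | V_space Om M x /\
    Num.sqrt (ipV eps Om M x x) <= 1]].

Definition energy_norm eps Om M uu : R :=
  Num.sqrt (dual_norm_V eps Om M (b_form eps Om M uu) ^+ 2
    + eps `^ (- (1 / 2)) * norm_half_Gamma eps Om (tua uu) ^+ 2).

Definition K_cone eps Om uu : Prop :=
  [/\ U_space Om uu, half_ge0 eps Om (tua uu) & mhalf_ge0 eps Om (tsa uu)].

Definition solves_vi beta eps Om M f (K : trial -> Prop) uu : Prop :=
  K uu /\ forall vv, K vv ->
    F_form beta eps Om M f (vv - uu) <= a_form beta eps Om M uu (vv - uu).

Definition P0_mesh M f : Prop := forall i, exists c : R,
  {ae leb R n.+1, forall x, @elt M i x -> f x = c}.

(* The functional q . n_T is the L^2 function with the constant value c i k on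
   the k-th facet.  Restrictions of Lipschitz functions are dense in
   H^{1/2}(bdry T), so they determine the functional. *)
Definition P0_skel M q : Prop :=
  exists c : forall i : 'I_(ntri M), 'I_n.+2 -> R,
  forall i G, [lipschitz G x | x in closure (elt i)] ->
    duality (elt i) q G
    = \sum_k facet_integral (vert i) k (fun x => c i k * G x).

Definition S1_skel M w : Prop :=
  exists g, [/\ {within \bigcup_(i in [set: 'I_(ntri M)]) bdry (elt i),
                  continuous g},
    forall i k, exists (a : E) (c : R),
      forall x, facet (@vert M i) k x -> g x = dot a x + c
  & forall i, has_trace (@elt M i) w g].

Definition U_h Om M uu : Prop :=
  [/\ U_space Om uu,
    P0_mesh M (tu uu) /\ (forall j, P0_mesh M (fun x => tsigma uu x ord0 j)),
    P0_mesh M (trho uu),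
    S1_skel M (tua uu) /\ S1_skel M (tub uu)
  & P0_skel M (tsa uu) /\ P0_skel M (tsb uu)].

Definition K_cone_h eps Om M uu : Prop := K_cone eps Om uu /\ U_h Om M uu.

Definition ext0 D (x : test) : test :=
  let: (mu, tau, v) := x in
  ((fun z => \1_D z * mu z), (fun z => \1_D z *: tau z),
   (fun z => \1_D z * v z)).

Definition riesz_inv eps D (l : test -> R) : test :=
  get [set r : test | V_loc D r /\
    forall x, V_loc D x -> ipV_loc eps D r x = l x].

Definition eta_elt2 beta eps Om M f uh (i : 'I_(ntri M)) : R :=
  let r := riesz_inv eps (elt i) (fun x =>
    L_form eps Om M f (ext0 (elt i) x)
    - b_form eps Om M uh (ext0 (elt i) x)) in
  beta * ipV_loc eps (elt i) r r.

(* the functional q . n_Om on bdry Om is the L^2 function s *)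
Definition has_ntrace Om M q (s : E -> R) : Prop :=
  L2_Gamma Om M s /\ forall G, [lipschitz G x | x in closure Om] ->
    duality Om q G = Gamma_integral Om M (fun x => s x * G x).

(* For discrete uh the functions s and g exist and are unique (almost everywhere)
   on bdry Om, so that the L^2(E) products do not depend on them. *)
Definition estimator beta eps Om M f uh (eta : R) : Prop :=
  0 <= eta /\ exists s g,
    [/\ has_ntrace Om M (tsa uh) s, has_trace Om (tua uh) g
    & eta ^+ 2 = \sum_(i < ntri M) eta_elt2 beta eps Om f uh i
        + \sum_(i < ntri M)
            eps `^ (1 / 4) * edge_integral Om i (fun x => s x * g x)].

End sobolev.

(* Main.v *)
(* Write e = eps^(1/4), let w = u - uh and let t = (m, p, v) represent b(w, .)
   in V, so that D = ||t||_V is the dual norm of B w.  Tested on one mesh element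
   at a time, the equation for t has a strong form:
     W = u_w - div p          has the traces of ua, with e grad W = sigma - p / e,
     q = sigma - grad m       has the normal traces of sa, with div q = rho - m / e^4,
     X = e^3 rho - e^4 Lap v  has the traces of ub,
     Q                        has the normal traces of sb, with e^3 div Q = u_w - v,
   where e^3 Q = (e^3 + e) sigma - e^2 grad X - (e^2 + e^4) grad v.  Zero traces and
   equal normal traces are inherited by Om from the elements, hence
   e <gn w, g0 w> = e (q, grad X) + e (div q, X), and 0 = <Q . n, X - W> since ua and
   ub agree on the boundary.  Subtracting half of the second identity from the first
   one leaves a quadratic form in sigma, e grad X, e^2 rho, u_w and the components of
   t; adding D^2 makes it positive definite, uniformly for e in [0, 1].  So
     N <= 20 (e <gn w, g0 w> + D^2),  N = |sigma|^2 + |e grad X|^2 + |e^2 rho|^2 + |u_w|^2,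
   while W, X, q and Q bound all the norms of w by N and D.  For an arbitrary w in U,
   <gn w, g0 w> is bounded by q and any extension of g0 w, which gives the estimate of
   the U-norm by the energy norm with an absolute constant.  For the error, the
   variational inequality tested with uh and the cone conditions give
     beta D^2 + e <gn w, g0 w> <=
       beta (b(uh, x) - L(x)) + e <gn uh, g0 uh>,  x = Theta(uh - u),
   whose first term is at most (beta D^2 + sum_T eta(T)^2) / 2, while the second one is
   sum_E eta(E)^2. *)

Require Import Defs.
From HB Require Import structures.
From mathcomp Require Import all_boot all_order all_algebra.
From mathcomp Require Import all_classical all_reals all_analysis.
From mathcomp Require Import measurable_realfun.
From mathcomp Require Import ring lra.

Set Implicit Arguments.
Unset Strict Implicit.
Unset Printing Implicit Defensive.

Import Order.TTheory GRing.Theory Num.Theory.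
Import numFieldNormedType.Exports.

Local Open Scope classical_set_scope.
Local Open Scope ring_scope.

Local Notation pdiv := Defs.pdiv.

(** * Square integrable functions *)

(** Traces exist here only as quotients: [H10] is a closure of test functions, and a normal trace is
    known through [duality] alone. There is no trace operator and no density of smooth functions up
    to the boundary to argue with. Statements about traces are therefore drawn from variational
    identities, by solving auxiliary problems with the Riesz theorem and testing with their
    solutions. The same theorem gives meaning to [Theta] and [riesz_inv], which are chosen by [get];
    it rests on the completeness of L2. Functions are not identified almost everywhere, so inner
    products are only semidefinite and weak derivatives are mostly compared under an integral. With
    [eps = e^4] all powers of [eps] become integral powers of [e]. Rescaled quantities such as
    [e^2 rho] or [p / e] remove [e] from the quadratic form, up to a factor [e] and a factor
    [1 + e^2]. The constants 7 and 200 are absolute because W, X, q and Q are themselves admissible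
    extensions of the traces: no trace or Poincare inequality on [Om] enters. *)

Lemma discr_le (R : realFieldType) (a b c : R) :
  (forall t, 0 <= a + 2 * t * b + t ^+ 2 * c) -> b ^+ 2 <= a * c.
Proof.
move=> H; have [c0|c0|c0] := ltgtP c 0.
(* A negative [c] is impossible: at [t = k + 1 >= 1], where [k c = - (1 + |a| + 2 |b|)], the
   quadratic is negative. *)
- have := H ((1 + `|a| + 2 * `|b|) / - c + 1); set k := (_ + _) / _.
  have k0 : 0 <= k by rewrite divr_ge0 ?addr_ge0 ?mulr_ge0// oppr_ge0 ltW.
  have kc : k * c = - (1 + `|a| + 2 * `|b|) by rewrite /k; field; lra.
  have := ler_norm a; have := ler_norm b; have := ler_norm (- b).
  rewrite normrN => *; have : (k + 1) * b <= (k + 1) * `|b|.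
    by rewrite ler_pM2l//; lra.
  have : 0 <= `|a| by []. have : 0 <= `|b| by [].
  have : (k + 1) ^+ 2 * c = (k + 1) * (k * c + c) by ring.
  rewrite kc => *; nra.
- have := H (- b / c); have -> : a + 2 * (- b / c) * b + (- b / c) ^+ 2 * c =
    (a * c - b ^+ 2) / c by field; lra.
  by rewrite pmulr_lge0 ?invr_gt0// subr_ge0.
- rewrite c0 mulr0; have [->|b0] := eqVneq b 0; first by rewrite expr0n.
  have := H (- (a + 1) / (2 * b)).
  have -> : a + 2 * (- (a + 1) / (2 * b)) * b + (- (a + 1) / (2 * b)) ^+ 2 * c = -1.
    by rewrite c0; field.
  by lra.
Qed.

Section L2_theory.
Variables (R : realType) (n : nat) (D : set 'rV[R]_n.+1).
Hypothesis mD : measurable D.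

Local Notation E := 'rV[R]_n.+1.
Local Notation mu := (leb R n.+1).
Implicit Types f g h : E -> R.

Lemma L2_measurable f : L2 D f -> measurable_fun D f.
Proof. by case. Qed.

Lemma L2_integrable_sqr f : L2 D f -> mu.-integrable D (EFin \o (fun x => f x ^+ 2)).
Proof.
move=> [mf ff]; apply/integrableP; split.
  by apply/measurable_EFinP; exact: measurable_funX.
by under eq_integral => x _ do rewrite /= ger0_norm ?sqr_ge0//.
Qed.

Lemma integrable_sqr_L2 f : measurable_fun D f ->
  mu.-integrable D (EFin \o (fun x => f x ^+ 2)) -> L2 D f.
Proof.
move=> mf /integrableP[_ ff]; split => //.
by under eq_integral => x _ do rewrite -[(_ ^+ 2)%R]ger0_norm ?sqr_ge0//.
Qed.

Lemma L2_integrable_mul f g : L2 D f -> L2 D g ->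
  mu.-integrable D (EFin \o (fun x => f x * g x)).
Proof.
move=> Lf Lg.
apply: (@le_integrable _ _ _ mu D mD _
  (EFin \o (fun x => f x ^+ 2 + g x ^+ 2))) => //.
- apply/measurable_EFinP; apply: measurable_funM; exact: L2_measurable.
- move=> x _ /=; rewrite lee_fin [leRHS]ger0_norm ?addr_ge0 ?sqr_ge0//.
  by rewrite ler_norml; apply/andP; split; nra.
- exact: (integrableD mD (L2_integrable_sqr Lf) (L2_integrable_sqr Lg)).
Qed.

Lemma ipC f g : ip D f g = ip D g f.
Proof. by apply: eq_Rintegral => x _; rewrite mulrC. Qed.

Lemma ip_eq f f' g g' : (forall x, D x -> f x = f' x) ->
  (forall x, D x -> g x = g' x) -> ip D f g = ip D f' g'.
Proof.
by move=> ff gg; apply: eq_Rintegral => x /set_mem Dx; rewrite ff// gg.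
Qed.

Lemma L2_eq f g : (forall x, D x -> f x = g x) -> L2 D f -> L2 D g.
Proof.
move=> fg [mf ff]; split.
  by apply: eq_measurable_fun mf => x /set_mem Dx; exact: fg.
by under eq_integral => x /set_mem Dx do rewrite -fg//.
Qed.

Lemma L2_0 : L2 D (fun=> 0).
Proof.
apply: integrable_sqr_L2 => //.
by rewrite /comp expr0n; exact: integrable0.
Qed.

Lemma L2_D f g : L2 D f -> L2 D g -> L2 D (fun x => f x + g x).
Proof.
move=> Lf Lg.
apply: integrable_sqr_L2.
  by apply: measurable_funD; exact: L2_measurable.
apply: (@eq_integrable _ _ _ mu D mD
  ((EFin \o (fun x => f x ^+ 2)%R) \+ (EFin \o (fun x => f x * g x)%R)
   \+ ((EFin \o (fun x => f x * g x)%R) \+ (EFin \o (fun x => g x ^+ 2)%R)))%E).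
  by move=> x _ /=; rewrite -!EFinD; congr (_%:E); ring.
by do !apply: integrableD => //;
   first [exact: L2_integrable_sqr|exact: L2_integrable_mul].
Qed.

Lemma L2_Z a f : L2 D f -> L2 D (fun x => a * f x).
Proof.
move=> Lf; apply: integrable_sqr_L2.
  by apply: measurable_funM => //; exact: L2_measurable.
apply: (@eq_integrable _ _ _ mu D mD
  (fun x => (a ^+ 2)%:E * (EFin \o (fun x => f x ^+ 2)%R) x)%E).
  by move=> x _ /=; rewrite -EFinM; congr (_%:E); ring.
by apply: integrableZl => //; exact: L2_integrable_sqr.
Qed.

Lemma L2_N f : L2 D f -> L2 D (fun x => - f x).
Proof. by move/(L2_Z (-1)); apply: L2_eq => x _; rewrite mulN1r. Qed.

Lemma L2_B f g : L2 D f -> L2 D g -> L2 D (fun x => f x - g x).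
Proof. by move=> Lf Lg; apply: (L2_D Lf); exact: L2_N. Qed.

Lemma L2_sum (I : Type) (s : seq I) (F : I -> E -> R) :
  (forall i, L2 D (F i)) -> L2 D (fun x => \sum_(i <- s) F i x).
Proof.
move=> LF; elim: s => [|i s IH].
  by apply: L2_eq L2_0 => x _; rewrite big_nil.
by apply: L2_eq (L2_D (LF i) IH) => x _; rewrite big_cons.
Qed.

Lemma ipDl f f' g : L2 D f -> L2 D f' -> L2 D g ->
  ip D (fun x => f x + f' x) g = ip D f g + ip D f' g.
Proof.
move=> Lf Lf' Lg; rewrite /ip -RintegralD//; try exact: L2_integrable_mul.
by apply: eq_Rintegral => x _; rewrite mulrDl.
Qed.

Lemma ipZl a f g : L2 D f -> L2 D g -> ip D (fun x => a * f x) g = a * ip D f g.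
Proof.
move=> Lf Lg; rewrite /ip -RintegralZl//; try exact: L2_integrable_mul.
by apply: eq_Rintegral => x _; rewrite mulrA.
Qed.

Lemma ipNl f g : L2 D f -> L2 D g -> ip D (fun x => - f x) g = - ip D f g.
Proof.
by move=> Lf Lg; rewrite -mulN1r -ipZl//; apply: ip_eq => // x _; rewrite mulN1r.
Qed.

Lemma ipBl f f' g : L2 D f -> L2 D f' -> L2 D g ->
  ip D (fun x => f x - f' x) g = ip D f g - ip D f' g.
Proof. by move=> Lf Lf' Lg; rewrite ipDl ?ipNl//; exact: L2_N. Qed.

Lemma ipDr f g g' : L2 D f -> L2 D g -> L2 D g' ->
  ip D f (fun x => g x + g' x) = ip D f g + ip D f g'.
Proof. by move=> *; rewrite ipC ipDl// !(ipC f). Qed.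

Lemma ipZr a f g : L2 D f -> L2 D g -> ip D f (fun x => a * g x) = a * ip D f g.
Proof. by move=> *; rewrite ipC ipZl// ipC. Qed.

Lemma ipBr f g g' : L2 D f -> L2 D g -> L2 D g' ->
  ip D f (fun x => g x - g' x) = ip D f g - ip D f g'.
Proof. by move=> *; rewrite ipC ipBl// !(ipC f). Qed.

Lemma ip0l g : ip D (fun=> 0) g = 0.
Proof.
rewrite /ip /Rintegral; under eq_integral do rewrite mul0r.
by rewrite integral0.
Qed.

Lemma ip0r g : ip D g (fun=> 0) = 0.
Proof. by rewrite ipC ip0l. Qed.

Lemma ip_ge0 f : 0 <= ip D f f.
Proof. by apply: Rintegral_ge0 => x _; rewrite -expr2 sqr_ge0. Qed.

Lemma ip_CS f g : L2 D f -> L2 D g ->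
  ip D f g ^+ 2 <= ip D f f * ip D g g.
Proof.
move=> Lf Lg; apply: discr_le => t.
have := ip_ge0 (fun x => f x + t * g x).
have Ltg := L2_Z t Lg.
rewrite ipDl// ?ipDr// ?ipZl// ?ipZr//; last exact: L2_D.
rewrite (ipC g f); suff -> : forall a b c : R,
  a + t * b + (t * b + t * (t * c)) = a + 2 * t * b + t ^+ 2 * c by [].
by move=> *; ring.
Qed.

Lemma ip_null f g : L2 D f -> L2 D g -> ip D f f = 0 -> ip D f g = 0.
Proof.
move=> Lf Lg f0; have := ip_CS Lf Lg; rewrite f0 mul0r => h.
by apply/eqP; rewrite -sqrf_eq0; apply/eqP/le_anti; rewrite h sqr_ge0.
Qed.

End L2_theory.

Lemma L2_S (R : realType) (n : nat) (A B : set 'rV[R]_n.+1) f :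
  measurable A -> measurable B -> A `<=` B -> L2 B f -> L2 A f.
Proof.
move=> mA mB AB Lf; apply: integrable_sqr_L2 => //.
  exact: measurable_funS (L2_measurable Lf).
exact: (integrableS mB mA AB (L2_integrable_sqr Lf)).
Qed.

(** * Completeness of L2 (Riesz-Fischer) *)

Section L2_completeness.
Variables (R : realType) (n : nat) (D : set 'rV[R]_n.+1).
Hypothesis mD : measurable D.

Local Notation E := 'rV[R]_n.+1.
Local Notation mu := (leb R n.+1).
Implicit Types f g h : E -> R.

Lemma ip_EFin f : L2 D f ->
  (ip D f f)%:E = (\int[mu]_(x in D) (f x ^+ 2)%:E)%E.
Proof.
move=> Lf; rewrite /ip /Rintegral fineK; last first.
  by apply: integrable_fin_num => //; exact: L2_integrable_mul.
by apply: eq_integral => x _; rewrite expr2.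
Qed.

Lemma sum_half_le (N : nat) : \sum_(0 <= j < N) (2^-1 : R) ^+ j <= 2.
Proof.
suff -> : \sum_(0 <= j < N) (2^-1 : R) ^+ j = 2 - 2 * 2^-1 ^+ N.
  by rewrite gerBl mulr_ge0// exprn_ge0// invr_ge0.
elim: N => [|N IH]; first by rewrite big_nil expr0 mulr1 subrr.
by rewrite big_nat_recr//= IH exprS; field.
Qed.

(** The hypothesis says [|d j| <= sqrt c / 2^j], so a geometric series dominates. *)
Lemma cvg_of_wsum_sqr (d : nat -> R) (c : R) :
  (forall j, 4 ^+ j * d j ^+ 2 <= c) -> cvgn (series d).
Proof.
move=> dc; apply: normed_cvg.
apply: (@series_le_cvg _ _ (geometric (Num.sqrt c) 2^-1)).
- by move=> j; exact: normr_ge0.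
- by move=> j; rewrite /= mulr_ge0 ?sqrtr_ge0// exprn_ge0.
- move=> j; rewrite /= exprVn ler_pdivlMr ?exprn_gt0//.
  rewrite -[leLHS]ger0_norm ?mulr_ge0// -sqrtr_sqr ler_wsqrtr//.
  rewrite exprMn real_normK ?num_real// mulrC -exprM mulnC exprM.
  by rewrite -natrX; exact: dc.
- by apply: is_cvg_geometric_series; rewrite ger0_norm; lra.
Qed.

Section fast_sequence.
Variable h : nat -> E -> R.
Hypothesis Lh : forall j, L2 D (h j).
Hypothesis dh : forall j,
  ip D (fun x => h j.+1 x - h j x) (fun x => h j.+1 x - h j x) <= 8^-1 ^+ j.

(** The function [sum_j 4^j (h_(j+1) - h_j)^2] has integral at most [sum_j 4^j / 8^j <= 2], hence is
    finite off a null set, and where it is finite the increments are summable. Multiplying by the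
    indicator of that set [G] gives a sequence that converges at every point of [D], which makes the
    limit measurable. *)
Lemma fast_L2_cvg : exists G : set E, exists g : E -> R,
  [/\ measurable G, G `<=` D, mu (D `\` G) = 0, measurable_fun D g
    & forall x, D x -> (fun j => h j x * \1_G x) @ \oo --> g x].
Proof.
pose a j x := (4 ^+ j * (h j.+1 x - h j x) ^+ 2 : R).
have a0 j x : 0 <= a j x by rewrite mulr_ge0 ?sqr_ge0// exprn_ge0.
have ma j : measurable_fun D (fun x => (a j x)%:E).
  apply/measurable_EFinP; apply: measurable_funM => //.
  by apply: measurable_funX; apply: measurable_funB; exact: L2_measurable.
pose A x := (\sum_(j <oo) (a j x)%:E)%E.
have mA : measurable_fun D A.
  apply: ge0_emeasurable_sum => // k x _ _; by rewrite lee_fin.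
have A0 x : (0 <= A x)%E by apply: nneseries_ge0 => j _ _; rewrite lee_fin.
have intA : mu.-integrable D A.
  apply/integrableP; split => //.
  under eq_integral => x _ do rewrite gee0_abs//.
  rewrite integral_nneseries//; last by move=> j x _; rewrite lee_fin.
  apply: (@le_lt_trans _ _ 2%:E); last exact: ltry.
  apply: lime_le.
    by apply: is_cvg_nneseries => j _ _; apply: integral_ge0 => x _; rewrite lee_fin.
  apply: nearW => N.
  apply: (@le_trans _ _ (\sum_(0 <= j < N) (2^-1 ^+ j)%:E)%E); last first.
    by rewrite sumEFin lee_fin sum_half_le.
  apply: lee_sum => j _.
  rewrite (_ : (\int[mu]_(x in D) _)%E =
     (4 ^+ j * ip D (fun x => h j.+1 x - h j x) (fun x => h j.+1 x - h j x))%:E).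
    rewrite lee_fin (_ : 2^-1 = 4 * 8^-1 :> R); last by field.
    by rewrite exprMn ler_wpM2l// exprn_ge0.
  rewrite EFinM ip_EFin; last by apply: L2_B.
  rewrite -ge0_integralZl_EFin ?exprn_ge0//.
  all: try by move=> x _; rewrite lee_fin sqr_ge0.
  by apply/measurable_EFinP; apply: measurable_funX; apply: measurable_funB; exact: L2_measurable.
pose G := D `&` [set x | A x \is a fin_num].
have mG : measurable G by exact: emeasurable_fin_num.
have cvh x : D x -> cvgn (fun j => h j x * \1_G x).
  move=> Dx; have [Gx|nGx] := pselect (G x); last first.
    rewrite (_ : (fun _ => _) = cst 0); first exact: is_cvg_cst.
    by apply/funext => j; rewrite indicE memNset// mulr0.
  have -> : (fun j => h j x * \1_G x) =
      (fun j => h 0%N x + series (fun j => h j.+1 x - h j x) j).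
    apply/funext => j; rewrite indicE mem_set// mulr1 /series/=.
    by rewrite telescope_sumr// addrC subrK.
  apply: is_cvgD; first exact: is_cvg_cst.
  have [_ /= Afin] := Gx.
  apply: (@cvg_of_wsum_sqr _ (fine (A x))) => j.
  rewrite -lee_fin fineK//.
  apply: le_trans (nneseries_lim_ge j.+1 _) => //=.
    by rewrite big_nat_recr//= leeDr// sume_ge0// => k _; rewrite lee_fin.
  by move=> k _ _; rewrite lee_fin.
exists G, (fun x => limn (fun j => h j x * \1_G x)); split => //.
- by move=> x [].
- have [N [mN N0 sN]] := integrable_ae mD intA.
  apply: (subset_measure0 _ mN) => //; first exact: measurableD.
  by move=> x [Dx nGx]; apply: sN => /= /(_ Dx) Afin; apply: nGx; split.
- apply: (@measurable_fun_cvg _ _ _ _ (fun j x => h j x * \1_G x)).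
    move=> j; apply: measurable_funM; first exact: L2_measurable.
    exact: measurable_indic.
  by move=> x Dx; exact: cvh.
Qed.

(** Fatou's lemma for the sequence cut off to [G]. The shift by [i] keeps only the indices for which
    the bound [c] holds, and the cut-off changes each integrand on a null set only. *)
Lemma fatou_sqr (G : set E) (f g : E -> R) (c : R) i :
  L2 D f -> measurable G -> G `<=` D -> mu (D `\` G) = 0 -> measurable_fun D g ->
  (forall x, D x -> (fun j => h j x * \1_G x) @ \oo --> g x) ->
  (forall j, (i <= j)%N -> ip D (fun x => f x - h j x) (fun x => f x - h j x) <= c) ->
  (\int[mu]_(x in D) ((f x - g x) ^+ 2)%:E <= c%:E)%E.
Proof.
move=> Lf mG GD G0 mg cvg_g fc.
pose F j x := ((f x - h (j + i)%N x * \1_G x) ^+ 2)%:E.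
have mF j : measurable_fun D (F j).
  apply/measurable_EFinP; apply: measurable_funX.
  apply: measurable_funB; first exact: L2_measurable.
  by apply: measurable_funM; [exact: L2_measurable|exact: measurable_indic].
have F0 j x : D x -> (0 <= F j x)%E by move=> _; rewrite lee_fin sqr_ge0.
have := @fatou _ _ _ mu D mD F mF F0.
rewrite (eq_integral (fun x => ((f x - g x) ^+ 2)%:E)); last first.
  move=> x /set_mem Dx.
  have cF : F ^~ x @ \oo --> ((f x - g x) ^+ 2)%:E.
    apply: cvg_EFin; first exact: nearW.
    rewrite /comp /=.
    under eq_fun do rewrite expr2.
    rewrite expr2; suff H : (fun j => f x - h (j + i)%N x * \1_G x) @ \oo --> f x - g x.
      by apply: cvgM.
    apply: cvgB; first exact: cvg_cst.
    have := cvg_g x Dx.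
    by rewrite -(cvg_shiftn i).
  rewrite is_cvg_limn_einfE; first exact: cvg_lim cF.
  by apply/cvg_ex; exists ((f x - g x) ^+ 2)%:E.
move=> /le_trans; apply.
rewrite limn_einf_lim; apply: lime_le; first exact: is_cvg_einfs.
apply: nearW => j.
apply: (@le_trans _ _ (\int[mu]_(x in D) F j x)%E).
  by apply: ereal_inf_lbound; exists j => /=.
have Li : L2 D (fun x => f x - h (j + i)%N x) by apply: L2_B.
rewrite (ae_eq_integral (fun x => ((f x - h (j + i)%N x) ^+ 2)%:E)) => //.
- by rewrite -ip_EFin// lee_fin fc// leq_addl.
- by apply/measurable_EFinP; apply: measurable_funX; exact: L2_measurable.
- exists (D `\` G); split => //; first exact: measurableD.
  move=> x /=; rewrite /F => nx; split; first by apply: contrapT => nD; apply: nx.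
  by move=> Gx; apply: nx => Dx; rewrite indicE mem_set// mulr1.
Qed.

End fast_sequence.

Lemma L2_complete (f : nat -> E -> R) : (forall k, L2 D (f k)) ->
  (forall e, 0 < e -> exists N, forall k l, (N <= k)%N -> (N <= l)%N ->
     ip D (fun x => f k x - f l x) (fun x => f k x - f l x) <= e) ->
  exists2 g, L2 D g & forall e, 0 < e -> exists N, forall k, (N <= k)%N ->
     ip D (fun x => f k x - g x) (fun x => f k x - g x) <= e.
Proof.
move=> Lf cf.
have /choice[N NP] : forall j, exists N, forall k l, (N <= k)%N -> (N <= l)%N ->
    ip D (fun x => f k x - f l x) (fun x => f k x - f l x) <= 8^-1 ^+ j.
  by move=> j; apply: cf; rewrite exprn_gt0// invr_gt0.
(* Cumulative sums of [N] give a monotone choice of indices that still lie above [N j]. *)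
pose m j := (\sum_(0 <= i < j.+1) N i)%N.
have mN j : (N j <= m j)%N by rewrite /m big_nat_recr//= leq_addl.
have mm j k : (j <= k)%N -> (m j <= m k)%N.
  by move=> jk; rewrite /m (@big_cat_nat _ _ _ j.+1 0 k.+1)//= leq_addr.
have Lh j : L2 D (f (m j)) by [].
have dh j : ip D (fun x => f (m j.+1) x - f (m j) x)
                 (fun x => f (m j.+1) x - f (m j) x) <= 8^-1 ^+ j.
  by apply: NP => //; exact: leq_trans (mN j) (mm _ _ (leqnSn j)).
have [G [g [mG GD G0 mg cg]]] := fast_L2_cvg Lh dh.
have key j k : (N j <= k)%N ->
    (\int[mu]_(x in D) ((f k x - g x) ^+ 2)%:E <= (8^-1 ^+ j)%:E)%E.
  move=> jk; apply: (fatou_sqr Lh (Lf k) mG GD G0 mg cg (i := j)).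
  by move=> l jl; apply: NP => //; exact: leq_trans (mN j) (mm _ _ jl).
have Ld j k : (N j <= k)%N -> L2 D (fun x => f k x - g x).
  move=> jk; split; first by apply: measurable_funB => //; exact: L2_measurable.
  by apply: le_lt_trans (key _ _ jk) _; exact: ltry.
exists g.
  apply: (@L2_eq _ _ _ (fun x => f (N 0%N) x - (f (N 0%N) x - g x))).
    by move=> x _; rewrite opprB addrC subrK.
  by apply: L2_B => //; exact: (Ld 0%N).
move=> e e0.
have [j je] : exists j, (8^-1 : R) ^+ j <= e.
  have /cvgrPdist_le/(_ e e0) [j _ /(_ j (leqnn j))] :
      (fun j => (8^-1 : R) ^+ j) @ \oo --> (0 : R).
    by apply: cvg_expr; rewrite ger0_norm; lra.
  rewrite /= sub0r normrN ger0_norm ?exprn_ge0// => ?; by exists j.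
exists (N j) => k jk; apply: le_trans je.
by rewrite -lee_fin ip_EFin; [exact: key|exact: (Ld j)].
Qed.

End L2_completeness.

(** * The Riesz representation theorem *)

Section riesz.
Variables (R : realType) (V : lmodType R) (P : V -> Prop) (B : V -> V -> R).
Hypothesis P0 : P 0.
Hypothesis Plin : forall a x y, P x -> P y -> P (a *: x + y).
Hypothesis BC : forall x y, P x -> P y -> B x y = B y x.
Hypothesis Blin : forall a x y z, P x -> P y -> P z ->
  B (a *: x + y) z = a * B x z + B y z.
Hypothesis Bge0 : forall x, P x -> 0 <= B x x.
Hypothesis Bcomplete : forall u : nat -> V, (forall k, P (u k)) ->
  (forall e, 0 < e -> exists N, forall k l, (N <= k)%N -> (N <= l)%N ->
     B (u k - u l) (u k - u l) <= e) ->
  exists2 x, P x & forall e, 0 < e -> exists N, forall k, (N <= k)%N ->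
     B (u k - x) (u k - x) <= e.
Variables (l : V -> R) (C : R).
Hypothesis C0 : 0 <= C.
Hypothesis llin : forall a x y, P x -> P y -> l (a *: x + y) = a * l x + l y.
Hypothesis lbnd : forall x, P x -> l x ^+ 2 <= C * B x x.

Let PD x y : P x -> P y -> P (x + y).
Proof. by move=> Px Py; rewrite -[x]scale1r; exact: Plin. Qed.

Let PZ a x : P x -> P (a *: x).
Proof. by move=> Px; rewrite -[_ *: _]addr0; exact: Plin. Qed.

Let PB x y : P x -> P y -> P (x - y).
Proof. by move=> Px Py; rewrite -scaleN1r; apply: PD => //; exact: PZ. Qed.

Let Bquad t x z : P x -> P z ->
  B (t *: z + x) (t *: z + x) = B x x + 2 * t * B x z + t ^+ 2 * B z z.
Proof.
move=> Px Pz; have Ptz := PZ t Pz.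
rewrite Blin//; last exact: Plin.
rewrite (@BC z)//; last exact: Plin.
rewrite (@BC x (_ + _))//; last exact: Plin.
by rewrite !Blin// (@BC z x)//; ring.
Qed.

Let CS x z : P x -> P z -> B x z ^+ 2 <= B x x * B z z.
Proof.
by move=> Px Pz; apply: discr_le => t; rewrite -Bquad// Bge0//; exact: Plin.
Qed.

Let J x := B x x - 2 * l x.

Let Jquad t x z : P x -> P z ->
  J (t *: z + x) = J x + 2 * t * (B x z - l z) + t ^+ 2 * B z z.
Proof. by move=> Px Pz; rewrite /J Bquad// llin//; ring. Qed.

Let Jlb x : P x -> - C <= J x.
Proof.
move=> Px; have := lbnd Px; have := Bge0 Px; rewrite /J.
set b := B x x; set m := l x => b0 mC.
have [b00|b00] := eqVneq b 0.
  move: mC; rewrite b00 mulr0 => m0.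
  suff -> : m = 0 by rewrite mulr0 subr0 oppr_le0.
  by apply/eqP; rewrite -sqrf_eq0; apply/eqP/le_anti; rewrite m0 sqr_ge0.
have bp : 0 < b by rewrite lt0r b00.
rewrite -subr_ge0 opprK -(pmulr_rge0 _ bp).
have : (m - b) ^+ 2 >= 0 by rewrite sqr_ge0.
by nra.
Qed.

Let infJ := inf [set J x | x in P].

Let infJ_le x : P x -> infJ <= J x.
Proof.
move=> Px; apply: ge_inf; last by exists x.
by exists (- C) => _ [y Py <-]; exact: Jlb.
Qed.

Let min_seq k : exists x, P x /\ J x <= infJ + k.+1%:R^-1.
Proof.
have k0 : 0 < k.+1%:R^-1 :> R by rewrite invr_gt0.
have : has_inf [set J x | x in P].
  split; first by exists (J 0), 0.
  by exists (- C) => _ [y Py <-]; exact: Jlb.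
move/inf_adherent => /(_ _ k0) [_ [x Px <-]] /ltW xJ.
by exists x.
Qed.

(** [J x = B x x - 2 l x] is bounded below by [- C]. Since its values at midpoints are at least the
    infimum, a minimizing sequence is Cauchy. Perturbing its members by [s z] gives a nonnegative
    quadratic in [s], whose discriminant bounds [B (u k) z - l z]. As [B] is only semidefinite, the
    passage to the limit goes through Cauchy-Schwarz. *)
Lemma riesz_representation : exists2 t, P t & forall x, P x -> B t x = l x.
Proof.
have /choice[u uP] := min_seq.
have Pu k : P (u k) by have [] := uP k.
have [ek [Ju small]] : exists ek : nat -> R, (forall k, J (u k) <= infJ + ek k) /\
    forall e, 0 < e -> exists N, forall k, (N <= k)%N -> ek k <= e.
  exists (fun k => k.+1%:R^-1); split; first by move=> k; have [] := uP k.
  move=> e e0; have /cvgrPdist_le/(_ e e0) [N _ NP] := @cvg_harmonic R.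
  exists N => k /NP /=; rewrite sub0r normrN ger0_norm//.
have Jmid k j : B (u k - u j) (u k - u j) <= 2 * ek k + 2 * ek j.
  have Pd : P (u k - u j) by exact: PB.
  (* The point tested is the midpoint of [u k] and [u j]. *)
  have := infJ_le (Plin 2^-1 Pd (Pu j)).
  rewrite Jquad// => hm.
  have uE : u k = 1 *: (u k - u j) + u j by rewrite scale1r subrK.
  have hk := Ju k; rewrite uE Jquad// in hk; have hj := Ju j.
  move: hj hk hm; rewrite expr1n !mul1r mulr1.
  have -> : 2 * 2^-1 = 1 :> R by field.
  have -> : 2^-1 ^+ 2 = 4^-1 :> R by field.
  move: (infJ) (J _) (B _ _) (B _ _) (l _) => i x b c d hj hk hm.
  lra.
have [t Pt tP] : exists2 x, P x & forall e, 0 < e -> exists N, forall k, (N <= k)%N ->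
     B (u k - x) (u k - x) <= e.
  apply: Bcomplete => // e e0.
  have [N NP] := small (e / 4) ltac:(by rewrite divr_gt0).
  exists N => k j Nk Nj; apply: le_trans (Jmid k j) _.
  by have := NP _ Nk; have := NP _ Nj; lra.
exists t => // z Pz.
have near k : (B (u k) z - l z) ^+ 2 <= ek k * B z z.
  apply: discr_le => s; have := infJ_le (Plin s Pz (Pu k)).
  rewrite Jquad//; have := Ju k; lra.
have Pd k : P (u k - t) by exact: PB.
have key e : 0 < e -> (B t z - l z) ^+ 2 <= 4 * e * B z z.
  move=> e0; have [N NP] := small e e0; have [M MP] := tP e e0.
  pose k := maxn N M.
  have h1 := near k; have h2 := CS (Pd k) Pz.
  have : B (u k - t) z = B (u k) z - B t z.
    by rewrite addrC -scaleN1r Blin//; ring.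
  move=> h3; rewrite h3 in h2.
  have bz := Bge0 Pz.
  have {}h1 : (B (u k) z - l z) ^+ 2 <= e * B z z.
    by apply: le_trans h1 _; rewrite ler_wpM2r// NP// leq_maxl.
  have {}h2 : (B (u k) z - B t z) ^+ 2 <= e * B z z.
    by apply: le_trans h2 _; rewrite ler_wpM2r// MP// leq_maxr.
  have : (B t z - l z) ^+ 2 <= 2 * (B (u k) z - l z) ^+ 2 + 2 * (B (u k) z - B t z) ^+ 2.
    have := sqr_ge0 ((B (u k) z - l z) + (B (u k) z - B t z)); nra.
  lra.
apply/eqP; rewrite -subr_eq0 -sqrf_eq0; apply/eqP/le_anti; rewrite sqr_ge0 andbT.
apply/ler_addgt0Pr => e e0; rewrite add0r.
have bz := Bge0 Pz.
have e'0 : 0 < e / (4 * (B z z + 1)) by rewrite divr_gt0//; lra.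
apply: le_trans (key _ e'0) _.
rewrite (_ : 4 * _ * _ = e * (B z z / (B z z + 1))); last by field; lra.
by rewrite ler_piMr ?ler_pdivrMr; lra.
Qed.

End riesz.

(** * Lebesgue measure on row vectors *)

Section rV_norm.
Variables (R : realType) (n : nat).

Lemma coord_le_norm (x : 'rV[R]_n) i : `|x ord0 i| <= `|x|.
Proof.
rewrite [leRHS]/Num.norm /= mx_normrE; apply/bigmax_geP; right => /=.
by exists (ord0, i).
Qed.

Lemma rV_norm_le (M : R) (x : 'rV[R]_n) : 0 <= M ->
  (forall i, `|x ord0 i| <= M) -> `|x| <= M.
Proof.
move=> M0 H; rewrite [leLHS]/Num.norm /= mx_normrE; apply/bigmax_leP; split => //.
by move=> [i j] _ /=; rewrite (ord1 i).
Qed.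

Lemma rV_norm_lt (M : R) (x : 'rV[R]_n) : 0 < M ->
  (forall i, `|x ord0 i| < M) -> `|x| < M.
Proof.
move=> M0 H; rewrite [ltLHS]/Num.norm /= mx_normrE; apply/bigmax_ltP; split => //.
by move=> [i j] _ /=; rewrite (ord1 i).
Qed.

End rV_norm.

(** * Borel measurability on row vectors *)

Section rV_measurable.
Variables (R : realType) (n : nat).

Lemma measurable_ball_rV (x : 'rV[R]_n) (e : R) : measurable (ball x e).
Proof.
have [e0|e0] := leP e 0.
  rewrite (_ : ball x e = set0)//; apply/seteqP; split => // y [].
  by rewrite ltNge e0.
rewrite (_ : ball x e =
   \bigcap_(i in [set: 'I_n]) ((fun y : 'rV[R]_n => y ord0 i) @^-1` (ball (x ord0 i) e))).
  apply: fin_bigcap_measurable => // i _.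
  rewrite -[X in measurable X]setTI; apply: measurable_coor => //.
  by apply: open_measurable; exact: ball_open.
rewrite /ball /= /mx_ball; apply/seteqP; split => [y [_ H] i _|y H] /=; first exact: H.
by split => // i j; rewrite (ord1 i); exact: H.
Qed.

(** The balls have rational centres and radii [1/(k+1)] and are enumerated by [unpickle]. Radius 0,
    which gives an empty ball, replaces those not contained in [A]. *)
Lemma open_bigcup_ball (A : set 'rV[R]_n) : open A ->
  exists (x : nat -> 'rV[R]_n) (r : nat -> R), A = \bigcup_k ball (x k) (r k).
Proof.
move=> oA.
pose q (p : 'rV[rat]_n * nat) : 'rV[R]_n := map_mx ratr p.1.
pose r (p : 'rV[rat]_n * nat) : R :=
  if `[< ball (q p) p.2.+1%:R^-1 `<=` A >] then p.2.+1%:R^-1 else 0.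
exists (fun k => if unpickle k is Some p then q p else 0),
       (fun k => if unpickle k is Some p then r p else 0).
apply/seteqP; split; last first.
  move=> x [k _]; case: unpickle => [p|]; last by case; rewrite ltxx.
  by rewrite /r; case: asboolP => [H|_ []]; [exact: H|rewrite ltxx].
move=> x Ax; have /nbhs_ballP [e /= e0 eA] : nbhs x A by exact: open_nbhs_nbhs.
have [k ke] : exists k : nat, k.+1%:R^-1 < e / 2.
  have /cvgrPdist_lt/(_ (e / 2)) := @cvg_harmonic R.
  move=> /(_ (divr_gt0 e0 (ltr0n _ 2))) [N _ NP].
  by exists N; have := NP N (leqnn N); rewrite /= sub0r normrN ger0_norm.
have k0 : 0 < k.+1%:R^-1 :> R by rewrite invr_gt0.
have /choice[c cP] : forall i, exists c : rat, ball (x ord0 i) (k.+1%:R^-1) (ratr c).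
  move=> i; have lt : x ord0 i - k.+1%:R^-1 < x ord0 i + k.+1%:R^-1.
    by rewrite ltrD2l (lt_trans _ k0)// oppr_lt0.
  have [c] := rat_in_itvoo lt.
  by rewrite in_itv/= => /andP[? ?]; exists c; rewrite /ball /= ltr_distlC; apply/andP.
have xq : ball x k.+1%:R^-1 (q (\row_i c i, k)).
  by split => // i j; rewrite (ord1 i) !mxE; exact: cP.
exists (pickle (\row_i c i, k)) => //; rewrite pickleK /r /=.
case: asboolP => [_|]; first exact: ball_sym.
case => y qy; apply: eA.
apply: (le_ball (ltW _)); last exact: ball_triangle xq qy.
by rewrite [e]splitr ltrD.
Qed.

Lemma open_measurable_rV (A : set 'rV[R]_n) : open A -> measurable A.
Proof.
move=> /open_bigcup_ball[x [r ->]]; apply: bigcupT_measurable => k.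
exact: measurable_ball_rV.
Qed.

Lemma continuous_measurable_rV (f : 'rV[R]_n -> R) : continuous f ->
  measurable_fun setT f.
Proof.
move=> cf; apply: (measurability (@RGenOInfty.G R)) => //.
  exact: RGenOInfty.measurableE.
move=> _ [_ [x ->] <-]; rewrite setTI; apply: open_measurable_rV.
by apply: open_comp => // y _; exact: cf.
Qed.

End rV_measurable.

(** * Sigma-finiteness, Tonelli and Fubini for [leb] *)

Section leb_box.
Variable R : realType.

Definition cbox n (M : R) : set 'rV[R]_n := [set x | forall i, `|x ord0 i| <= M].

Lemma measurable_cbox n M : measurable (@cbox n M).
Proof.
rewrite (_ : cbox M =
   \bigcap_(i in [set: 'I_n]) ((fun y : 'rV[R]_n => y ord0 i) @^-1` `[- M, M]%classic)).
  apply: fin_bigcap_measurable => // i _.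
  rewrite -[X in measurable X]setTI; exact: measurable_coor.
apply/seteqP; split => [y H i _|y H i] /=; first by rewrite in_itv/= -ler_norml; exact: H.
by have := H i I; rewrite /= in_itv/= -ler_norml.
Qed.

Lemma row_cons0 n (p : R * 'rV[R]_n) : row_cons p ord0 ord0 = p.1.
Proof.
have := row_mxEl (const_mx p.1 : 'rV_1) p.2 ord0 ord0; rewrite [X in _ = X]mxE => <-.
by congr (row_mx _ _ _ _); exact/val_inj.
Qed.

Lemma row_consS n (p : R * 'rV[R]_n) i : row_cons p ord0 (lift ord0 i) = p.2 ord0 i.
Proof.
rewrite -(row_mxEr (const_mx p.1 : 'rV_1) p.2).
by congr (row_mx _ _ _ _); exact/val_inj.
Qed.

Lemma row_cons_cbox n M : @row_cons R n @^-1` cbox M = `[- M, M]%classic `*` cbox M.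
Proof.
apply/seteqP; split=> [[x y] /= H|[x y] /= [H1 H2] i].
  split => [|i]; first by have := H ord0; rewrite row_cons0 /= in_itv/= ler_norml.
  by have := H (lift ord0 i); rewrite row_consS.
have [j ->|->] := unliftP ord0 i; first by rewrite row_consS; exact: H2.
by rewrite row_cons0 ler_norml; move: H1; rewrite /= in_itv.
Qed.

Lemma leb_cbox_lty n M : (leb R n (cbox M) < +oo)%E.
Proof.
elim: n => [|n IH] /=.
  by rewrite diracE ltry.
rewrite /pushforward row_cons_cbox product_measure2E//; last exact: measurable_cbox.
apply: lte_mul_pinfty => //.
have : @lebesgue_measure R [set` `[- M, M]] \is a fin_num.
  by rewrite lebesgue_measure_itv/=; case: ifP.
exact.
Qed.

Lemma leb_sigma_finite n : sigma_finite setT (leb R n).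
Proof.
exists (fun k => cbox k%:R); last by move=> k; split; [exact: measurable_cbox|exact: leb_cbox_lty].
apply/seteqP; split => // x _; exists (Num.bound `|x|) => //= i.
apply: le_trans (coord_le_norm _ _) _; apply/ltW/archi_boundP => //.
Qed.

(** The set function of [leb R n] under a name of its own, to which the sigma-finite structure
    required by Fubini's theorem is attached. *)
Definition lebsf n : set 'rV[R]_n -> \bar R := leb R n.

Section lebsf_measure.
Variable n : nat.

HB.instance Definition _ := isMeasure.Build _ _ _ (@lebsf n)
  (measure0 (leb R n)) (measure_ge0 (leb R n)) (@measure_semi_sigma_additive _ _ _ (leb R n)).

HB.instance Definition _ :=
  Measure_isSigmaFinite.Build _ _ _ (@lebsf n) (leb_sigma_finite n).

End lebsf_measure.

Local Notation lam := (@lebesgue_measure R).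

Section tonelli.
Variables (n : nat) (f : 'rV[R]_n.+1 -> \bar R).
Hypotheses (mf : measurable_fun setT f) (f0 : forall x, (0 <= f x)%E).

(** [leb] is the image of a product built with [\x^], whereas the Fubini theorems speak of [\x].
    Both products agree on rectangles, and sigma-finiteness makes them equal. *)
Lemma leb_tonelli_cons :
  (\int[leb R n.+1]_x f x = \int[lam \x @lebsf n]_p f (row_cons p))%E.
Proof.
rewrite /= ge0_integral_pushforward//; last exact: measurable_row_cons.
apply: eq_measure_integral => //= A mA _; apply/esym.
by apply: product_measure_unique => // B C mB mC/=; rewrite product_measure2E.
Qed.

Let mfc : measurable_fun setT (f \o @row_cons R n).
Proof. by apply: measurableT_comp => //; exact: measurable_row_cons. Qed.

Lemma leb_tonelli21 :
  (\int[leb R n.+1]_x f x = \int[leb R n]_y \int[lam]_x f (row_cons (x, y)))%E.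
Proof. by rewrite leb_tonelli_cons; have := @fubini_tonelli2 _ _ _ _ R lam (@lebsf n) (f \o @row_cons R n) mfc (fun p => f0 _); exact. Qed.

Lemma leb_tonelli12 :
  (\int[leb R n.+1]_x f x = \int[lam]_x \int[leb R n]_y f (row_cons (x, y)))%E.
Proof. by rewrite leb_tonelli_cons; have := @fubini_tonelli1 _ _ _ _ R lam (@lebsf n) (f \o @row_cons R n) mfc (fun p => f0 _); exact. Qed.

End tonelli.

Section fubini.
Variables (n : nat) (f : 'rV[R]_n.+1 -> \bar R).
Hypotheses (if_ : (leb R n.+1).-integrable setT f).

Let mf : measurable_fun setT f.
Proof. exact: measurable_int if_. Qed.

Let ifc : (lam \x @lebsf n)%E.-integrable setT (f \o @row_cons R n).
Proof.
apply/integrableP; split.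
  by apply: measurableT_comp => //; exact: measurable_row_cons.
have /integrableP[_] := if_; rewrite leb_tonelli_cons//.
exact: measurableT_comp.
Qed.

Let fubini_cons :
  (\int[leb R n.+1]_x f x = \int[lam \x @lebsf n]_p f (row_cons p))%E.
Proof.
rewrite integralE [RHS]integralE !leb_tonelli_cons//.
- by congr (_ - _)%E; apply: eq_integral => p _; rewrite funeposE || rewrite funenegE; rewrite ?funeposE ?funenegE.
- exact: measurable_funeneg.
- exact: measurable_funepos.
Qed.

Lemma leb_fubini21 :
  (\int[leb R n.+1]_x f x = \int[leb R n]_y \int[lam]_x f (row_cons (x, y)))%E.
Proof. rewrite fubini_cons; have := integral21_prod_meas1 ifc; exact: esym. Qed.

Lemma leb_fubini12 :
  (\int[leb R n.+1]_x f x = \int[lam]_x \int[leb R n]_y f (row_cons (x, y)))%E.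
Proof. rewrite fubini_cons; have := integral12_prod_meas1 ifc; exact: esym. Qed.

End fubini.

End leb_box.

(** * Derivatives along lines *)

Section reparametrization.
Variables (R : realType) (V V' : normedModType R).
Variables (f : V -> R) (g : V' -> R) (a v : V) (b w : V').
Hypothesis fg : forall h : R, f (h *: v + a) = g (h *: w + b).

Let quotE : (fun h : R => h^-1 *: ((f \o shift a) (h *: v) - f a)) =
            (fun h : R => h^-1 *: ((g \o shift b) (h *: w) - g b)).
Proof.
apply/funext => h /=; have := fg 0; rewrite !scale0r !add0r => ->.
by rewrite fg.
Qed.

(** A directional derivative sees a function on one line only: both sides are limits of the same
    quotient. Partial derivatives pass to slices in this way. *)
Lemma derivable_reparam : derivable f a v = derivable g b w.
Proof. by rewrite /derivable quotE. Qed.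

Lemma derive_reparam : 'D_v f a = 'D_w g b.
Proof. by rewrite /derive quotE. Qed.

End reparametrization.

(** * Integrals of derivatives with compact support *)

Section zero_integral.
Variable R : realType.

Lemma row_cons_delta0 n (h x : R) (y : 'rV[R]_n) :
  row_cons (h *: 1 + x, y) = h *: delta_mx ord0 ord0 + row_cons (x, y).
Proof.
apply/rowP => i; rewrite [RHS]mxE [X in _ = X + _]mxE [X in _ = _ * X + _]mxE.
have [j ->|->] := unliftP ord0 i.
  by rewrite !row_consS /= mulr0 add0r.
by rewrite !row_cons0 /= mulr1 [_%:A]mulr1.
Qed.

Lemma row_cons_deltaS n (h x : R) (y : 'rV[R]_n) j :
  row_cons (x, h *: delta_mx ord0 j + y) =
  h *: delta_mx ord0 (lift ord0 j) + row_cons (x, y).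
Proof.
apply/rowP => i; rewrite [RHS]mxE [X in _ = X + _]mxE [X in _ = _ * X + _]mxE.
have [k ->|->] := unliftP ord0 i.
  by rewrite !row_consS /= !mxE (inj_eq lift_inj).
by rewrite !row_cons0 /= mulr0 add0r.
Qed.

Lemma ball_row_cons n (p q : R * 'rV[R]_n) e : 0 < e ->
  `|p.1 - q.1| < e -> `|p.2 - q.2| < e -> `|row_cons p - row_cons q| < e.
Proof.
move=> e0 h1 h2; apply: rV_norm_lt => // i; rewrite mxE [X in _ + X]mxE.
have [k ->|->] := unliftP ord0 i; rewrite ?row_consS ?row_cons0//.
by apply: le_lt_trans h2; have := coord_le_norm (p.2 - q.2) k; rewrite !mxE.
Qed.

Lemma continuous_row_cons1 n (y : 'rV[R]_n) : continuous (fun x : R => row_cons (x, y)).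
Proof.
move=> x; apply/cvgrPdist_lt => e e0.
have /cvgrPdist_lt/(_ e e0) : (fun z : R => z) @ x --> x by exact: cvg_id.
by apply: filterS => z xz; apply: ball_row_cons => //=; rewrite subrr normr0.
Qed.

Lemma continuous_row_cons2 n (x : R) : continuous (fun y : 'rV[R]_n => row_cons (x, y)).
Proof.
move=> y; apply/(cvgrPdist_lt (FF := nbhs_filter y)) => e e0.
apply: filterS (nbhsx_ballx y e e0) => z; rewrite mx_norm_ball /ball_ /= => yz.
by apply: ball_row_cons => //=; rewrite subrr normr0.
Qed.

Lemma cts_integrable_rV n (f : 'rV[R]_n -> R) M : continuous f ->
  (forall x, ~ cbox M x -> f x = 0) -> (leb R n).-integrable setT (EFin \o f).
Proof.
move=> cf f0.
have mf := continuous_measurable_rV cf.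
have : (leb R n).-integrable (cbox M) (EFin \o f).
  apply: measurable_bounded_integrable => //; first exact: measurable_cbox.
  - exact: leb_cbox_lty.
  - exact: measurable_funTS.
  - have cM : compact (cbox M : set 'rV[R]_n).
      rewrite (_ : cbox M = [set v : 'rV[R]_n | forall i, `[- M, M]%classic (v ord0 i)]).
        by apply: (@rV_compact _ _ (fun=> `[- M, M]%classic)) => _; apply: segment_compact.
      by apply/seteqP; split => v H i /=; have := H i; rewrite /= in_itv/= ler_norml.
    have : compact (f @` cbox M).
      by apply: continuous_compact => //; exact: continuous_subspaceT.
    move/compact_bounded => [B [Breal HB]].
    exists B; split => // r rB x /= Mx; apply: HB rB _ _; by exists x.
rewrite (integrable_mkcond _ (measurable_cbox M)); apply: eq_integrable => // x _.
rewrite patchE; case: ifPn => // /negP; rewrite inE => nM /=.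
by rewrite f0.
Qed.

Lemma integral_derive1_eq0 (g dg : R -> R) (M : R) :
  (forall x, derivable g x 1) -> (forall x, 'D_1 g x = dg x) -> continuous dg ->
  (forall x, M < `|x| -> g x = 0) -> (forall x, M < `|x| -> dg x = 0) ->
  (\int[@lebesgue_measure R]_x (dg x)%:E = 0)%E.
Proof.
(* The interval must be nonempty and its end points must satisfy the strict bound [M < |x|], while
   [M] itself may be negative. *)
move=> ddg gE cdg g0 dg0; pose N : R := `|M| + 1.
have MN : M < N by rewrite (le_lt_trans (ler_norm _))// ltrDl.
have N0 : 0 < N by rewrite ltr_wpDl.
have : (\int[@lebesgue_measure R]_(x in `[(- N)%R, N]) (dg x)%:E = 0)%E.
  have cg : continuous g.
    move=> x; apply: differentiable_continuous; exact/derivable1_diffP.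
  rewrite (@continuous_FTC2 _ dg g)//.
  - by rewrite !g0 ?subee// ?normrN gtr0_norm.
  - by rewrite gtrN.
  - exact: continuous_subspaceT.
  - split => //; first by apply: cvg_at_right_filter; exact: cg.
    by apply: cvg_at_left_filter; exact: cg.
  - by move=> x _; rewrite derive1E gE.
rewrite integral_mkcond => <-; apply: eq_integral => x _.
rewrite patchE; case: ifPn => // /negP; rewrite inE /= in_itv/= => nx.
rewrite dg0// (lt_trans MN)// ltNge; apply/negP.
by rewrite ler_norml.
Qed.

(** By Fubini, direction [ord0] is integrated out on lines by the one-dimensional case. Every other
    direction is tangent to the slices with fixed first coordinate, which are treated by induction
    on the dimension. *)
Lemma integral_derive_eq0 n (F dF : 'rV[R]_n.+1 -> R) (i : 'I_n.+1) (M : R) :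
  (forall x, derivable F x (delta_mx ord0 i)) ->
  (forall x, 'D_(delta_mx ord0 i) F x = dF x) ->
  continuous dF ->
  (forall x, ~ cbox M x -> F x = 0) -> (forall x, ~ cbox M x -> dF x = 0) ->
  (\int[leb R n.+1]_x (dF x)%:E = 0)%E.
Proof.
have cons_out m (x : R) (y : 'rV[R]_m) : M < `|x| -> ~ cbox M (row_cons (x, y)).
  by move=> xM /(_ ord0); rewrite row_cons0 /= leNgt xM.
have slice0 m (G dG : 'rV[R]_m.+1 -> R) :
    (forall x, derivable G x (delta_mx ord0 ord0)) ->
    (forall x, 'D_(delta_mx ord0 ord0) G x = dG x) -> continuous dG ->
    (forall x, ~ cbox M x -> G x = 0) -> (forall x, ~ cbox M x -> dG x = 0) ->
    (\int[leb R m.+1]_x (dG x)%:E = 0)%E.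
  move=> ddG GE cdG G0 dG0; have idG := cts_integrable_rV cdG dG0.
  rewrite leb_fubini21// -[RHS](integral0 (leb R m) setT); apply: eq_integral => y _.
  apply: (@integral_derive1_eq0 (fun x => G (row_cons (x, y))) _ M).
  - move=> x; suff -> : derivable (fun x => G (row_cons (x, y))) x 1 =
        derivable G (row_cons (x, y)) (delta_mx ord0 ord0) by [].
    by apply: derivable_reparam => h; rewrite row_cons_delta0.
  - move=> x; rewrite -GE; apply: derive_reparam => h; by rewrite row_cons_delta0.
  - by move=> x; apply: continuous_comp; [exact: continuous_row_cons1|exact: cdG].
  - by move=> x /cons_out xM; rewrite G0.
  - by move=> x /cons_out xM; rewrite dG0.
elim: n F dF i => [|n IH] F dF i.
  by rewrite (ord1 i); exact: slice0.
have [j ->|->] := unliftP ord0 i; last exact: slice0.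
move=> ddF FE cdF F0 dF0; have idF := cts_integrable_rV cdF dF0.
rewrite leb_fubini12// -[RHS](integral0 lebesgue_measure setT).
apply: eq_integral => x _.
have out y : ~ cbox M y -> ~ cbox M (row_cons (x, y) : 'rV[R]_n.+2).
  by apply: contra_not => + k => /(_ (lift ord0 k)); rewrite row_consS.
apply: (IH (fun y => F (row_cons (x, y))) _ j).
- move=> y; suff -> : derivable (fun y => F (row_cons (x, y))) y (delta_mx ord0 j) =
      derivable F (row_cons (x, y)) (delta_mx ord0 (lift ord0 j)) by [].
  by apply: derivable_reparam => h; rewrite row_cons_deltaS.
- move=> y; rewrite -FE; apply: derive_reparam => h; by rewrite row_cons_deltaS.
- by move=> y; apply: continuous_comp; [exact: continuous_row_cons2|exact: cdF].
- by move=> y /out yM; rewrite F0.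
- by move=> y /out yM; rewrite dF0.
Qed.

End zero_integral.

(** * Test functions *)

Section Ck_calculus.
Variables (R : realType) (n : nat).
Local Notation E := 'rV[R]_n.+1.
Implicit Types f g : E -> R.

Lemma Ck_ext k f g : f =1 g -> Ck k f -> Ck k g.
Proof. by move/funext ->. Qed.

Lemma CkS k f : Ck k.+1 f <-> [/\ continuous f,
  forall i x, derivable f x (delta_mx ord0 i : E) & forall i, Ck k (pder i f)].
Proof. by []. Qed.

Lemma Ck_mono k f : Ck k.+1 f -> Ck k f.
Proof.
elim: k f => [|k IH] f; first by case.
by case/CkS => [cf df Hf]; apply/CkS; split => // i; apply: IH; exact: Hf.
Qed.

Lemma Ck_continuous k f : Ck k f -> continuous f.
Proof. by case: k => [//|k] []. Qed.

Lemma Ck_D k f g : Ck k f -> Ck k g -> Ck k (fun x => f x + g x).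
Proof.
elim: k f g => [|k IH] f g; first by move=> cf cg x; apply: continuousD; [exact: cf|exact: cg].
move=> /CkS[cf df Hf] /CkS[cg dg Hg]; apply/CkS; split.
- by move=> x; apply: continuousD; [exact: cf|exact: cg].
- by move=> i x; apply: derivableD.
- move=> i; apply: (@Ck_ext _ (fun x => pder i f x + pder i g x)); last exact: (IH _ _ (Hf i) (Hg i)).
  by move=> x; rewrite /pder -deriveD.
Qed.

Lemma Ck_M k f g : Ck k f -> Ck k g -> Ck k (fun x => f x * g x).
Proof.
elim: k f g => [|k IH] f g; first by move=> cf cg x; apply: continuousM; [exact: cf|exact: cg].
move=> /[dup] Cf /CkS[cf df Hf] /[dup] Cg /CkS[cg dg Hg]; apply/CkS; split.
- by move=> x; apply: continuousM; [exact: cf|exact: cg].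
- by move=> i x; apply: derivableM.
- move=> i; apply: (@Ck_ext _ (fun x => f x * pder i g x + g x * pder i f x)).
    by move=> x; rewrite /pder -[RHS]/('D_(delta_mx ord0 i) (f * g) x) deriveM.
  apply: Ck_D; [exact: (IH _ _ (Ck_mono Cf) (Hg i))|exact: (IH _ _ (Ck_mono Cg) (Hf i))].
Qed.

Lemma Ck_cst k (c : R) : Ck k (fun _ : E => c).
Proof.
elim: k c => [|k IH] c; first exact: cst_continuous.
apply/CkS; split => [|i x|i]; [exact: cst_continuous|exact: derivable_cst|].
by apply: (@Ck_ext _ (fun=> 0)) => // x; rewrite /pder derive_cst.
Qed.

Lemma Ck_prod k (I : Type) (s : seq I) (F : I -> E -> R) :
  (forall i, Ck k (F i)) -> Ck k (fun x => \prod_(i <- s) F i x).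
Proof.
move=> CF; elim: s => [|i s IH].
  by apply: Ck_ext (Ck_cst k 1) => x; rewrite big_nil.
by apply: Ck_ext (Ck_M (CF i) IH) => x; rewrite big_cons.
Qed.

End Ck_calculus.

(** * Smooth functions that are flat at 0 *)

Section flat_exponential.
Variable R : realType.
Implicit Types p : {poly R}.

(** Each degree uses up half of the exponent: [y <= (2/d) exp(d y / 2)]. *)
Lemma poly_le_expR p (d : R) : 0 < d ->
  exists2 C, 0 <= C & forall y, 0 <= y -> `|p.[y]| <= C * expR (d * y).
Proof.
elim/poly_ind: p d => [|p c IH] d d0.
  by exists 0 => // y _; rewrite horner0 normr0 mul0r.
have d20 : 0 < d / 2 by rewrite divr_gt0.
have [C C0 HC] := IH _ d20.
exists (C * (2 / d) + `|c|); first by rewrite addr_ge0// mulr_ge0// divr_ge0// ltW.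
move=> y y0; rewrite hornerMXaddC.
have e1 : 1 <= expR (d * y) by rewrite (le_trans _ (expR_ge1Dx _))// lerDl mulr_ge0// ltW.
have ye : y <= 2 / d * expR (d / 2 * y).
  have := expR_ge1Dx (d / 2 * y) => h.
  rewrite -ler_pdivrMl ?divr_gt0// invf_div; apply: le_trans h; lra.
apply: le_trans (ler_normD _ _) _; rewrite normrM (ger0_norm y0) mulrDl.
apply: lerD; last by rewrite ler_peMr.
rewrite (_ : d * y = d / 2 * y + d / 2 * y); last by field.
rewrite expRD; set e := expR _ in ye *.
apply: (@le_trans _ _ (C * e * (2 / d * e))).
  by apply: ler_pM => //; exact: HC.
by rewrite le_eqVlt; apply/orP; left; apply/eqP; ring.
Qed.

(** Unlike [exp(-1/x)] alone, this family is closed under differentiation, with [flat' p] as the new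
    polynomial, so that smoothness is a single induction over all [p]. *)
Definition flat p (x : R) : R := if 0 < x then p.[x^-1] * expR (- x^-1) else 0.

(** This is [poly_le_expR] for [p X^2] at the point [1/x]. The quadratic decay makes the derivative
    at 0 vanish. *)
Lemma flat_le_sqr p : exists2 C, 0 <= C & forall x, `|flat p x| <= C * x ^+ 2.
Proof.
have [C C0 HC] := poly_le_expR (p * 'X^2) (ltr01 : (0 : R) < 1).
exists C => // x; rewrite /flat; case: ifPn => x0; last by rewrite normr0 mulr_ge0 ?sqr_ge0.
have y0 : 0 < x^-1 by rewrite invr_gt0.
have {HC} := HC x^-1 (ltW y0).
rewrite -[in X in _ -> X](invrK x); move: x^-1 y0 => y y0.
rewrite invrK hornerM hornerXn mul1r !normrM => h.
rewrite (ger0_norm (expR_ge0 _)) expRN exprVn -ler_pdivlMr ?invr_gt0 ?expR_gt0// invrK.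
by rewrite (gtr0_norm y0) -expr2 in h; rewrite mulrAC ler_pdivlMr ?exprn_gt0.
Qed.

Definition flat' p := 'X^2 * (p - p^`()).

Lemma is_derive_flat p (x : R) : is_derive x (1 : R) (flat p) (flat (flat' p) x).
Proof.
have [x0|x0|x0] := ltgtP x 0.
- have -> : flat (flat' p) x = 0 by rewrite /flat ltNge (ltW x0).
  apply: (@near_eq_is_derive _ _ _ (cst 0)).
    near=> y; rewrite /flat ltNge (_ : y <= 0)//.
    by apply: ltW; near: y; exact: lt_nbhsl.
- have -> : flat (flat' p) x = (flat' p).[x^-1] * expR (- x^-1) by rewrite /flat x0.
  apply: (@near_eq_is_derive _ R R (fun y : R => p.[y^-1] * expR (- y^-1))).
    near=> y; rewrite /flat (_ : 0 < y)//.
    by near: y; exact: lt_nbhsr.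
  have x1 : x != 0 by rewrite gt_eqF.
  have dV : is_derive x 1 (fun y : R => y^-1) (- x ^- 2).
    apply: DeriveDef; first exact: derivableV.
    by rewrite deriveV// derive_id [_ *: 1]mulr1.
  have dN : is_derive x 1 (fun y : R => - y^-1) (x ^- 2).
    by have := is_deriveN dV; rewrite opprK.
  have dp : is_derive x 1 (fun y => p.[y^-1]) (p^`().[x^-1] * - x ^- 2).
    exact: is_derive1_comp.
  have de : is_derive x 1 (fun y => expR (- y^-1)) (expR (- x^-1) * x ^- 2).
    exact: is_derive1_comp.
  apply: is_derive_eq (is_deriveM dp de) _.
  rewrite /= /flat' hornerM hornerXn hornerD hornerN exprVn.
  by rewrite /GRing.scale /=; ring.
- have -> : flat (flat' p) x = 0 by rewrite x0 /flat ltxx.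
  rewrite x0.
  have [C C0 HC] := flat_le_sqr p.
  have f0 : flat p 0 = 0 by rewrite /flat ltxx.
  have cv : (fun h => h^-1 *: ((flat p \o shift 0) (h *: 1) - flat p 0)) @ 0^' --> (0 : R).
    apply/cvgrPdist_le => e e0; near=> h.
    have h0 : h != 0 by near: h; exact: nbhs_dnbhs_neq.
    rewrite sub0r normrN f0 subr0 /= addr0 [h *: 1]mulr1 normrM normfV.
    rewrite mulrC ler_pdivrMr ?normr_gt0//; apply: le_trans (HC h) _.
    rewrite -real_normK ?num_real// expr2 mulrA ler_wpM2r//.
    have hC : `|h| <= e / (C + 1).
      by near: h; apply: dnbhs0_le; apply: divr_gt0 => //; lra.
    apply: le_trans (ler_wpM2l C0 hC) _.
    rewrite mulrCA; apply: ler_piMr; first exact: ltW.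
    by rewrite ler_pdivrMr; lra.
  by apply: DeriveDef; [apply/cvg_ex; exists 0|exact: cvg_lim cv].
Unshelve. all: by end_near. Qed.

End flat_exponential.

(** * Smooth bumps on boxes *)

Section bump.
Variables (R : realType) (n : nat).
Local Notation E := 'rV[R]_n.+1.

Lemma continuous_flat p : continuous (@flat R p).
Proof.
move=> x; apply/differentiable_continuous/derivable1_diffP.
by have [] := is_derive_flat p x.
Qed.

Lemma derive_flat_coor p (al ga : R) (i j : 'I_n.+1) (x : E) :
  is_derive x (delta_mx ord0 j : E) (fun y : E => flat p (al * y ord0 i + ga))
    (al * (i == j)%:R * flat (flat' p) (al * x ord0 i + ga)).
Proof.
pose w : R := al * (i == j)%:R; pose b := al * x ord0 i + ga.
have fg h : flat p (al * (h *: (delta_mx ord0 j : E) + x) ord0 i + ga) = flat p (h *: w + b).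
  congr flat; rewrite !mxE eqxx /= /b /w /GRing.scale /=; ring.
have [df fE] := is_derive_flat p b.
have dfb : differentiable (flat p) b by exact/derivable1_diffP.
apply: DeriveDef.
  rewrite (derivable_reparam (f := fun y : E => flat p (al * y ord0 i + ga)) fg).
  exact: diff_derivable.
rewrite (derive_reparam (f := fun y : E => flat p (al * y ord0 i + ga)) fg).
rewrite deriveE// -[w]mulr1 -[w * 1]/(w *: 1) linearZ/= -deriveE// fE.
by rewrite /GRing.scale.
Qed.

Lemma coor_continuous (i : 'I_n.+1) : continuous (fun y : E => y ord0 i).
Proof. exact: coord_continuous. Qed.

Lemma Ck_flat_coor k p (al ga : R) (i : 'I_n.+1) :
  Ck k (fun y : E => flat p (al * y ord0 i + ga)).
Proof.
elim: k p => [|k IH] p.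
  move=> x; apply: (@continuous_comp _ _ _ (fun y : E => al * y ord0 i + ga)).
    apply: continuousD; last exact: cst_continuous.
    by apply: continuousM; [exact: cst_continuous|exact: coor_continuous].
  exact: continuous_flat.
apply/CkS; split.
- exact: (Ck_continuous (IH p)).
- by move=> j x; have [] := derive_flat_coor p al ga i j x.
- move=> j; apply: (@Ck_ext _ _ _ (fun x : E =>
      (al * (i == j)%:R) * flat (flat' p) (al * x ord0 i + ga))); last first.
    by apply: Ck_M; [exact: Ck_cst|exact: IH].
  move=> x.
  by rewrite /pder; have [_ ->] := derive_flat_coor p al ga i j x.
Qed.

Local Notation zeta := (@flat R 1).

Lemma zeta_ge0 x : 0 <= zeta x.
Proof. by rewrite /flat; case: ifP => // _; rewrite hornerC mul1r expR_ge0. Qed.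

Lemma zeta_le1 x : zeta x <= 1.
Proof.
rewrite /flat; case: ifP => // x0; rewrite hornerC mul1r -expR0 ler_expR.
by rewrite oppr_le0 invr_ge0 ltW.
Qed.

Lemma zeta_eq0 x : x <= 0 -> zeta x = 0.
Proof. by move=> x0; rewrite /flat ltNge x0. Qed.

Lemma zeta_cvg1 (c d : R) : 0 < c -> (fun k : nat => zeta (k%:R * c + d)) @ \oo --> (1 : R).
Proof.
move=> c0; apply/cvgrPdist_le => e e0; near=> k.
have k1 : 0 < k%:R * c + d.
  near: k; exists (Num.bound (`|d| / c)) => // k /= kb.
  have : `|d| / c < k%:R.
    apply: lt_le_trans (archi_boundP _) _; last by rewrite ler_nat.
    by rewrite divr_ge0// ltW.
  rewrite ltr_pdivrMr// => dk; have := ler_norm (- d); rewrite normrN; lra.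
have k2 : e^-1 <= k%:R * c + d.
  near: k; exists (Num.bound ((`|d| + e^-1) / c)) => // k /= kb.
  have : (`|d| + e^-1) / c < k%:R.
    apply: lt_le_trans (archi_boundP _) _; last by rewrite ler_nat.
    by apply: divr_ge0; [apply: addr_ge0 => //; rewrite invr_ge0 ltW|exact: ltW].
  rewrite ltr_pdivrMr// => dk; have := ler_norm (- d); rewrite normrN; lra.
rewrite ger0_norm ?subr_ge0 ?zeta_le1// /flat k1 hornerC mul1r.
have := expR_ge1Dx (- (k%:R * c + d)^-1) => h.
have : (k%:R * c + d)^-1 <= e by rewrite -[e]invrK lef_pV2// posrE invr_gt0.
lra.
Unshelve. all: by end_near. Qed.

Definition obox (a b : E) : set E :=
  [set x | forall i, a ord0 i < x ord0 i /\ x ord0 i < b ord0 i].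

(** The arguments are [k (x_i - a_i) - 1] and [k (b_i - x_i) - 1]. Subtracting 1 keeps the support
    at distance [1/k] from the faces, hence inside the open box. The shift is lost as [k] grows, and
    the bumps tend to the indicator of the box. *)
Definition smooth_bump (a b : E) (k : nat) (x : E) : R :=
  \prod_(i < n.+1) (zeta (k%:R * x ord0 i + (- k%:R * a ord0 i - 1))
                  * zeta (- k%:R * x ord0 i + (k%:R * b ord0 i - 1))).

Lemma Ck_bump a b k m : Ck m (smooth_bump a b k).
Proof. by apply: Ck_prod => i; apply: Ck_M; exact: Ck_flat_coor. Qed.

Lemma bump_ge0 a b k x : 0 <= smooth_bump a b k x.
Proof. by apply: prodr_ge0 => i _; rewrite mulr_ge0// zeta_ge0. Qed.

Lemma bump_le1 a b k x : smooth_bump a b k x <= 1.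
Proof.
apply: prodr_ile1 => i _; rewrite mulr_ge0 ?zeta_ge0//=.
by rewrite mulr_ile1 ?zeta_ge0 ?zeta_le1.
Qed.

Lemma bump_neq0 a b k x : smooth_bump a b k x != 0 -> forall i,
  1 <= k%:R * (x ord0 i - a ord0 i) /\ 1 <= k%:R * (b ord0 i - x ord0 i).
Proof.
move=> /prodf_neq0 H i; have {H} := H i isT.
rewrite mulf_eq0 negb_or => /andP[h1 h2]; split; rewrite leNgt; apply/negP => h.
  by move: h1; rewrite zeta_eq0 ?eqxx//; nra.
by move: h2; rewrite zeta_eq0 ?eqxx//; nra.
Qed.

Lemma bump_cvg a b x : (fun k => smooth_bump a b k x) @ \oo --> (\1_(obox a b) x : R).
Proof.
have [bx|nbx] := pselect (obox a b x).
  rewrite indicE mem_set// -[X in _ --> X](@big1 _ 1 *%R 'I_n.+1 (index_enum _) xpredT (fun=> 1))//.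
  apply: cvg_big => [|i _]; first exact: mul_continuous.
  have [ax xb] := bx i.
  rewrite -[X in _ --> X]mulr1; apply: cvgM.
    have h := @zeta_cvg1 (x ord0 i - a ord0 i) (-1) ltac:(by rewrite subr_gt0).
    apply: cvg_trans h; apply: near_eq_cvg; apply: nearW => k.
    by congr (flat 1 _); ring.
  have h := @zeta_cvg1 (b ord0 i - x ord0 i) (-1) ltac:(by rewrite subr_gt0).
  apply: cvg_trans h; apply: near_eq_cvg; apply: nearW => k.
  by congr (flat 1 _); ring.
rewrite indicE memNset//.
suff H k : smooth_bump a b k x = 0 by under eq_fun do rewrite H; exact: cvg_cst.
apply/eqP; apply: contra_notT nbx => /bump_neq0 H i; have [h1 h2] := H i.
have k0 : 0 <= k%:R :> R by [].
split; rewrite ltNge; apply/negP => h; nra.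
Qed.

End bump.

(** * Operations on test functions *)

Section test_functions.
Variables (R : realType) (n : nat).
Local Notation E := 'rV[R]_n.+1.
Implicit Types (D : set E) (phi psi : E -> R).

Lemma test_cbox D phi : test_function D phi ->
  exists M : R, forall x, ~ cbox M x -> phi x = 0.
Proof.
move=> [_ /compact_bounded [M [_ HM]] _].
exists (M + 1) => x nx; apply/eqP; apply: contra_notT nx => x0 i.
apply: le_trans (coord_le_norm _ _) _; apply: (HM (M + 1)); first by rewrite ltrDl.
exact: subset_closure.
Qed.

Lemma test_out D phi x : test_function D phi -> ~ D x -> phi x = 0.
Proof.
move=> [_ _ HD] nD; apply/eqP; apply: contra_notT nD => x0; apply: HD.
exact: subset_closure.
Qed.

Lemma test_functionS D D' phi : D `<=` D' -> test_function D phi -> test_function D' phi.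
Proof. by move=> DD [h1 h2 h3]; split => //; exact: subset_trans h3 DD. Qed.

Lemma test_function_sub D phi psi : test_function D phi -> (forall k, Ck k psi) ->
  (forall x, psi x != 0 -> closure [set y | phi y != 0] x) -> test_function D psi.
Proof.
move=> [h1 h2 h3] Cp sub.
have cl : closure [set x | psi x != 0] `<=` closure [set y | phi y != 0].
  have /closure_id -> := @closed_closure _ [set y | phi y != 0].
  exact: closureS.
split => //; last exact: subset_trans cl h3.
by apply: subclosed_compact h2 cl; exact: closed_closure.
Qed.

Lemma test_pder D phi i : test_function D phi -> test_function D (pder i phi).
Proof.
move=> /[dup] T [h1 h2 h3]; apply: (test_function_sub T).
  by move=> k; have /CkS[_ _] := h1 k.+1.
move=> x; apply: contraPP => /= nx.
have op : open (~` closure [set y | phi y != 0]).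
  by apply: closed_openC; exact: closed_closure.
apply/negP; rewrite negbK; apply/eqP; rewrite /pder.
rewrite (near_eq_derive (g := cst 0)); first by rewrite derive_cst.
have := open_nbhs_nbhs (conj op nx); apply: filterS => y ny.
by apply/eqP; apply: contra_notT ny => ?; exact: subset_closure.
Qed.

Lemma test_function_M D phi psi : test_function D phi -> (forall k, Ck k psi) ->
  test_function D (fun x => phi x * psi x).
Proof.
move=> /[dup] T [h1 h2 h3] Cp; apply: (test_function_sub T).
  by move=> k; exact: Ck_M.
by move=> x; rewrite mulf_eq0 negb_or => /andP[? _]; exact: subset_closure.
Qed.

Lemma test_function_0 D : test_function D (fun _ => 0).
Proof.
have e : [set x : E | (0 : R) != 0] = set0 by apply/seteqP; split => x //=; rewrite eqxx.
split; rewrite ?e ?closure0//; first by move=> k; exact: Ck_cst.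
exact: compact0.
Qed.

Lemma test_function_D D phi psi : test_function D phi -> test_function D psi ->
  test_function D (fun x => phi x + psi x).
Proof.
move=> [h1 h2 h3] [k1 k2 k3].
have cl : closure [set x | phi x + psi x != 0] `<=`
   closure [set x | phi x != 0] `|` closure [set x | psi x != 0].
  rewrite -closureU; apply: closureS => x /=.
  have [-> |] := eqVneq (phi x) 0; last by left.
  by rewrite add0r; right.
split; first by move=> k; exact: Ck_D.
  apply: subclosed_compact cl; first exact: closed_closure.
  exact: compactU.
by apply: subset_trans cl _ => x [/h3|/k3].
Qed.

Lemma test_function_Z D a phi : test_function D phi -> test_function D (fun x => a * phi x).
Proof.
move=> T; have := test_function_M T (psi := fun=> a) (fun k => @Ck_cst R n k a).
by congr test_function; apply/funext => x; rewrite mulrC.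
Qed.

Lemma bump_test D a b k : obox a b `<=` D -> test_function D (smooth_bump a b k).
Proof.
move=> bD.
pose K := [set x : E | forall i,
  1 <= k%:R * (x ord0 i - a ord0 i) /\ 1 <= k%:R * (b ord0 i - x ord0 i)].
have c1 i : continuous (fun x : E => k%:R * (x ord0 i - a ord0 i)).
  move=> x; apply: (@continuousM _ _ (fun=> k%:R) (fun x : E => x ord0 i - a ord0 i)).
    exact: cst_continuous.
  by apply: continuousB; [exact: coor_continuous|exact: cst_continuous].
have c2 i : continuous (fun x : E => k%:R * (b ord0 i - x ord0 i)).
  move=> x; apply: (@continuousM _ _ (fun=> k%:R) (fun x : E => b ord0 i - x ord0 i)).
    exact: cst_continuous.
  by apply: continuousB; [exact: cst_continuous|exact: coor_continuous].
have cK : closed K.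
  rewrite (_ : K = \bigcap_(i in [set: 'I_n.+1])
    ([set x : E | 1 <= k%:R * (x ord0 i - a ord0 i)] `&`
     [set x : E | 1 <= k%:R * (b ord0 i - x ord0 i)])).
    apply: closed_bigI => i _; apply: closedI.
      by apply: (preimage_closed _ (@closed_ge R 1)) => x _; exact: c1.
    by apply: (preimage_closed _ (@closed_ge R 1)) => x _; exact: c2.
  by apply/seteqP; split => x /= H i; [move=> _; exact: H|exact: (H i I)].
have Kb : K `<=` obox a b.
  move=> x Kx i; have [h1 h2] := Kx i.
  have k0 : 0 <= k%:R :> R by [].
  split; rewrite ltNge; apply/negP => h; nra.
have sK : closure [set x | smooth_bump a b k x != 0] `<=` K.
  rewrite [K](closure_id _).1//; apply: closureS => x; exact: bump_neq0.
split; last exact: subset_trans sK (subset_trans Kb bD).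
  by move=> m; exact: Ck_bump.
apply: subclosed_compact sK; first exact: closed_closure.
apply: bounded_closed_compact => //.
exists (`|a| + `|b|); split; first exact: num_real.
move=> M Mab x /Kb xb; apply: rV_norm_le.
  by apply: le_trans (ltW Mab); rewrite addr_ge0.
move=> i; have [h1 h2] := xb i.
have := coord_le_norm a i; have := coord_le_norm b i => hb ha.
have := ler_norm (b ord0 i); have := ler_norm (- a ord0 i); rewrite normrN => ? ?.
have a0 : 0 <= `|a| by []; have b0 : 0 <= `|b| by [].
rewrite ler_norml; apply/andP; split; lra.
Qed.

End test_functions.

(** * Integration by parts against test functions *)

Section test_integrals.
Variables (R : realType) (n : nat).
Local Notation E := 'rV[R]_n.+1.
Implicit Types (D : set E) (phi psi : E -> R).

Lemma cts_compact_L2 D (f : E -> R) (M : R) : measurable D -> continuous f ->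
  (forall x, ~ cbox M x -> f x = 0) -> L2 D f.
Proof.
move=> mD cf f0; apply: integrable_sqr_L2 => //.
  by apply: measurable_funTS; exact: continuous_measurable_rV.
apply: (@integrableS _ _ _ _ setT) => //.
apply: (@cts_integrable_rV _ _ _ M).
  by move=> x; rewrite /GRing.exp /=; apply: continuousM; exact: cf.
by move=> x /f0 ->; rewrite expr0n.
Qed.

Lemma test_L2 D D' phi : measurable D -> test_function D' phi -> L2 D phi.
Proof.
move=> mD /[dup] T [Cp _ _]; have [M HM] := test_cbox T.
exact: cts_compact_L2 (Cp 0%N) HM.
Qed.

Lemma ip_test_out D (f g : E -> R) : (forall x, ~ D x -> f x * g x = 0) ->
  ip D f g = \int[leb R n.+1]_x (f x * g x).
Proof.
move=> fg; rewrite /ip Rintegral_mkcond; apply: eq_Rintegral => x _.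
rewrite patchE; case: ifPn => // /negP; rewrite inE => nD.
by rewrite fg.
Qed.

(** The product of [psi] and [phi] has compact support, so its derivative integrates to 0 over the
    whole space. As [phi] vanishes outside [D], integrals over [D] and over the whole space
    agree. *)
Lemma ibp_test D phi psi i : measurable D ->
  test_function D phi -> (forall k, Ck k psi) ->
  ip D psi (pder i phi) = - ip D (pder i psi) phi.
Proof.
move=> mD T Cp; have [M HM] := test_cbox T.
have Ti := test_pder i T; have [Mi HMi] := test_cbox Ti.
have Cphi k : Ck k phi by case: T.
have /CkS[_ dphi Cdphi] := Cphi 1%N; have /CkS[_ dpsi Cdpsi] := Cp 1%N.
rewrite !ip_test_out; first last.
- by move=> x /(test_out Ti) ->; rewrite mulr0.
- by move=> x /(test_out T) ->; rewrite mulr0.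
have c1 : continuous (fun x => psi x * pder i phi x).
  by apply: (Ck_continuous (k := 0%N)); apply: Ck_M; [exact: (Cp 0%N)|exact: (Cdphi i)].
have c2 : continuous (fun x => pder i psi x * phi x).
  by apply: (Ck_continuous (k := 0%N)); apply: Ck_M; [exact: (Cdpsi i)|exact: (Cphi 0%N)].
have i1 : (leb R n.+1).-integrable setT (EFin \o (fun x => psi x * pder i phi x)).
  by apply: (cts_integrable_rV c1 (M := Mi)) => x /HMi ->; rewrite mulr0.
have i2 : (leb R n.+1).-integrable setT (EFin \o (fun x => pder i psi x * phi x)).
  by apply: (cts_integrable_rV c2 (M := M)) => x /HM ->; rewrite mulr0.
apply/eqP; rewrite -addr_eq0 -RintegralD//; apply/eqP.
rewrite /Rintegral (_ : (\int[_]_(x in _) _)%E = 0%E)//.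
have mono M1 M2 (x : E) : M1 <= M2 -> cbox M1 x -> cbox M2 x.
  by move=> h H j; exact: le_trans (H j) h.
apply: (@integral_derive_eq0 _ _ (fun x => psi x * phi x)
  (fun x => psi x * pder i phi x + pder i psi x * phi x) i (Num.max M Mi)).
- by move=> x; apply: derivableM; [exact: dpsi|exact: dphi].
- move=> x; rewrite -[LHS]/('D_(delta_mx ord0 i) (psi * phi) x) deriveM//.
  by rewrite /GRing.scale /= /pder; congr (_ + _); rewrite mulrC.
- by move=> x; exact: (continuousD (c1 x) (c2 x)).
- move=> x nx; rewrite HM ?mulr0//; apply: contra_not nx; apply: mono.
  by rewrite le_max lexx.
- move=> x nx; rewrite HM ?HMi ?mulr0 ?addr0//; apply: contra_not nx; apply: mono;
  by rewrite le_max lexx ?orbT.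
Qed.

End test_integrals.

(** * The fundamental lemma of the calculus of variations *)

Section fundamental_lemma.
Variables (R : realType) (n : nat).
Local Notation E := 'rV[R]_n.+1.
Local Notation mu := (leb R n.+1).
Implicit Types (D : set E).

Lemma measurable_obox (a b : E) : measurable (obox a b).
Proof.
rewrite (_ : obox a b = \bigcap_(i in [set: 'I_n.+1])
   ((fun y : E => y ord0 i) @^-1` `]a ord0 i, b ord0 i[%classic)).
  apply: fin_bigcap_measurable => // i _.
  by rewrite -[X in measurable X]setTI; exact: measurable_coor.
apply/seteqP; split => x H i; first by move=> _ /=; rewrite in_itv/=; apply/andP; exact: H.
by have := H i I; rewrite /= in_itv/= => /andP.
Qed.

Lemma obox_lty (a b : E) : (mu (obox a b) < +oo)%E.
Proof.
apply: le_lt_trans (leb_cbox_lty n.+1 (`|a| + `|b|)).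
apply: le_measure; rewrite ?inE; [exact: measurable_obox|exact: measurable_cbox|].
move=> x xb i; have [h1 h2] := xb i.
have := coord_le_norm a i; have := coord_le_norm b i => hb ha.
have := ler_norm (b ord0 i); have := ler_norm (- a ord0 i); rewrite normrN => ? ?.
have a0 : 0 <= `|a| by []; have b0 : 0 <= `|b| by [].
rewrite ler_norml; apply/andP; split; lra.
Qed.

Lemma oboxI (a b a' b' : E) : obox a b `&` obox a' b' =
  obox (\row_i Num.max (a ord0 i) (a' ord0 i)) (\row_i Num.min (b ord0 i) (b' ord0 i)).
Proof.
apply/seteqP; split => [x [H H'] i|x H].
  by have [? ?] := H i; have [? ?] := H' i; rewrite !mxE gt_max lt_min; split; apply/andP.
by split => i; have := H i; rewrite !mxE gt_max lt_min => -[/andP[? ?] /andP[? ?]].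
Qed.

(** A half-space [x_i > c] is a countable union of open boxes. Boxes are stable under intersection,
    as a Dynkin argument requires of a generator. *)
Lemma measurable_gen_obox :
  @measurable _ E = <<s [set A | exists a b : E, A = obox a b] >>.
Proof.
set G := [set A | _]; apply/seteqP; split; last first.
  apply: smallest_sub; first exact: sigma_algebra_measurable.
  by move=> _ [a [b ->]]; exact: measurable_obox.
apply: smallest_sub; first exact: smallest_sigma_algebra.
move=> B; rewrite -bigcup_seq/= => -[i _ [C mC <-]]; rewrite setTI.
have H : (@measurable _ (measurableTypeR R)) `<=` [set C | <<s G >> ((fun x : E => x ord0 i) @^-1` C)].
  rewrite RGenOInfty.measurableE; apply: smallest_sub.
    split => /=.
    - by rewrite preimage_set0; exact: sigma_algebra0.
    - by move=> A /= GA; rewrite setTD preimage_setC; apply: sigma_algebraC.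
    - by move=> F GF; rewrite preimage_bigcup; exact: sigma_algebra_bigcup.
  move=> _ [x ->] /=.
  rewrite (_ : _ @^-1` _ = \bigcup_k obox
    (\row_j (if j == i then x else - k%:R) : E) (const_mx k%:R)).
    apply: sigma_algebra_bigcup => k; apply: sub_sigma_algebra.
    by eexists; eexists; reflexivity.
  apply/seteqP; split => [y /=|y [k _] /(_ i)]; last first.
    by rewrite !mxE eqxx /= in_itv/= andbT => -[].
  rewrite in_itv/= andbT => xy; exists (Num.bound `|y|) => // j.
  have yj : `|y ord0 j| < (Num.bound `|y|)%:R.
    by apply: le_lt_trans (coord_le_norm _ _) _; exact: archi_boundP.
  move: yj; rewrite ltr_norml !mxE => /andP[? ?]; split => //.
  by case: eqP => // ->.
exact: H.
Qed.

(** The smooth bumps are test functions that stay below the indicator of the box and converge to it,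
    so dominated convergence applies. *)
Lemma ip_indic_obox D (g : E -> R) (a b : E) : measurable D -> L2 D g ->
  (forall phi, test_function D phi -> ip D g phi = 0) -> obox a b `<=` D ->
  (\int[mu]_(x in obox a b) (g x)%:E = 0)%E.
Proof.
move=> mD Lg H abD.
have mB := measurable_obox a b.
have L1 : L2 D (\1_(obox a b) : E -> R).
  apply: integrable_sqr_L2 => //.
  rewrite (_ : (fun x => _) = \1_(obox a b)); last first.
    by apply/funext => x; rewrite indicE; case: (_ \in _); rewrite ?expr1n ?expr0n.
  apply: (@integrableS _ _ _ _ setT) => //.
  apply/integrableP; split; first exact/measurable_EFinP.
  under eq_integral do rewrite /= ger0_norm//.
  by rewrite integral_indic// setIT; exact: obox_lty.
have := @dominated_convergence _ _ _ mu D mD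
  (fun k x => (g x * smooth_bump a b k x)%:E) (fun x => (g x * \1_(obox a b) x)%:E)
  (fun x => `|g x * \1_(obox a b) x|%:E).
case.
- move=> k; apply/measurable_EFinP/measurable_funM; first exact: L2_measurable.
  by apply: L2_measurable; apply: test_L2 => //; exact: bump_test _ abD.
- by apply/measurable_EFinP/measurable_funM; exact: L2_measurable.
- apply: aeW => x Dx; apply: cvg_EFin; first exact: nearW.
  by apply: cvgM; [exact: cvg_cst|exact: bump_cvg].
- have := integrable_abse (L2_integrable_mul mD Lg L1); exact: eq_integrable.
- apply: aeW => x k Dx /=; rewrite lee_fin !normrM ler_wpM2l// indicE.
  have [xb|xb] := pselect (obox a b x).
    by rewrite mem_set// normr1 ger0_norm ?bump_le1 ?bump_ge0.
  by rewrite (test_out (bump_test k (@subset_refl _ (obox a b)))) ?normr0.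
move=> _ _; rewrite [X in X @ _ --> _](_ : _ = cst 0%E).
  move/cvg_lim => /(_ (@ereal_hausdorff R)); rewrite lim_cst// => h.
  rewrite -(setIidr abD) integral_mkcondr h; apply: eq_integral => x xD.
  by rewrite patchE indicE; case: (boolP (x \in obox a b)) => _; rewrite ?mulr1 ?mulr0.
apply/funext => k /=.
have Tk := bump_test k abD.
have := H _ Tk; rewrite /ip /Rintegral => /eqP.
rewrite fine_eq0; first by move/eqP.
by apply: integrable_fin_num => //; apply: L2_integrable_mul => //; exact: (test_L2 mD Tk).
Qed.

Lemma ball_obox (x : E) (r : R) :
  ball x r = obox (\row_i (x ord0 i - r)) (\row_i (x ord0 i + r)).
Proof.
apply/seteqP; split => y.
  move=> [r0 H] i; have := H ord0 i; rewrite !mxE /ball /= ltr_distlC.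
  by move/andP.
move=> H; have H' i : x ord0 i - r < y ord0 i /\ y ord0 i < x ord0 i + r.
  by have := H i; rewrite !mxE.
split; first by have [h1 h2] := H' ord0; lra.
move=> i j; rewrite (ord1 i) /ball /= ltr_distlC; apply/andP; exact: H'.
Qed.

(** For a box [B] inside [D], the sets [A] such that [g] has integral 0 over the intersection of [A]
    and [B] form a Dynkin system containing all boxes. Hence [g = 0] almost everywhere on [B]. Balls
    of the maximum norm are boxes, and countably many of them fill [D]. *)
Lemma fundamental_lemma D (g : E -> R) : open D -> L2 D g ->
  (forall phi, test_function D phi -> ip D g phi = 0) -> ip D g g = 0.
Proof.
move=> oD Lg H; have mD := open_measurable_rV oD.
have mg := L2_measurable Lg.
have key (a b : E) : obox a b `<=` D -> ae_eq mu (obox a b) (EFin \o g) (cst 0%E).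
  move=> abD; set B := obox a b; have mB : measurable B := measurable_obox a b.
  have LB : L2 B g := L2_S mB mD abD Lg.
  have iB : mu.-integrable B (EFin \o g).
    have L1 : L2 B (fun=> 1).
      apply: integrable_sqr_L2 => //.
      apply/integrableP; split; first exact/measurable_EFinP.
      under eq_integral do rewrite /= expr1n normr1.
      by rewrite integral_cst// mul1e obox_lty.
    apply: eq_integrable (L2_integrable_mul mB LB L1) => // x _ /=.
    by rewrite mulr1.
  have iS A : measurable A -> mu.-integrable (A `&` B) (EFin \o g).
    move=> mA; exact: (integrableS mB (measurableI _ _ mA mB) (@subIsetr _ _ _) iB).
  apply: integral_ae_eq => //.
  suff P : forall A, measurable A -> (\int[mu]_(x in A `&` B) (g x)%:E = 0)%E.
    move=> A AB mA; rewrite integral0 -(setIidl AB); exact: P.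
  rewrite measurable_gen_obox.
  apply: dynkin_induction => //.
  - by rewrite -measurable_gen_obox.
  - by move=> _ _ [a1 [b1 ->]] [a2 [b2 ->]]; rewrite oboxI; eexists; eexists.
  - by rewrite setTI; exact: (ip_indic_obox mD Lg H abD).
  - move=> _ [a1 [b1 ->]]; rewrite oboxI; apply: (ip_indic_obox mD Lg H).
    by rewrite -oboxI => x [_ /abD].
  - move=> A mA A0.
    have [mAB mACB] := (measurableI _ _ mA mB, measurableI _ _ (measurableC mA) mB).
    have AUB : (A `&` B) `|` (~` A `&` B) = B.
      by rewrite -setIUl setUv setTI.
    have := @integral_setU _ _ _ mu (A `&` B) (~` A `&` B) (EFin \o g) mAB mACB.
    rewrite AUB => /(_ (measurable_int _ iB)).
    rewrite disj_set2E setIACA setICr set0I eqxx => /(_ isT).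
    by rewrite /comp A0 add0e (ip_indic_obox mD Lg H abD) => <-.
  - move=> F mF tF F0; rewrite setI_bigcupl integral_bigcup//.
    + by rewrite eseries0// => i _ _; exact: F0.
    + exact: trivIset_setIr.
    + by move=> k; exact: measurableI.
    + by rewrite -setI_bigcupl; apply: iS; exact: bigcupT_measurable.
have [x [r DE]] := open_bigcup_ball oD.
have aeD : ae_eq mu D (EFin \o g) (cst 0%E).
  have : mu.-negligible (\bigcup_k (ball (x k) (r k) `&` [set y | g y != 0])).
    apply: negligible_bigcup => k; rewrite ball_obox.
    have [|N [mN N0 sN]] := key (\row_i (x k ord0 i - r k)) (\row_i (x k ord0 i + r k)).
      by rewrite -ball_obox DE => y yk; exists k.
    exists N; split => // y [yk /eqP gy]; apply: sN => /= /(_ yk) [].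
    exact: gy.
  apply: negligibleS => y /= /not_implyP[]; rewrite DE => -[k _ yk] gy.
  by exists k => //; split => //; apply/eqP => g0; apply: gy; rewrite g0.
rewrite /ip /Rintegral (ae_eq_integral (cst 0%E))//.
- by rewrite integral0.
- by apply/measurable_EFinP; exact: measurable_funM.
- by move: aeD; apply: filterS => y H' /H' /= [->]; rewrite mul0r.
Qed.

End fundamental_lemma.

(** * Hyperplanes are null sets *)

Section hyperplane.
Variable R : realType.

Lemma continuous_lin n (a : 'rV[R]_n) : continuous (fun x : 'rV[R]_n => \sum_i a ord0 i * x ord0 i).
Proof.
move=> x; elim: (index_enum _) => [|i s IH].
  rewrite (_ : (fun y => _) = cst 0); first exact: cst_continuous.
  by apply/funext => y; rewrite big_nil.
rewrite (_ : (fun y => _) = (fun y : 'rV[R]_n =>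
    a ord0 i * y ord0 i + \sum_(i <- s) a ord0 i * y ord0 i)).
  apply: (@continuousD _ _ _ (fun y : 'rV[R]_n => a ord0 i * y ord0 i)
    (fun y : 'rV[R]_n => \sum_(i <- s) a ord0 i * y ord0 i)); last exact: IH.
  by apply: (@continuousM _ _ (fun=> a ord0 i)); [exact: cst_continuous|exact: coord_continuous].
by apply/funext => y; rewrite big_cons.
Qed.

Lemma measurable_hyperplane n (a : 'rV[R]_n) (c : R) :
  measurable [set x : 'rV[R]_n | \sum_i a ord0 i * x ord0 i = c].
Proof.
have := continuous_measurable_rV (@continuous_lin n a).
by move/(_ measurableT [set c] (measurable_set1 c)); rewrite setTI.
Qed.

(** If the first coefficient is nonzero, a line in the first direction meets the hyperplane in a
    single point. Otherwise the slices are hyperplanes in one dimension less. *)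
Lemma hyperplane_null n (a : 'rV[R]_n) (c : R) : a != 0 ->
  leb R n [set x : 'rV[R]_n | \sum_i a ord0 i * x ord0 i = c] = 0%E.
Proof.
elim: n a c => [|n IH] a c a0.
  by case/eqP: a0; apply/rowP => -[].
set H := [set x : 'rV[R]_n.+1 | _]; have mH : measurable H by exact: measurable_hyperplane.
have mI : measurable_fun setT (EFin \o (\1_H : 'rV[R]_n.+1 -> R)).
  by apply/measurable_EFinP.
have I0 x : (0 <= (EFin \o (\1_H : 'rV[R]_n.+1 -> R)) x)%E by rewrite lee_fin.
have sumE (x : R) (y : 'rV[R]_n) : \sum_i a ord0 i * row_cons (x, y) ord0 i =
    a ord0 ord0 * x + \sum_i (\row_i a ord0 (lift ord0 i)) ord0 i * y ord0 i.
  rewrite big_ord_recl row_cons0; congr (_ + _); apply: eq_bigr => i _.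
  by rewrite row_consS mxE.
rewrite -[H]setIT -integral_indic//.
have [a00|a00] := eqVneq (a ord0 ord0) 0.
  rewrite (leb_tonelli12 mI I0) -[RHS](integral0 lebesgue_measure setT).
  apply: eq_integral => x _.
  have a'0 : \row_i a ord0 (lift ord0 i) != 0.
    apply: contra a0 => /eqP /rowP a'; apply/eqP/rowP => i; rewrite mxE.
    by have [j ->|->] := unliftP ord0 i => //; have := a' j; rewrite !mxE.
  rewrite -[RHS](IH _ c a'0) -[X in leb R n X]setIT -integral_indic//; last exact: measurable_hyperplane.
  apply: eq_integral => y _; rewrite /= !indicE; congr ((_ : bool)%:R%:E).
  by rewrite /H; apply/idP/idP; rewrite !inE /= sumE a00 mul0r add0r.
rewrite (leb_tonelli21 mI I0) -[RHS](integral0 (leb R n) setT).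
apply: eq_integral => y _.
set s := \sum_i (\row_i a ord0 (lift ord0 i)) ord0 i * y ord0 i.
have <- : lebesgue_measure [set (c - s) / a ord0 ord0] = 0%E by exact: lebesgue_measure_set1.
rewrite -[X in lebesgue_measure X]setIT -integral_indic//.
apply: eq_integral => x _; rewrite /= !indicE; congr ((_ : bool)%:R%:E).
rewrite /H; apply/idP/idP; rewrite !inE /= sumE -/s => h.
  by rewrite -h addrK mulrC mulKf.
by rewrite h mulrC divfK// subrK.
Qed.

End hyperplane.

(** * Square integrable vector fields *)

Section L2v_theory.
Variables (R : realType) (n : nat) (D : set 'rV[R]_n.+1).
Hypothesis mD : measurable D.
Local Notation E := 'rV[R]_n.+1.
Implicit Types (p q h : E -> E).

Lemma ipvE p q : L2v D p -> L2v D q ->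
  ipv D p q = \sum_i ip D (fun x => p x ord0 i) (fun x => q x ord0 i).
Proof.
move=> Lp Lq; rewrite /ipv /dot.
elim: (index_enum _) => [|i s IH].
  rewrite big_nil /Rintegral; under eq_integral do rewrite big_nil.
  by rewrite integral0.
rewrite big_cons -IH -RintegralD//; last 2 first.
- exact: L2_integrable_mul.
- rewrite (_ : EFin \o _ = (fun x => \sum_(j <- s) (p x ord0 j * q x ord0 j)%:E)%E).
    by apply: integrable_sum => // j _; exact: L2_integrable_mul.
  by apply/funext => x; rewrite /= sumEFin.
by apply: eq_Rintegral => x _; rewrite big_cons.
Qed.

Lemma ipvC p q : ipv D p q = ipv D q p.
Proof.
by apply: eq_Rintegral => x _; rewrite /dot; apply: eq_bigr => i _; rewrite mulrC.
Qed.

Lemma ipv_eq p p' q q' : (forall x, D x -> p x = p' x) ->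
  (forall x, D x -> q x = q' x) -> ipv D p q = ipv D p' q'.
Proof.
by move=> pp qq; apply: eq_Rintegral => x /set_mem Dx; rewrite pp// qq.
Qed.

Lemma L2v_eq p q : (forall x, D x -> p x = q x) -> L2v D p -> L2v D q.
Proof. by move=> pq Lp i; apply: L2_eq (Lp i) => x Dx; rewrite pq. Qed.

Lemma L2v_0 : L2v D (fun=> 0).
Proof. by move=> i; apply: L2_eq (L2_0 D) => x _; rewrite mxE. Qed.

Lemma L2v_D p q : L2v D p -> L2v D q -> L2v D (fun x => p x + q x).
Proof. by move=> Lp Lq i; apply: L2_eq (L2_D mD (Lp i) (Lq i)) => x _; rewrite mxE. Qed.

Lemma L2v_Z a p : L2v D p -> L2v D (fun x => a *: p x).
Proof. by move=> Lp i; apply: L2_eq (L2_Z mD a (Lp i)) => x _; rewrite mxE. Qed.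

Lemma L2v_B p q : L2v D p -> L2v D q -> L2v D (fun x => p x - q x).
Proof. by move=> Lp Lq i; apply: L2_eq (L2_B mD (Lp i) (Lq i)) => x _; rewrite !mxE. Qed.

Lemma ipvDl p p' q : L2v D p -> L2v D p' -> L2v D q ->
  ipv D (fun x => p x + p' x) q = ipv D p q + ipv D p' q.
Proof.
move=> Lp Lp' Lq; rewrite !ipvE//; last exact: L2v_D.
rewrite -big_split; apply: eq_bigr => i _ /=.
by rewrite -ipDl//; apply: ip_eq => // x _; rewrite mxE.
Qed.

Lemma ipvZl a p q : L2v D p -> L2v D q ->
  ipv D (fun x => a *: p x) q = a * ipv D p q.
Proof.
move=> Lp Lq; rewrite !ipvE//; last exact: L2v_Z.
rewrite mulr_sumr; apply: eq_bigr => i _ /=.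
by rewrite -ipZl//; apply: ip_eq => // x _; rewrite mxE.
Qed.

Lemma ipvBl p p' q : L2v D p -> L2v D p' -> L2v D q ->
  ipv D (fun x => p x - p' x) q = ipv D p q - ipv D p' q.
Proof.
move=> Lp Lp' Lq.
have -> : ipv D (fun x => p x - p' x) q = ipv D (fun x => p x + (-1) *: p' x) q.
  by apply: ipv_eq => // x _; rewrite scaleN1r.
rewrite ipvDl//; last exact: L2v_Z.
by rewrite ipvZl// mulN1r.
Qed.

Lemma ipvDr p q q' : L2v D p -> L2v D q -> L2v D q' ->
  ipv D p (fun x => q x + q' x) = ipv D p q + ipv D p q'.
Proof. by move=> *; rewrite ipvC ipvDl// !(ipvC p). Qed.

Lemma ipvZr a p q : L2v D p -> L2v D q ->
  ipv D p (fun x => a *: q x) = a * ipv D p q.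
Proof. by move=> *; rewrite ipvC ipvZl// ipvC. Qed.

Lemma ipvBr p q q' : L2v D p -> L2v D q -> L2v D q' ->
  ipv D p (fun x => q x - q' x) = ipv D p q - ipv D p q'.
Proof. by move=> *; rewrite ipvC ipvBl// !(ipvC p). Qed.

Lemma ipv_ge0 p : 0 <= ipv D p p.
Proof.
by apply: Rintegral_ge0 => x _; apply: sumr_ge0 => i _; rewrite -expr2 sqr_ge0.
Qed.

Lemma ipv_CS p q : L2v D p -> L2v D q -> ipv D p q ^+ 2 <= ipv D p p * ipv D q q.
Proof.
move=> Lp Lq; apply: discr_le => t.
have := ipv_ge0 (fun x => p x + t *: q x).
have Ltq := L2v_Z t Lq.
rewrite ipvDl// ?ipvDr// ?ipvZl// ?ipvZr//; last exact: L2v_D.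
rewrite (ipvC q p); suff -> : forall a b c : R,
  a + t * b + (t * b + t * (t * c)) = a + 2 * t * b + t ^+ 2 * c by [].
by move=> *; ring.
Qed.

End L2v_theory.

(** * Closed subspaces of finite products of L2 *)

Section L2_families.
Variables (R : realType) (n : nat) (D : set 'rV[R]_n.+1).
Hypothesis mD : measurable D.
Local Notation E := 'rV[R]_n.+1.

Definition cvgL2 (f : nat -> E -> R) (g : E -> R) := forall e, 0 < e ->
  exists N, forall k, (N <= k)%N -> ip D (fun x => f k x - g x) (fun x => f k x - g x) <= e.

Lemma cvgL2_ip (f : nat -> E -> R) g h : (forall k, L2 D (f k)) -> L2 D g -> L2 D h ->
  cvgL2 f g -> (fun k => ip D (f k) h) @ \oo --> ip D g h.
Proof.
move=> Lf Lg Lh fg; apply/cvgrPdist_le => e e0.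
have hh := ip_ge0 D h.
have c0 : 0 < ip D h h + 1 by lra.
have [|N HN] := fg (e ^+ 2 / (ip D h h + 1)); first by rewrite divr_gt0// exprn_gt0.
exists N => // k /= /HN Hk.
rewrite -(ler_pXn2r (n := 2))// ?nnegrE; last exact: ltW.
rewrite real_normK ?num_real//.
rewrite -sqrrN opprB -ipBl//.
apply: le_trans (ip_CS mD (L2_B mD (Lf k) Lg) Lh) _.
apply: le_trans (ler_wpM2r hh Hk) _.
rewrite mulrAC ler_pdivrMr// ler_wpM2l ?sqr_ge0//; lra.
Qed.

(** The equations that define weak derivatives have this form and are thus inherited by L2
    limits. *)
Lemma cvgL2_sum_eq0 (J : finType) (f : J -> nat -> E -> R) (g h : J -> E -> R) :
  (forall j k, L2 D (f j k)) -> (forall j, L2 D (g j)) -> (forall j, L2 D (h j)) ->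
  (forall j, cvgL2 (f j) (g j)) -> (forall k, \sum_j ip D (f j k) (h j) = 0) ->
  \sum_j ip D (g j) (h j) = 0.
Proof.
move=> Lf Lg Lh fg f0.
have : (fun k => \sum_j ip D (f j k) (h j)) @ \oo --> \sum_j ip D (g j) (h j).
  by apply: cvg_big => [|j _]; [exact: add_continuous|exact: cvgL2_ip].
under eq_fun do rewrite f0.
by move/cvg_lim => <-//; rewrite lim_cst.
Qed.

Variables (J : finType) (c : J -> R).
Hypothesis c0 : forall j, 0 < c j.
Local Notation V := (J -> E -> R).
Implicit Types F G : V.

Definition ipJ F G : R := \sum_j c j * ip D (F j) (G j).

Variable Q : V -> Prop.
Hypothesis QL : forall F, Q F -> forall j, L2 D (F j).
Hypothesis Q0 : Q (fun _ _ => 0).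
Hypothesis Qlin : forall a F G, Q F -> Q G -> Q (fun j x => a * F j x + G j x).
Hypothesis Qclosed : forall (F : nat -> V) G, (forall k, Q (F k)) ->
  (forall j, L2 D (G j)) -> (forall j, cvgL2 (fun k => F k j) (G j)) -> Q G.

(** [Q] is meant to be a space of functions listed together with their weak derivatives.
    Completeness in the graph norm is then completeness of L2 in each component, and only the
    closedness of the differential relations is left to check. *)
Lemma riesz_L2J (l : V -> R) (C : R) : 0 <= C ->
  (forall a F G, Q F -> Q G -> l (fun j x => a * F j x + G j x) = a * l F + l G) ->
  (forall F, Q F -> l F ^+ 2 <= C * ipJ F F) ->
  exists2 T, Q T & forall F, Q F -> ipJ T F = l F.
Proof.
move=> C0 llin lbnd.
have QB F G : Q F -> Q G -> Q (fun j x => F j x - G j x).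
  move=> QF QG; have := Qlin (-1) QG QF; congr Q.
  by apply/funext => j; apply/funext => x; rewrite mulN1r addrC.
apply: (@riesz_representation _ V Q ipJ _ _ _ _ _ _ l C) => //.
- move=> F G QF QG; apply: eq_bigr => j _; by rewrite ipC.
- move=> a F G H QF QG QH; rewrite /ipJ mulr_sumr -big_split; apply: eq_bigr => j _ /=.
  rewrite -[X in ip D X]/(fun x => a * F j x + G j x) ipDl ?ipZl//; try exact: QL.
    by ring.
  by apply: L2_Z => //; exact: QL.
- by move=> F QF; apply: sumr_ge0 => j _; rewrite mulr_ge0 ?ip_ge0// ltW.
- move=> u Qu cau.
  have part F j : c j * ip D (F j) (F j) <= ipJ F F.
    rewrite /ipJ (bigD1 j)//= lerDl sumr_ge0// => i _.
    by rewrite mulr_ge0 ?ip_ge0// ltW.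
  have /choice[g gP] : forall j, exists g, L2 D g /\ cvgL2 (fun k => u k j) g.
    move=> j; have [|e e0|g Lg gg] := @L2_complete _ _ D mD (fun k => u k j).
    - by move=> k; exact: QL.
    - have [|N HN] := cau (c j * e); first by rewrite mulr_gt0.
      exists N => k m Nk Nm; have := le_trans (part _ j) (HN k m Nk Nm).
      by rewrite ler_pM2l.
    - by exists g.
  have Qg : Q g.
    by apply: (Qclosed Qu) => j; have [] := gP j.
  exists g => // e e0.
  pose w := \sum_j c j + 1.
  have w0 : 0 < w by rewrite ltr_wpDl// sumr_ge0// => j _; exact: ltW.
  have /choice[N NP] : forall j, exists N, forall k, (N <= k)%N ->
      ip D (fun x => u k j x - g j x) (fun x => u k j x - g j x) <= e / w.
    by move=> j; have [_] := gP j; apply; rewrite divr_gt0.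
  exists (\max_j N j)%N => k Nk.
  apply: (@le_trans _ _ (\sum_j c j * (e / w))).
    apply: ler_sum => j _; rewrite ler_wpM2l ?(ltW (c0 j))//.
    by apply: NP; apply: leq_trans Nk; exact: leq_bigmax.
  rewrite -mulr_suml mulrCA ler_piMr ?(ltW e0)// ler_pdivrMr// mul1r /w.
  by rewrite lerDl.
Qed.

End L2_families.

(* Turns the integrals into variables: ring and nra would otherwise try to
   unify them by unfolding. *)
Ltac absip := repeat
  match goal with
  | |- context [ip ?D ?f ?g] => let x := fresh "x" in set (x := ip D f g) in *; clearbody x
  | |- context [ipv ?D ?f ?g] => let x := fresh "x" in set (x := ipv D f g) in *; clearbody x
  | H : context [ip ?D ?f ?g] |- _ => let x := fresh "x" in set (x := ip D f g) in *; clearbody x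
  | H : context [ipv ?D ?f ?g] |- _ => let x := fresh "x" in set (x := ipv D f g) in *; clearbody x
  end.

Lemma lin_bound_lt (R : realFieldType) (a x y e : R) :
  0 <= a -> 0 <= x -> 0 <= y ->
  x < e / (4 * a + 4) -> y < e / (4 * a + 4) -> 2 * a * x + 2 * y < e.
Proof.
move=> a0 x0 y0; have k0 : 0 < 4 * a + 4 by lra.
by rewrite !ltr_pdivlMr// => h h'; nra.
Qed.

Lemma sum_sqr_le (R : realFieldType) (A B x y u v e : R) :
  0 <= A -> 0 <= B -> 0 <= x -> 0 <= y -> u ^+ 2 <= A * x -> v ^+ 2 <= B * y ->
  (y + x) * (2 * (A + B) + 1) < e -> (u + v) ^+ 2 <= e.
Proof.
move=> A0 B0 x0 y0 ux vy he.
have h1 : (u + v) ^+ 2 <= 2 * u ^+ 2 + 2 * v ^+ 2.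
  by have := sqr_ge0 (u - v); rewrite !expr2; lra.
have h2 := mulr_ge0 A0 y0; have h3 := mulr_ge0 B0 x0.
have h4 : (y + x) * (2 * (A + B) + 1) =
  2 * (A * x) + 2 * (A * y) + 2 * (B * x) + 2 * (B * y) + x + y by ring.
lra.
Qed.

(** * Weak derivatives *)

Section weak_derivatives.
Variables (R : realType) (n : nat) (D : set 'rV[R]_n.+1).
Hypothesis oD : open D.
Local Notation E := 'rV[R]_n.+1.
Implicit Types (f g h w v : E -> R) (p q : E -> E).

Let mD : measurable D. Proof. exact: open_measurable_rV. Qed.

(** By the fundamental lemma [f - g] has norm 0, and such a function is orthogonal to all of L2. *)
Lemma test_eq_ip f g h : L2 D f -> L2 D g -> L2 D h ->
  (forall phi, test_function D phi -> ip D f phi = ip D g phi) -> ip D f h = ip D g h.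
Proof.
move=> Lf Lg Lh H; apply/eqP; rewrite -subr_eq0 -ipBl//; apply/eqP.
have Lfg := L2_B mD Lf Lg; apply: ip_null => //.
apply: fundamental_lemma => // phi T; have Lp := test_L2 mD T.
by rewrite ipBl// H// subrr.
Qed.

Lemma wgradP w : H1 D w -> is_wgrad D w (wgrad D w).
Proof. by case=> _ [q wq]; apply: (getPex (P := [set q | is_wgrad D w q])); exists q. Qed.

Lemma wdivP q : Hdiv D q -> is_wdiv D q (wdiv D q).
Proof. by case=> _ [h qh]; apply: (getPex (P := [set h | is_wdiv D q h])); exists h. Qed.

Lemma H1_L2 w : H1 D w -> L2 D w. Proof. by case. Qed.

Lemma Hdiv_L2v q : Hdiv D q -> L2v D q. Proof. by case. Qed.

Lemma wgrad_L2v w : H1 D w -> L2v D (wgrad D w). Proof. by case/wgradP. Qed.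

Lemma wdiv_L2 q : Hdiv D q -> L2 D (wdiv D q). Proof. by case/wdivP. Qed.

Lemma is_wgrad_unique w q q' (h : E -> E) : is_wgrad D w q -> is_wgrad D w q' ->
  L2v D h -> ipv D q h = ipv D q' h.
Proof.
move=> [Lq Hq] [Lq' Hq'] Lh; rewrite !ipvE//; apply: eq_bigr => i _.
apply: test_eq_ip => // phi T.
by apply: oppr_inj; rewrite -Hq// -Hq'.
Qed.

Lemma is_wdiv_unique q h h' f : is_wdiv D q h -> is_wdiv D q h' ->
  L2 D f -> ip D h f = ip D h' f.
Proof.
move=> [Lh Hh] [Lh' Hh'] Lf; apply: test_eq_ip => // phi T.
by apply: oppr_inj; rewrite -Hh// -Hh'.
Qed.

Lemma is_wgrad_lin a w w' q q' : L2 D w -> L2 D w' ->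
  is_wgrad D w q -> is_wgrad D w' q' ->
  is_wgrad D (fun x => a * w x + w' x) (fun x => a *: q x + q' x).
Proof.
move=> Lw Lw' [Lq Hq] [Lq' Hq']; split; first by apply: L2v_D => //; exact: L2v_Z.
move=> phi T i; have Lp := test_L2 mD T; have Lpi := test_L2 mD (test_pder i T).
rewrite ipDl ?ipZl//; last exact: L2_Z.
rewrite (_ : ip D (fun x => _ ord0 i) phi =
  ip D (fun x => a * q x ord0 i + q' x ord0 i) phi); last first.
  by apply: ip_eq => // x _; rewrite !mxE.
rewrite ipDl ?ipZl//; last exact: L2_Z.
by rewrite Hq// Hq'//; absip; ring.
Qed.

Lemma is_wdiv_lin a q q' h h' : L2v D q -> L2v D q' ->
  is_wdiv D q h -> is_wdiv D q' h' ->
  is_wdiv D (fun x => a *: q x + q' x) (fun x => a * h x + h' x).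
Proof.
move=> Lq Lq' [Lh Hh] [Lh' Hh']; split; first by apply: L2_D => //; exact: L2_Z.
move=> phi T; have Lp := test_L2 mD T.
have Lgp : L2v D (grad phi).
  by move=> i; apply: L2_eq (test_L2 mD (test_pder i T)) => x _; rewrite mxE.
rewrite ipDl ?ipZl//; last exact: L2_Z.
rewrite ipvDl ?ipvZl//; last exact: L2v_Z.
by rewrite Hh// Hh'//; absip; ring.
Qed.

Lemma H1_lin a w w' : H1 D w -> H1 D w' -> H1 D (fun x => a * w x + w' x).
Proof.
move=> [Lw [q Hq]] [Lw' [q' Hq']]; split; first by apply: L2_D => //; exact: L2_Z.
by exists (fun x => a *: q x + q' x); exact: is_wgrad_lin.
Qed.

Lemma Hdiv_lin a q q' : Hdiv D q -> Hdiv D q' -> Hdiv D (fun x => a *: q x + q' x).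
Proof.
move=> [Lq [h Hh]] [Lq' [h' Hh']]; split; first by apply: L2v_D => //; exact: L2v_Z.
by exists (fun x => a * h x + h' x); exact: is_wdiv_lin.
Qed.

Lemma ipv_wgrad w q (h : E -> E) : H1 D w -> is_wgrad D w q -> L2v D h ->
  ipv D (wgrad D w) h = ipv D q h.
Proof. by move=> Hw wq; apply: is_wgrad_unique wq; exact: wgradP. Qed.

Lemma ip_wdiv q h f : Hdiv D q -> is_wdiv D q h -> L2 D f ->
  ip D (wdiv D q) f = ip D h f.
Proof. by move=> Hq qh; apply: is_wdiv_unique qh; exact: wdivP. Qed.

Lemma ipv_wgrad_lin a w w' (h : E -> E) : H1 D w -> H1 D w' -> L2v D h ->
  ipv D (wgrad D (fun x => a * w x + w' x)) h = a * ipv D (wgrad D w) h + ipv D (wgrad D w') h.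
Proof.
move=> Hw Hw' Lh; have [Lg Lg'] := (wgrad_L2v Hw, wgrad_L2v Hw').
rewrite (@ipv_wgrad _ (fun x => a *: wgrad D w x + wgrad D w' x))//.
- by rewrite ipvDl ?ipvZl//; exact: L2v_Z.
- exact: H1_lin.
- by apply: is_wgrad_lin; [exact: H1_L2|exact: H1_L2|exact: wgradP|exact: wgradP].
Qed.

Lemma ip_wdiv_lin a q q' f : Hdiv D q -> Hdiv D q' -> L2 D f ->
  ip D (wdiv D (fun x => a *: q x + q' x)) f = a * ip D (wdiv D q) f + ip D (wdiv D q') f.
Proof.
move=> Hq Hq' Lf; have [Lg Lg'] := (wdiv_L2 Hq, wdiv_L2 Hq').
rewrite (@ip_wdiv _ (fun x => a * wdiv D q x + wdiv D q' x))//.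
- by rewrite ipDl ?ipZl//; exact: L2_Z.
- exact: Hdiv_lin.
- by apply: is_wdiv_lin; [exact: Hdiv_L2v|exact: Hdiv_L2v|exact: wdivP|exact: wdivP].
Qed.

Lemma test_grad_L2v D' phi : test_function D' phi -> L2v D (grad phi).
Proof.
by move=> T i; apply: L2_eq (test_L2 mD (test_pder i T)) => x _; rewrite mxE.
Qed.

Lemma test_is_wgrad D' phi : test_function D' phi -> is_wgrad D phi (grad phi).
Proof.
move=> T; split; first exact: test_grad_L2v T.
move=> psi T' i; rewrite (@ibp_test _ _ D psi phi i mD T'); last by case: T.
by congr (- _); apply: ip_eq => // x _; rewrite mxE.
Qed.

Lemma test_H1 D' phi : test_function D' phi -> H1 D phi.
Proof.
by move=> T; split; [exact: test_L2 T|exists (grad phi); exact: test_is_wgrad T].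
Qed.

Lemma test_is_wdiv D' phi i : test_function D' phi ->
  is_wdiv D (fun x => phi x *: delta_mx ord0 i) (pder i phi).
Proof.
move=> T; have Lp := test_L2 mD T; have Lpi := test_L2 mD (test_pder i T).
split => // psi T'; have := @ibp_test _ _ D psi phi i mD T'.
move=> <-; last by case: T.
apply: eq_Rintegral => x _; rewrite /dot (bigD1 i)//= big1 ?addr0.
  by rewrite !mxE !eqxx mulr1.
by move=> j ji; rewrite !mxE (negbTE ji) andbF mulr0 mul0r.
Qed.

Lemma test_Hdiv D' phi i : test_function D' phi ->
  Hdiv D (fun x => phi x *: delta_mx ord0 i).
Proof.
move=> T; split; last by exists (pder i phi); exact: test_is_wdiv T.
move=> j; apply: L2_eq (L2_Z mD (j == i)%:R (test_L2 mD T)) => x _.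
by rewrite !mxE eqxx mulrC.
Qed.

Lemma dualityE q h w (g : E -> E) : Hdiv D q -> is_wdiv D q h -> H1 D w -> is_wgrad D w g ->
  duality D q w = ipv D q g + ip D h w.
Proof.
move=> Hq qh Hw wg; rewrite /duality (ip_wdiv Hq qh (H1_L2 Hw)) ipvC.
by rewrite (ipv_wgrad Hw wg (Hdiv_L2v Hq)) ipvC.
Qed.

Lemma duality_linr q a w w' : Hdiv D q -> H1 D w -> H1 D w' ->
  duality D q (fun x => a * w x + w' x) = a * duality D q w + duality D q w'.
Proof.
move=> Hq Hw Hw'; have [Lq Lh] := (Hdiv_L2v Hq, wdiv_L2 Hq).
have [Lw Lw'] := (H1_L2 Hw, H1_L2 Hw').
rewrite /duality ipvC ipv_wgrad_lin// !(ipvC _ q) ipDr ?ipZr//; last exact: L2_Z.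
by absip; ring.
Qed.

Lemma duality_linl a q q' w : Hdiv D q -> Hdiv D q' -> H1 D w ->
  duality D (fun x => a *: q x + q' x) w = a * duality D q w + duality D q' w.
Proof.
move=> Hq Hq' Hw; have [Lq Lq'] := (Hdiv_L2v Hq, Hdiv_L2v Hq').
have [Lw Lg] := (H1_L2 Hw, wgrad_L2v Hw).
rewrite /duality ip_wdiv_lin// ipvDl ?ipvZl//; last exact: L2v_Z.
by absip; ring.
Qed.

End weak_derivatives.

(** * Functions with zero trace *)

Section zero_trace.
Variables (R : realType) (n : nat) (D : set 'rV[R]_n.+1).
Hypothesis oD : open D.
Local Notation E := 'rV[R]_n.+1.
Implicit Types (f g h w v : E -> R) (p q : E -> E).

Let mD : measurable D. Proof. exact: open_measurable_rV. Qed.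

(** The gradient is a separate argument, so that any weak gradient may be inserted and nothing is
    tied to the choice made in [wgrad]. *)
Definition h1sq w q : R := ip D w w + ipv D q q.

Lemma h1sq_ge0 w q : 0 <= h1sq w q.
Proof. by rewrite addr_ge0 ?ip_ge0 ?ipv_ge0. Qed.

Lemma h1sq_lin a w w' q q' : L2 D w -> L2 D w' -> L2v D q -> L2v D q' ->
  h1sq (fun x => a * w x + w' x) (fun x => a *: q x + q' x)
  <= 2 * a ^+ 2 * h1sq w q + 2 * h1sq w' q'.
Proof.
move=> Lw Lw' Lq Lq'; have [La Lqa] := (L2_Z mD a Lw, L2v_Z mD a Lq).
have [L1 L2v1] := (L2_B mD La Lw', L2v_B mD Lqa Lq').
have h1 := ip_ge0 D (fun x => a * w x - w' x).
have h2 := ipv_ge0 D (fun x => a *: q x - q' x).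
rewrite /h1sq.
rewrite ipBl// !ipBr// !ipZl// !ipZr// in h1.
rewrite ipvBl// !ipvBr// !ipvZl// !ipvZr// in h2.
rewrite ipDl//; last exact: L2_D.
rewrite !ipDr// !ipZl// !ipZr//.
rewrite ipvDl//; last exact: L2v_D.
rewrite !ipvDr// !ipvZl// !ipvZr//.
rewrite (ipC _ w' w) (ipvC _ q' q) in h1 h2 *.
by absip; lra.
Qed.

Lemma H10P w q : L2 D w -> is_wgrad D w q ->
  H10 D w <-> forall e, 0 < e -> exists2 phi, test_function D phi &
    h1sq (fun x => w x - phi x) (fun x => q x - grad phi x) < e.
Proof.
move=> Lw wq; have Hw : H1 D w by split => //; exists q.
have same phi : test_function D phi ->
    ip D (w - phi) (w - phi) + ipv D (wgrad D w - grad phi) (wgrad D w - grad phi) =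
    h1sq (fun x => w x - phi x) (fun x => q x - grad phi x).
  move=> T; have Lp := test_L2 mD T; have Lg := test_grad_L2v oD T.
  have Lq : L2v D q by case: wq.
  have Lwg := wgrad_L2v Hw.
  congr (_ + _); rewrite -[LHS]/(ipv D (fun x => wgrad D w x - grad phi x)
     (fun x => wgrad D w x - grad phi x)).
  have L1 := L2v_B mD Lwg Lg; have L2' := L2v_B mD Lq Lg.
  rewrite ipvBl// (ipv_wgrad oD Hw wq L1) -ipvBl// ipvC ipvBl//.
  by rewrite (ipv_wgrad oD Hw wq L2') -ipvBl.
split.
  by move=> [_ H] e /H[phi T lt]; exists phi => //; rewrite -same.
by move=> H; split => // e /H[phi T lt]; exists phi => //; rewrite same.
Qed.

Lemma H10_H1 w : H10 D w -> H1 D w. Proof. by case. Qed.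

Lemma test_H10 phi : test_function D phi -> H10 D phi.
Proof.
move=> T; apply/(H10P (test_L2 mD T) (test_is_wgrad oD T)) => e e0.
exists phi => //; rewrite /h1sq (_ : (fun x => phi x - phi x) = fun=> 0); last first.
  by apply/funext => x; rewrite subrr.
rewrite ip0l add0r (_ : (fun x => _) = fun=> 0); last by apply/funext => x; rewrite subrr.
by rewrite ipvE//; [rewrite big1// => i _; rewrite -[RHS](ip0l D (fun=> 0)); apply: ip_eq => // x _; rewrite mxE|exact: L2v_0..].
Qed.

Lemma H10_closure w q : L2 D w -> is_wgrad D w q ->
  (forall e, 0 < e -> exists v p, [/\ H10 D v, is_wgrad D v p &
     h1sq (fun x => w x - v x) (fun x => q x - p x) <= e]) -> H10 D w.
Proof.
move=> Lw wq H; apply/(H10P Lw wq) => e e0.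
have [|v [p [Hv vp vwe]]] := H (e / 5); first by rewrite divr_gt0.
have Lv : L2 D v by case: Hv => -[].
have [|phi T pe] := (H10P Lv vp).1 Hv (e / 5); first by rewrite divr_gt0.
exists phi => //.
have [Lq Lp] : L2v D q /\ L2v D p by case: wq; case: vp.
have Lphi := test_L2 mD T; have Lg := test_grad_L2v oD T.
have := h1sq_lin 1 (L2_B mD Lw Lv) (L2_B mD Lv Lphi) (L2v_B mD Lq Lp) (L2v_B mD Lp Lg).
rewrite (_ : (fun x => 1 * _ + _) = (fun x => w x - phi x)); last first.
  by apply/funext => x; ring.
rewrite (_ : (fun x => 1 *: _ + _) = (fun x => q x - grad phi x)); last first.
  by apply/funext => x; rewrite scale1r subrKA.
by rewrite expr1n mulr1 => /le_lt_trans; apply; lra.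
Qed.

Lemma H10_lin a w w' : H10 D w -> H10 D w' -> H10 D (fun x => a * w x + w' x).
Proof.
move=> Hw Hw'; have [Lw Lw'] : L2 D w /\ L2 D w' by split; [case: Hw => -[]|case: Hw' => -[]].
have wq := wgradP (H10_H1 Hw); have wq' := wgradP (H10_H1 Hw').
have [Lq Lq'] : L2v D (wgrad D w) /\ L2v D (wgrad D w') by case: wq; case: wq'.
apply/(H10P (L2_D mD (L2_Z mD a Lw) Lw') (is_wgrad_lin oD a Lw Lw' wq wq')) => e e0.
have c0 : 0 < e / (4 * a ^+ 2 + 4).
  by rewrite divr_gt0// ltr_wpDl// mulr_ge0// sqr_ge0.
have [phi T he] := (H10P Lw wq).1 Hw _ c0.
have [psi T' he'] := (H10P Lw' wq').1 Hw' _ c0.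
exists (fun x => a * phi x + psi x); first by apply: test_function_D => //; exact: test_function_Z.
have [Lp Lp'] := (test_L2 mD T, test_L2 mD T').
have [Lg Lg'] := (test_grad_L2v oD T, test_grad_L2v oD T').
have := h1sq_lin a (L2_B mD Lw Lp) (L2_B mD Lw' Lp') (L2v_B mD Lq Lg) (L2v_B mD Lq' Lg').
rewrite (_ : (fun x => a * _ + _) = (fun x => a * w x + w' x - (a * phi x + psi x))); last first.
  by apply/funext => x; ring.
rewrite (_ : (fun x => a *: _ + _) =
    (fun x => a *: wgrad D w x + wgrad D w' x - grad (fun x => a * phi x + psi x) x)); last first.
  apply/funext => x; apply/rowP => i; rewrite !mxE /pder.
  have [[Cp _ _] [Cp' _ _]] := (T, T').
  have /CkS[_ dp _] := Cp 1%N; have /CkS[_ dp' _] := Cp' 1%N.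
  have -> : 'D_(delta_mx ord0 i) (fun x => a * phi x + psi x) x =
     a * 'D_(delta_mx ord0 i) phi x + 'D_(delta_mx ord0 i) psi x.
    rewrite -[LHS]/('D_(delta_mx ord0 i) ((a *: phi) + psi) x) deriveD//.
      by rewrite deriveZ.
    exact: derivableZ.
  by ring.
move=> /le_lt_trans; apply.
by apply: lin_bound_lt he he'; rewrite ?sqr_ge0 ?h1sq_ge0.
Qed.

(** For a test function the pairing vanishes by the definition of the weak divergence. It is
    continuous in the H^1 norm by Cauchy-Schwarz, so it vanishes on the closure. *)
Lemma duality_H10 q w : Hdiv D q -> H10 D w -> duality D q w = 0.
Proof.
move=> Hq Hw; have [Lq Lh] := (Hdiv_L2v Hq, wdiv_L2 Hq).
have [Lw Lg] := (H1_L2 (H10_H1 Hw), wgrad_L2v (H10_H1 Hw)).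
have wq := wgradP (H10_H1 Hw).
apply/eqP; rewrite -sqrf_eq0; apply/eqP/le_anti; rewrite sqr_ge0 andbT.
apply/ler_addgt0Pr => e e0; rewrite add0r.
pose C := 2 * (ipv D q q + ip D (wdiv D q) (wdiv D q)) + 1.
have qq := ipv_ge0 D q; have hh := ip_ge0 D (wdiv D q).
have C0 : 0 < C by rewrite /C; lra.
have [|phi T he] := (H10P Lw wq).1 Hw (e / C); first by rewrite divr_gt0.
have [Lp Lgp] := (test_L2 mD T, test_grad_L2v oD T).
have -> : duality D q w = ipv D q (fun x => wgrad D w x - grad phi x) +
    ip D (wdiv D q) (fun x => w x - phi x).
  rewrite ipvBr// ipBr//; have [_ ->//] := wdivP Hq; by rewrite /duality; absip; ring.
have L1 := L2v_B mD Lg Lgp; have L2' := L2_B mD Lw Lp.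
have h1 := ipv_CS mD Lq L1; have h2 := ip_CS mD Lh L2'.
have g1 := ipv_ge0 D (fun x => wgrad D w x - grad phi x).
have g2 := ip_ge0 D (fun x => w x - phi x).
move: he; rewrite /h1sq ltr_pdivlMr// /C => he.
exact: (sum_sqr_le qq hh g1 g2 h1 h2 he).
Qed.

End zero_trace.

(** * Riesz representation in spaces of weakly differentiable functions *)

Section riesz_data.
Variables (R : realType) (n : nat) (D : set 'rV[R]_n.+1).
Hypothesis mD : measurable D.
Local Notation E := 'rV[R]_n.+1.
Variables (J : finType) (c : J -> R).
Hypothesis c0 : forall j, 0 < c j.
Local Notation V := (J -> E -> R).
Variable Q : V -> Prop.
Hypothesis QL : forall F, Q F -> forall j, L2 D (F j).
Hypothesis Q0 : Q (fun _ _ => 0).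
Hypothesis Qlin : forall a F G, Q F -> Q G -> Q (fun j x => a * F j x + G j x).
Hypothesis Qclosed : forall (F : nat -> V) G, (forall k, Q (F k)) ->
  (forall j, L2 D (G j)) -> (forall j, cvgL2 D (fun k => F k j) (G j)) -> Q G.

Lemma riesz_L2J_data (K : V) : (forall j, L2 D (K j)) ->
  exists2 T, Q T & forall F, Q F -> ipJ D c T F = \sum_j ip D (K j) (F j).
Proof.
move=> LK.
apply: (riesz_L2J mD c0 QL Q0 Qlin Qclosed (C := \sum_j (c j)^-1 * ip D (K j) (K j))).
- by apply: sumr_ge0 => j _; rewrite mulr_ge0 ?ip_ge0// invr_ge0 ltW.
- move=> a F G QF QG; rewrite mulr_sumr -big_split; apply: eq_bigr => j _ /=.
  have [LF LG] := (QL QF j, QL QG j).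
  by rewrite ipDr ?ipZr//; exact: L2_Z.
(* The quadratic in [t] is [sum_j c_j |K_j / c_j + t F_j|^2]. *)
- move=> F QF; apply: discr_le => t.
  rewrite /ipJ !mulr_sumr -!big_split; apply: sumr_ge0 => j _ /=.
  have LF := QL QF j; have Lt := L2_Z mD t LF; have cj := c0 j.
  have Lk := L2_Z mD (c j)^-1 (LK j).
  have := ip_ge0 D (fun x => (c j)^-1 * K j x + t * F j x).
  rewrite ipDl ?ipDr ?ipZl ?ipZr//; last exact: L2_D.
  rewrite (ipC D (F j) (K j)); absip => h.
  apply: le_trans (mulr_ge0 (ltW cj) h) _.
  by rewrite le_eqVlt; apply/orP; left; apply/eqP; field; rewrite gt_eqF.
Qed.

End riesz_data.

Section families.
Variables (R : realType) (n : nat) (D : set 'rV[R]_n.+1).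
Hypothesis oD : open D.
Local Notation E := 'rV[R]_n.+1.

Let mD : measurable D. Proof. exact: open_measurable_rV. Qed.

(** A function is put in front of a family: (w, grad w) and (div q, q) become families of [n + 2]
    scalar functions, and (Lap w, w, grad w) one of [n + 3]. *)
Definition consF m (w : E -> R) (F : 'I_m -> E -> R) (j : 'I_m.+1) : E -> R :=
  if unlift ord0 j is Some i then F i else w.

Lemma consF0 m w (F : 'I_m -> E -> R) : consF w F ord0 = w.
Proof. by rewrite /consF unlift_none. Qed.

Lemma consFS m w (F : 'I_m -> E -> R) i : consF w F (lift ord0 i) = F i.
Proof. by rewrite /consF liftK. Qed.

Definition coor (q : E -> E) (i : 'I_n.+1) : E -> R := fun x => q x ord0 i.

Definition rowF (F : 'I_n.+1 -> E -> R) : E -> E := fun x => \row_i F i x.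

Definition tailF m (F : 'I_m.+1 -> E -> R) : 'I_m -> E -> R := fun i => F (lift ord0 i).

Lemma tailFK m w (F : 'I_m -> E -> R) : tailF (consF w F) = F.
Proof. by apply/funext => i; rewrite /tailF consFS. Qed.

Lemma rowFK q : rowF (coor q) = q.
Proof. by apply/funext => x; apply/rowP => i; rewrite mxE. Qed.

Lemma L2v_rowF F : (forall i, L2 D (F i)) -> L2v D (rowF F).
Proof. by move=> LF i; apply: L2_eq (LF i) => x _; rewrite mxE. Qed.

Lemma sum_consF m (F : 'I_m.+1 -> E -> R) w (G : 'I_m -> E -> R) (c : 'I_m.+1 -> R) :
  \sum_j c j * ip D (F j) (consF w G j) =
  c ord0 * ip D (F ord0) w + \sum_i c (lift ord0 i) * ip D (tailF F i) (G i).
Proof.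
by rewrite big_ord_recl consF0; congr (_ + _); apply: eq_bigr => i _; rewrite consFS.
Qed.

Lemma sum_coor c F q : L2v D q -> (forall i, L2 D (F i)) ->
  \sum_i c * ip D (F i) (coor q i) = c * ipv D (rowF F) q.
Proof.
move=> Lq LF; rewrite ipvE//; last exact: L2v_rowF.
rewrite mulr_sumr; apply: eq_bigr => i _; congr (_ * _).
by apply: ip_eq => // x _; rewrite mxE.
Qed.

Lemma is_wgrad_closed (F : nat -> 'I_n.+2 -> E -> R) (G : 'I_n.+2 -> E -> R) :
  (forall k j, L2 D (F k j)) -> (forall j, L2 D (G j)) ->
  (forall j, cvgL2 D (fun k => F k j) (G j)) ->
  (forall k, is_wgrad D (F k ord0) (rowF (tailF (F k)))) ->
  is_wgrad D (G ord0) (rowF (tailF G)).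
Proof.
move=> LF LG FG HF; split; first by apply: L2v_rowF => i; exact: LG.
move=> phi T i; apply/eqP; rewrite -addr_eq0; apply/eqP.
have [Lp Lpi] := (test_L2 mD T, test_L2 mD (test_pder i T)).
have rowE (H : 'I_n.+2 -> E -> R) : ip D (fun x => rowF (tailF H) x ord0 i) phi =
    ip D (H (lift ord0 i)) phi.
  by apply: ip_eq => // x _; rewrite mxE.
(* The two terms of the weak derivative equation are indexed by [bool], to fit [cvgL2_sum_eq0]. *)
pose f (b : bool) := if b then (ord0 : 'I_n.+2) else lift ord0 i.
pose h (b : bool) := if b then pder i phi else phi.
have := @cvgL2_sum_eq0 _ _ _ mD bool (fun b k => F k (f b)) (fun b => G (f b)) h.
rewrite big_bool/= rowE; apply => //; first by case.
move=> k; rewrite big_bool/=; have [_ /(_ phi T i) ->] := HF k.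
by rewrite rowE addNr.
Qed.

Lemma is_wdiv_closed (F : nat -> 'I_n.+2 -> E -> R) (G : 'I_n.+2 -> E -> R) :
  (forall k j, L2 D (F k j)) -> (forall j, L2 D (G j)) ->
  (forall j, cvgL2 D (fun k => F k j) (G j)) ->
  (forall k, is_wdiv D (rowF (tailF (F k))) (F k ord0)) ->
  is_wdiv D (rowF (tailF G)) (G ord0).
Proof.
move=> LF LG FG HF; split => // phi T; apply/eqP; rewrite -addr_eq0 addrC; apply/eqP.
have Lp := test_L2 mD T; have Lg := test_grad_L2v oD T.
have sumE H : (forall j, L2 D (H j)) ->
    \sum_j ip D (H j) (consF phi (coor (grad phi)) j) =
    ip D (H ord0) phi + ipv D (rowF (tailF H)) (grad phi).
  move=> LH; have := sum_consF H phi (coor (grad phi)) (fun=> 1).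
  rewrite sum_coor//; last by move=> i; exact: LH.
  by rewrite !mul1r => <-; apply: eq_bigr => j _; rewrite mul1r.
rewrite -sumE//; apply: (cvgL2_sum_eq0 mD (f := fun j k => F k j)) => //.
- by move=> j; rewrite /consF; case: unliftP => // i _; exact: Lg.
- by move=> k; rewrite sumE//; have [_ /(_ phi T) ->] := HF k; rewrite subrr.
Qed.

Lemma h1sq_small (F : nat -> 'I_n.+2 -> E -> R) (G : 'I_n.+2 -> E -> R) e :
  (forall k j, L2 D (F k j)) -> (forall j, L2 D (G j)) -> 0 < e ->
  (forall j, cvgL2 D (fun k => F k j) (G j)) ->
  exists k, h1sq D (fun x => G ord0 x - F k ord0 x)
    (fun x => rowF (tailF G) x - rowF (tailF (F k)) x) <= e.
Proof.
move=> LF LG e0 FG.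
have w0 : 0 < n.+2%:R :> R by rewrite ltr0n.
have /choice[N NP] : forall j, exists N, forall k, (N <= k)%N ->
    ip D (fun x => F k j x - G j x) (fun x => F k j x - G j x) <= e / n.+2%:R.
  by move=> j; apply: (FG j); rewrite divr_gt0.
exists (\max_j N j)%N; set k := (\max_j N j)%N.
have Hj j : ip D (fun x => G j x - F k j x) (fun x => G j x - F k j x) <= e / n.+2%:R.
  rewrite (_ : ip _ _ _ = ip D (fun x => F k j x - G j x) (fun x => F k j x - G j x)).
    by apply: NP; exact: leq_bigmax.
  by apply: eq_Rintegral => x _; ring.
have L1 : L2v D (fun x => rowF (tailF G) x - rowF (tailF (F k)) x).
  by apply: L2v_B => //; apply: L2v_rowF => i; [exact: LG|exact: LF].
rewrite /h1sq ipvE//.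
apply: (@le_trans _ _ (\sum_(j < n.+2) e / n.+2%:R)); last first.
  by rewrite sumr_const card_ord -[leLHS]mulr_natr divfK ?gt_eqF.
rewrite [leRHS]big_ord_recl; apply: lerD; first exact: Hj.
apply: ler_sum => i _; apply: le_trans (Hj (lift ord0 i)).
by rewrite le_eqVlt; apply/orP; left; apply/eqP; apply: ip_eq => x _; rewrite !mxE.
Qed.

Section riesz_gradient.
Variable S : (E -> R) -> Prop.
Hypothesis SH1 : forall w, S w -> H1 D w.
Hypothesis S0 : S (fun=> 0).
Hypothesis Slin : forall a w w', S w -> S w' -> S (fun x => a * w x + w' x).
Hypothesis Sclosed : forall w q, L2 D w -> is_wgrad D w q ->
  (forall e, 0 < e -> exists v p, [/\ S v, is_wgrad D v p &
     h1sq D (fun x => w x - v x) (fun x => q x - p x) <= e]) -> S w.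

Lemma is_wgrad0 : is_wgrad D (fun=> 0) (fun=> 0).
Proof.
split; first exact: L2v_0.
move=> phi T i; rewrite ip0l (_ : ip D _ phi = 0) ?oppr0// -[RHS](ip0l D phi).
by apply: ip_eq => // x _; rewrite mxE.
Qed.

(** [S] stands for H^1 or for [H10], which differ only in the reason why they are closed. *)
Lemma riesz_gradient (c0 c1 : R) f (G : E -> E) : 0 < c0 -> 0 < c1 -> L2 D f -> L2v D G ->
  exists2 w, S w & forall v, S v ->
    c0 * ip D w v + c1 * ipv D (wgrad D w) (wgrad D v) = ip D f v + ipv D G (wgrad D v).
Proof.
move=> c00 c10 Lf LG.
pose c (j : 'I_n.+2) := if unlift ord0 j is Some _ then c1 else c0.
have cp j : 0 < c j by rewrite /c; case: unlift.
pose Q (F : 'I_n.+2 -> E -> R) := S (F ord0) /\ is_wgrad D (F ord0) (rowF (tailF F)).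
have QL F : Q F -> forall j, L2 D (F j).
  move=> [SF [LF _]] j; have [i ->|->] := unliftP ord0 j; last exact: H1_L2 (SH1 SF).
  by apply: L2_eq (LF i) => x _; rewrite mxE.
have rowE a (F F' : 'I_n.+2 -> E -> R) : rowF (tailF (fun j x => a * F j x + F' j x)) =
    (fun x => a *: rowF (tailF F) x + rowF (tailF F') x).
  by apply/funext => x; apply/rowP => i; rewrite !mxE.
have [||||T QT TP] := @riesz_L2J_data _ _ D mD _ c cp Q QL _ _ _ (consF f (coor G)).
- split => //; rewrite (_ : rowF _ = fun=> 0); first exact: is_wgrad0.
  by apply/funext => x; apply/rowP => i; rewrite !mxE.
- move=> a F F' QF QF'; have [[SF gF] [SF' gF']] := (QF, QF').
  split; first exact: Slin.
  by rewrite rowE; apply: is_wgrad_lin => //; exact: QL.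
- move=> F F' QF LF' FF'.
  have gF' : is_wgrad D (F' ord0) (rowF (tailF F')).
    apply: (is_wgrad_closed _ LF' FF'); first by move=> k; exact: QL.
    by move=> k; have [] := QF k.
  split => //; apply: (Sclosed (LF' ord0) gF') => e e0.
  have [k hk] := h1sq_small (fun k => QL _ (QF k)) LF' e0 FF'.
  by have [SFk gFk] := QF k; exists (F k ord0), (rowF (tailF (F k))).
- by move=> j; rewrite /consF; case: unliftP => [i _|//]; exact: LG.
have [ST gT] := QT; exists (T ord0) => // v Sv.
have Hv := SH1 Sv; have [Lv Lgv] := (H1_L2 Hv, wgrad_L2v Hv).
have QF : Q (consF v (coor (wgrad D v))).
  rewrite /Q consF0 tailFK rowFK; split => //; exact: wgradP.
have := TP _ QF; rewrite /ipJ sum_consF.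
under [X in _ + X = _ -> _]eq_bigr do rewrite /c liftK.
rewrite /c unlift_none sum_coor//; last by move=> i; exact: QL.
have := sum_consF (consF f (coor G)) v (coor (wgrad D v)) (fun=> 1).
rewrite tailFK sum_coor// rowFK consF0 !mul1r => sE.
rewrite (ipv_wgrad oD (SH1 ST) gT Lgv) => ->; rewrite -sE.
by apply: eq_bigr => j _; rewrite mul1r.
Qed.

End riesz_gradient.

Lemma riesz_H1 (c0 c1 : R) f G : 0 < c0 -> 0 < c1 -> L2 D f -> L2v D G ->
  exists2 w, H1 D w & forall v, H1 D v ->
    c0 * ip D w v + c1 * ipv D (wgrad D w) (wgrad D v) = ip D f v + ipv D G (wgrad D v).
Proof.
move=> c00 c10 Lf LG; apply: riesz_gradient => //.
- by split; [exact: L2_0|exists (fun=> 0); exact: is_wgrad0].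
- by move=> a w w'; exact: H1_lin.
- by move=> w q Lw wq _; split => //; exists q.
Qed.

Lemma riesz_H10 f G : L2 D f -> L2v D G ->
  exists2 w, H10 D w & forall v, H10 D v ->
    ip D w v + ipv D (wgrad D w) (wgrad D v) = ip D f v + ipv D G (wgrad D v).
Proof.
move=> Lf LG.
have [||||w Hw H] := @riesz_gradient (H10 D) _ _ _ _ 1 1 f G ltr01 ltr01 Lf LG.
- by move=> w [].
- exact/test_H10/test_function_0.
- by move=> a w w'; exact: H10_lin.
- by move=> w q Lw wq; exact: H10_closure.
- by exists w => // v Hv; rewrite -H// !mul1r.
Qed.

Lemma riesz_Hdiv (c0 c1 : R) G f : 0 < c0 -> 0 < c1 -> L2v D G -> L2 D f ->
  exists2 p, Hdiv D p & forall q, Hdiv D q ->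
    c0 * ipv D p q + c1 * ip D (wdiv D p) (wdiv D q) = ipv D G q + ip D f (wdiv D q).
Proof.
move=> c00 c10 LG Lf.
pose c (j : 'I_n.+2) := if unlift ord0 j is Some _ then c0 else c1.
have cp j : 0 < c j by rewrite /c; case: unlift.
pose Q (F : 'I_n.+2 -> E -> R) := L2v D (rowF (tailF F)) /\ is_wdiv D (rowF (tailF F)) (F ord0).
have QL F : Q F -> forall j, L2 D (F j).
  move=> [LF [L0 _]] j; have [i ->|->//] := unliftP ord0 j.
  by apply: L2_eq (LF i) => x _; rewrite mxE.
have rowE a (F F' : 'I_n.+2 -> E -> R) : rowF (tailF (fun j x => a * F j x + F' j x)) =
    (fun x => a *: rowF (tailF F) x + rowF (tailF F') x).
  by apply/funext => x; apply/rowP => i; rewrite !mxE.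
have [||||T QT TP] := @riesz_L2J_data _ _ D mD _ c cp Q QL _ _ _ (consF f (coor G)).
- have -> : Q (fun _ _ => 0) = (L2v D (fun=> 0) /\ is_wdiv D (fun=> 0) (fun=> 0)).
    rewrite /Q (_ : rowF _ = fun=> 0)//.
    by apply/funext => x; apply/rowP => i; rewrite !mxE.
  split; first exact: L2v_0.
  split; first exact: L2_0.
  move=> phi T; have Lg := test_grad_L2v oD T; rewrite ip0l oppr0 ipvE//; last exact: L2v_0.
  by rewrite big1// => i _; rewrite -[RHS](ip0l D (coor (grad phi) i)); apply: ip_eq => // x _; rewrite mxE.
- move=> a F F' QF QF'; have [[LF gF] [LF' gF']] := (QF, QF').
  by rewrite /Q rowE; split; [apply: L2v_D => //; exact: L2v_Z|exact: is_wdiv_lin].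
- move=> F F' QF LF' FF'; split; first by apply: L2v_rowF => i; exact: LF'.
  apply: (is_wdiv_closed _ LF' FF'); first by move=> k; exact: QL.
  by move=> k; have [] := QF k.
- by move=> j; rewrite /consF; case: unliftP => [i _|//]; exact: LG.
have [LT gT] := QT; have HT : Hdiv D (rowF (tailF T)) by split => //; exists (T ord0).
exists (rowF (tailF T)) => // q Hq; have [Lq Lh] := (Hdiv_L2v Hq, wdiv_L2 Hq).
have QF : Q (consF (wdiv D q) (coor q)).
  by rewrite /Q consF0 tailFK rowFK; split => //; exact: wdivP.
have := TP _ QF; rewrite /ipJ sum_consF.
under [X in _ + X = _ -> _]eq_bigr do rewrite /c liftK.
rewrite /c unlift_none sum_coor//; last by move=> i; exact: QL.
have := sum_consF (consF f (coor G)) (wdiv D q) (coor q) (fun=> 1).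
rewrite tailFK sum_coor// rowFK consF0 !mul1r => sE.
rewrite (ip_wdiv oD HT gT Lh) addrC => ->; rewrite addrC -sE.
by apply: eq_bigr => j _; rewrite mul1r.
Qed.

End families.

(** * Boundary values from variational identities *)

Section variational.
Variables (R : realType) (n : nat) (D : set 'rV[R]_n.+1).
Hypothesis oD : open D.
Local Notation E := 'rV[R]_n.+1.

Let mD : measurable D. Proof. exact: open_measurable_rV. Qed.

Lemma wdiv_wgrad_is w q h : H1 D w -> is_wgrad D w q -> is_wdiv D q h ->
  is_wdiv D (wgrad D w) h.
Proof.
move=> Hw wq [Lh Hh]; split => // phi T.
by rewrite (ipv_wgrad oD Hw wq (test_grad_L2v oD T)) Hh.
Qed.

Lemma riesz_H1Delta (c0 c1 c2 : R) f G k : 0 < c0 -> 0 < c1 -> 0 < c2 ->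
  L2 D f -> L2v D G -> L2 D k ->
  exists2 w, H1Delta D w & forall v, H1Delta D v ->
    c0 * ip D w v + c1 * ipv D (wgrad D w) (wgrad D v)
      + c2 * ip D (wdiv D (wgrad D w)) (wdiv D (wgrad D v))
    = ip D f v + ipv D G (wgrad D v) + ip D k (wdiv D (wgrad D v)).
Proof.
move=> c00 c10 c20 Lf LG Lk.
pose c' (j : 'I_n.+2) := if unlift ord0 j is Some _ then c1 else c0.
pose c (j : 'I_n.+3) := if unlift ord0 j is Some i then c' i else c2.
have cp j : 0 < c j by rewrite /c; case: unlift => // i; rewrite /c'; case: unlift.
pose Q (F : 'I_n.+3 -> E -> R) := [/\ L2 D (tailF F ord0),
  is_wgrad D (tailF F ord0) (rowF (tailF (tailF F)))
  & is_wdiv D (rowF (tailF (tailF F))) (F ord0)].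
have QL F : Q F -> forall j, L2 D (F j).
  move=> [Lw [LF _] [L0 _]] j; have [i ->|->//] := unliftP ord0 j.
  have [l ->|->//] := unliftP ord0 i.
  by apply: L2_eq (LF l) => x _; rewrite mxE.
have rowE a (F F' : 'I_n.+3 -> E -> R) :
    rowF (tailF (tailF (fun j x => a * F j x + F' j x))) =
    (fun x => a *: rowF (tailF (tailF F)) x + rowF (tailF (tailF F')) x).
  by apply/funext => x; apply/rowP => i; rewrite !mxE.
have L2vr F : Q F -> L2v D (rowF (tailF (tailF F))).
  by move=> QF; apply: L2v_rowF => i; exact: QL.
have [||||T QT TP] :=
    @riesz_L2J_data _ _ D mD _ c cp Q QL _ _ _ (consF k (consF f (coor G))).
- rewrite /Q (_ : rowF _ = fun=> 0); last first.
    by apply/funext => x; apply/rowP => i; rewrite !mxE.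
  split; [exact: L2_0|exact: is_wgrad0|].
  split; first exact: L2_0.
  move=> phi T; have Lg := test_grad_L2v oD T; rewrite ip0l oppr0 ipvE//; last exact: L2v_0.
  by rewrite big1// => i _; rewrite -[RHS](ip0l D (coor (grad phi) i)); apply: ip_eq => // x _; rewrite mxE.
- move=> a F F' QF QF'; have [[LF gF dF] [LF' gF' dF']] := (QF, QF').
  rewrite /Q rowE; split; first by apply: L2_D => //; exact: L2_Z.
  + by apply: is_wgrad_lin.
  + by apply: is_wdiv_lin => //; exact: L2vr.
- move=> F F' QF LF' FF'; split; first exact: LF'.
    apply: (is_wgrad_closed oD (F := fun k => tailF (F k)) (G := tailF F')) => //.
    + by move=> l j; apply: (QL _ (QF l)).
    + by move=> j; exact: LF'.
    + by move=> j; exact: FF'.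
    + by move=> l; have [] := QF l.
  (* Removing the middle component leaves (Lap w, grad w), to which the closedness of the divergence
     applies. *)
  pose sel (H : 'I_n.+3 -> E -> R) := consF (H ord0) (tailF (tailF H)).
  have Lsel H : (forall j, L2 D (H j)) -> forall j, L2 D (sel H j).
    move=> LH j; have [i ->|->] := unliftP ord0 j; rewrite /sel.
      by rewrite consFS; exact: LH.
    by rewrite consF0; exact: LH.
  have := @is_wdiv_closed _ _ D oD (fun l => sel (F l)) (sel F').
  rewrite /sel consF0 tailFK; apply.
  + by move=> l; exact: (Lsel _ (QL _ (QF l))).
  + exact: Lsel.
  + move=> j; have [i ->|->] := unliftP ord0 j.
      under eq_fun do rewrite consFS; rewrite consFS; exact: FF'.
    under eq_fun do rewrite consF0; rewrite consF0; exact: FF'.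
  + by move=> l; rewrite consF0 tailFK; have [] := QF l.
- move=> j; rewrite /consF; case: unliftP => [i _|//].
  by case: unliftP => [l _|//]; exact: LG.
have [LT gT dT] := QT; have LTr := L2vr _ QT.
have HT : H1 D (tailF T ord0) by split => //; exists (rowF (tailF (tailF T))).
have dT' := wdiv_wgrad_is HT gT dT.
have HdT : Hdiv D (wgrad D (tailF T ord0)).
  by split; [exact: wgrad_L2v|exists (T ord0)].
exists (tailF T ord0); first by split.
move=> v [Hv Hdv]; have [Lv Lgv] := (H1_L2 Hv, wgrad_L2v Hv); have Ldv := wdiv_L2 Hdv.
have QF : Q (consF (wdiv D (wgrad D v)) (consF v (coor (wgrad D v)))).
  by rewrite /Q !tailFK !consF0 rowFK; split => //; [exact: wgradP|exact: wdivP].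
have := TP _ QF; rewrite /ipJ sum_consF.
under [X in _ + X = _ -> _]eq_bigr do rewrite /c liftK.
rewrite /c unlift_none sum_consF.
under [X in _ + (_ + X) = _ -> _]eq_bigr do rewrite /c' liftK.
rewrite /c' unlift_none sum_coor//; last by move=> i; exact: QL.
have := sum_consF D (consF k (consF f (coor G))) (wdiv D (wgrad D v))
  (consF v (coor (wgrad D v))) (fun=> 1).
rewrite [X in _ = _ + X]sum_consF !tailFK sum_coor// rowFK !consF0 !mul1r => sE.
rewrite (ipv_wgrad oD HT gT Lgv) (ip_wdiv oD HdT dT' Ldv) addrC => ->.
rewrite [RHS]addrC -sE.
by apply: eq_bigr => j _; rewrite mul1r.
Qed.

(* The H^1-projection of c on H10 differs from c by some g with div grad g = g,
   and testing with tau = grad g gives g = 0. *)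
Lemma zero_trace_of_duality c (a : E -> E) : L2 D c -> L2v D a ->
  (forall tau, Hdiv D tau -> ipv D a tau + ip D c (wdiv D tau) = 0) ->
  is_wgrad D c a /\ H10 D c.
Proof.
move=> Lc La H.
have ca : is_wgrad D c a.
  split => // phi T i; have Ht := test_Hdiv oD i T.
  have := H _ Ht; rewrite (ipC D c) (ip_wdiv oD Ht (test_is_wdiv oD i T) Lc) ipC.
  move=> /eqP; rewrite addr_eq0 => /eqP e; rewrite -[LHS]opprK -e; congr (- _).
  apply: eq_Rintegral => x _; rewrite /dot (bigD1 i)//= big1 ?addr0.
    by rewrite !mxE !eqxx mulr1.
  by move=> j ji; rewrite !mxE (negbTE ji) andbF !mulr0.
split => //; have Hc : H1 D c by split => //; exists a.
have [w Hw wP] := riesz_H10 oD Lc La.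
have Hw1 := H10_H1 Hw; have [Lw Lgw] := (H1_L2 Hw1, wgrad_L2v Hw1).
pose g x := -1 * w x + c x; pose gg x := -1 *: wgrad D w x + a x.
have gP : is_wgrad D g gg by apply: is_wgrad_lin => //; exact: wgradP.
have Lg : L2 D g by apply: L2_D => //; exact: L2_Z.
have Lgg : L2v D gg by case: gP.
have dg : is_wdiv D gg g.
  split => // phi T; have Hp := test_H10 oD T.
  have Lp := test_L2 mD T; have Lgp := test_grad_L2v oD T.
  have Hp1 := H10_H1 Hp; have tg := test_is_wgrad oD T.
  have e1 (q : E -> E) : L2v D q -> ipv D q (wgrad D phi) = ipv D q (grad phi).
    by move=> Lq; rewrite ipvC (ipv_wgrad oD Hp1 tg Lq) ipvC.
  have := wP _ Hp; rewrite (e1 _ Lgw) (e1 _ La).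
  rewrite ipvDl ?ipvZl ?ipDl ?ipZl//; [|exact: L2_Z|exact: L2v_Z].
  by absip => ?; lra.
have Hgg : Hdiv D gg by split => //; exists g.
have h1 : ipv D a gg + ip D c g = 0.
  by rewrite -(H _ Hgg) (ipC D c (wdiv D gg)) (ip_wdiv oD Hgg dg Lc) (ipC D g).
have h2 : ipv D (wgrad D w) gg + ip D w g = 0.
  rewrite -(duality_H10 oD Hgg Hw) (dualityE oD Hgg dg Hw1 (wgradP Hw1)).
  by rewrite (ipvC D gg) (ipC D g).
have g0 : h1sq D g gg = 0.
  have e1 : ip D g g = -1 * ip D w g + ip D c g.
    by rewrite -ipZl// -ipDl//; exact: L2_Z.
  have e2 : ipv D gg gg = -1 * ipv D (wgrad D w) gg + ipv D a gg.
    by rewrite -ipvZl// -ipvDl//; exact: L2v_Z.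
  by rewrite /h1sq e1 e2; absip; lra.
apply: (H10_closure oD Lc ca) => e e0; exists w, (wgrad D w); split => //; first exact: wgradP.
apply: le_trans (ltW e0); rewrite -g0 le_eqVlt; apply/orP; left; apply/eqP.
congr (_ + _); [apply: ip_eq|apply: ipv_eq] => x _; rewrite /g /gg ?scaleN1r ?mulN1r addrC//.
Qed.

Lemma ipv0l (q : E -> E) : L2v D q -> ipv D (fun=> 0) q = 0.
Proof.
move=> Lq; rewrite ipvE//; last exact: L2v_0.
rewrite big1// => i _; rewrite -[RHS](ip0l D (coor q i)).
by apply: ip_eq => // x _; rewrite mxE.
Qed.

Lemma is_wgrad_null w w' q : L2 D w -> L2 D w' -> is_wgrad D w q ->
  ip D (fun x => w' x - w x) (fun x => w' x - w x) = 0 -> is_wgrad D w' q.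
Proof.
move=> Lw Lw' [Lq Hq] ww'; split => // phi T i.
have Lp := test_L2 mD (test_pder i T); have Ld := L2_B mD Lw' Lw.
rewrite -Hq//; apply/eqP; rewrite -subr_eq0 -ipBl//.
by rewrite (ip_null mD Ld Lp ww').
Qed.

(** This is the Dirichlet problem for [v - Lap v = f]. Its solutions have a square integrable
    Laplacian, hence are admissible tests for very weak formulations. *)
Lemma solve_H10 f : L2 D f -> exists v, [/\ H10 D v, H1Delta D v &
  is_wdiv D (wgrad D v) (fun x => v x - f x)].
Proof.
move=> Lf; have [v Hv vP] := riesz_H10 oD Lf (L2v_0 D).
have Hv1 := H10_H1 Hv; have [Lv Lgv] := (H1_L2 Hv1, wgrad_L2v Hv1).
have dv : is_wdiv D (wgrad D v) (fun x => v x - f x).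
  split; first exact: L2_B.
  move=> phi T; have Hp := test_H10 oD T; have Hp1 := H10_H1 Hp.
  have Lp := test_L2 mD T; have Lgp := wgrad_L2v Hp1.
  have := vP _ Hp; rewrite ipv0l// addr0 (ipvC D (wgrad D v)).
  rewrite (ipv_wgrad oD Hp1 (test_is_wgrad oD T) Lgv) ipvC ipBl//.
  by absip; lra.
exists v; split => //; split => //; split => //; by exists (fun x => v x - f x).
Qed.

(** This is the Neumann problem: tests from all of H^1 encode a vanishing normal trace. *)
Lemma solve_H1 f : L2 D f -> exists v, [/\ H1Delta D v,
  is_wdiv D (wgrad D v) (fun x => v x - f x) &
  forall z, H1 D z -> ip D v z + ipv D (wgrad D v) (wgrad D z) = ip D f z].
Proof.
move=> Lf; have [v Hv vP] := riesz_H1 oD ltr01 ltr01 Lf (L2v_0 D).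
have [Lv Lgv] := (H1_L2 Hv, wgrad_L2v Hv).
have {}vP z : H1 D z -> ip D v z + ipv D (wgrad D v) (wgrad D z) = ip D f z.
  move=> Hz; have := vP _ Hz; rewrite (ipv0l (wgrad_L2v Hz)); absip => h.
  by rewrite -[RHS]addr0 -h !mul1r.
have dv : is_wdiv D (wgrad D v) (fun x => v x - f x).
  split; first exact: L2_B.
  move=> phi T; have Hp1 := test_H1 oD T.
  have Lp := test_L2 mD T.
  have := vP _ Hp1; rewrite (ipvC D (wgrad D v)).
  rewrite (ipv_wgrad oD Hp1 (test_is_wgrad oD T) Lgv) ipvC ipBl//.
  by absip; lra.
exists v; split => //; split => //; split => //; by exists (fun x => v x - f x).
Qed.

(* Very weak solutions with zero boundary values are H10 solutions: g equals
   the H10 solution phi of phi - Lap phi = g + h - div G, by testing with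
   v - Lap v = phi - g. *)
Lemma zero_trace_of_laplacian h (G : E -> E) g : L2 D h -> L2v D G -> L2 D g ->
  (forall v, H1Delta D v ->
     ip D h v + ipv D G (wgrad D v) + ip D g (wdiv D (wgrad D v)) = 0) ->
  H10 D g /\ forall v, H1 D v ->
     ip D h v + ipv D G (wgrad D v) - ipv D (wgrad D g) (wgrad D v) = 0.
Proof.
move=> Lh LG Lg H.
have [phi Hphi phiP] := riesz_H10 oD (L2_D mD Lh Lg) LG.
have Hphi1 := H10_H1 Hphi; have [Lphi Lgphi] := (H1_L2 Hphi1, wgrad_L2v Hphi1).
have Lpg := L2_B mD Lphi Lg.
have Lgp := L2_B mD Lg Lphi.
have null : ip D (fun x => g x - phi x) (fun x => g x - phi x) = 0.
  have [v [Hv Hdv dv]] := solve_H10 Lpg.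
  have Hv1 := H10_H1 Hv; have [Lv Lgv] := (H1_L2 Hv1, wgrad_L2v Hv1).
  have Hgv := Hdv.2.
  have h1 := H _ Hdv; rewrite (ipC D g) (ip_wdiv oD Hgv dv Lg) in h1.
  have h2 := duality_H10 oD Hgv Hphi.
  rewrite (dualityE oD Hgv dv Hphi1 (wgradP Hphi1)) in h2.
  have h3 := phiP _ Hv.
  rewrite ipDl// in h3; rewrite !ipBl// in h1 h2.
  rewrite !ipBl// !ipBr//.
  rewrite (ipvC D (wgrad D v)) (ipC D v phi) in h2.
  rewrite (ipC D v g) (ipC D phi g) in h1; rewrite (ipC D g phi).
  rewrite (ipC D g phi) in h1 h2.
  clear -h1 h2 h3; absip; lra.
have gphi : is_wgrad D g (wgrad D phi).
  by apply: is_wgrad_null null => //; exact: wgradP.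
have Hg : H10 D g.
  apply: (H10_closure oD Lg gphi) => e e0; exists phi, (wgrad D phi); split => //.
    exact: wgradP.
  rewrite /h1sq null add0r.
  have -> : ipv D (fun x => wgrad D phi x - wgrad D phi x)
      (fun x => wgrad D phi x - wgrad D phi x) = 0.
    rewrite -[RHS](ipv0l (L2v_0 D)).
    by apply: ipv_eq => x _; rewrite subrr.
  exact: ltW.
split => //; have Hg1 := H10_H1 Hg; have Lgg := wgrad_L2v Hg1.
have H' v : H1Delta D v -> ip D h v + ipv D G (wgrad D v) - ipv D (wgrad D g) (wgrad D v) = 0.
  move=> Hv; rewrite -(H _ Hv); have := duality_H10 oD Hv.2 Hg; rewrite /duality.
  rewrite (ipvC D (wgrad D v)) (ipC D (wdiv _ _)).
  by absip; lra.
have LG' := L2v_B mD LG Lgg.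
(* [y] represents the functional to be shown zero on all of H^1, whereas [H'] covers only functions
   with a square integrable Laplacian. The Neumann solution [w] with data [y] is such a function,
   and testing with it gives [|y|^2 = 0]. *)
have [y Hy yP] := riesz_H1 oD ltr01 ltr01 Lh LG'.
have [Ly Lgy] := (H1_L2 Hy, wgrad_L2v Hy).
have [w [Hw dw wP]] := solve_H1 Ly.
have [Lw Lgw] := (H1_L2 Hw.1, wgrad_L2v Hw.1).
have y0 : ip D y y = 0.
  rewrite -(wP _ Hy) (ipC D w) (ipvC D (wgrad D w)).
  have := yP _ Hw.1; rewrite !mul1r => ->; rewrite ipvBl//.
  by rewrite -(H' _ Hw); absip; ring.
have gy : is_wgrad D y (fun=> 0).
  split; first exact: L2v_0.
  move=> psi T i; rewrite (ip_null mD Ly (test_L2 mD (test_pder i T)) y0).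
  apply/eqP; rewrite eq_sym oppr_eq0 -[X in _ == X](ip0l D psi); apply/eqP.
  by apply: ip_eq => // x _; rewrite mxE.
move=> v Hv; have [Lv Lgv] := (H1_L2 Hv, wgrad_L2v Hv).
have := yP _ Hv; rewrite (ipv_wgrad oD Hy gy Lgv) ipv0l// (ip_null mD Ly Lv y0).
by rewrite ipvBl//; absip; lra.
Qed.

End variational.

(** * Meshes *)

Section restriction.
Variables (R : realType) (n : nat).
Local Notation E := 'rV[R]_n.+1.
Local Notation mu := (leb R n.+1).
Implicit Types (D Om : set E) (f g : E -> R) (p q : E -> E).

Lemma indic_in (T : Type) (D : set T) x : D x -> \1_D x = 1 :> R.
Proof. by move=> Dx; rewrite indicE mem_set. Qed.

Lemma indic_out (T : Type) (D : set T) x : ~ D x -> \1_D x = 0 :> R.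
Proof. by move=> Dx; rewrite indicE memNset. Qed.

Lemma ip_indic Om D f g : D `<=` Om -> ip Om (fun x => \1_D x * f x) g = ip D f g.
Proof.
move=> DO; rewrite /ip Rintegral_mkcond [RHS]Rintegral_mkcond.
apply: eq_Rintegral => x _; rewrite !patchE.
have [xD|xD] := boolP (x \in D).
  by rewrite (mem_set (DO _ (set_mem xD))) (indic_in (set_mem xD)) mul1r.
by case: ifP => // _; rewrite indicE (negbTE xD) !mul0r.
Qed.

Lemma ipv_indic Om D p q : D `<=` Om -> ipv Om (fun x => \1_D x *: p x) q = ipv D p q.
Proof.
move=> DO; rewrite /ipv Rintegral_mkcond [RHS]Rintegral_mkcond.
apply: eq_Rintegral => x _; rewrite !patchE.
have [xD|xD] := boolP (x \in D).
  by rewrite (mem_set (DO _ (set_mem xD))) (indic_in (set_mem xD)) scale1r.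
case: ifP => // _; rewrite indicE (negbTE xD) scale0r /dot big1// => i _.
by rewrite mxE mul0r.
Qed.

Lemma L2_indic Om D f : measurable Om -> measurable D -> D `<=` Om -> L2 D f ->
  L2 Om (fun x => \1_D x * f x).
Proof.
move=> mO mD DO [mf ff].
have fE : (fun x => \1_D x * f x) = f \_ D.
  apply/funext => x; rewrite patchE indicE; case: ifP => _; first by rewrite mul1r.
  by rewrite mul0r.
split; first by rewrite fE; apply/measurable_restrict => //; rewrite setIidr.
apply: le_lt_trans ff; rewrite integral_mkcond [leRHS]integral_mkcond.
rewrite le_eqVlt; apply/orP; left; apply/eqP.
apply: eq_integral => x _; rewrite !patchE.
have [xD|xD] := boolP (x \in D).
  by rewrite (mem_set (DO _ (set_mem xD))) (indic_in (set_mem xD)) mul1r.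
by case: ifP => // _; rewrite indicE (negbTE xD) mul0r expr0n.
Qed.

Lemma L2v_indic Om D p : measurable Om -> measurable D -> D `<=` Om -> L2v D p ->
  L2v Om (fun x => \1_D x *: p x).
Proof.
by move=> mO mD DO Lp i; apply: L2_eq (L2_indic mO mD DO (Lp i)) => x _; rewrite mxE.
Qed.

Lemma L2v_S Om D p : measurable D -> measurable Om -> D `<=` Om -> L2v Om p -> L2v D p.
Proof. by move=> mD mO DO Lp i; exact: (L2_S mD mO DO (Lp i)). Qed.

Section partition.
Variables (m : nat) (F : 'I_m -> set E) (Om : set E).
Hypothesis mO : measurable Om.
Hypothesis mF : forall i, measurable (F i).
Hypothesis F_disj : forall i j, i != j -> F i `&` F j = set0.
Hypothesis F_sub : forall i, F i `<=` Om.
Variable N : set E.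
Hypothesis mN : measurable N.
Hypothesis N0 : mu N = 0%E.
Hypothesis F_cover : Om `\` N `<=` \bigcup_(i in setT) F i.

Lemma ip_partition f g : L2 Om f -> L2 Om g -> ip Om f g = \sum_i ip (F i) f g.
Proof.
move=> Lf Lg.
pose U := \big[setU/set0]_(i <- index_enum 'I_m) F i.
have UE : U = \bigcup_(i in setT) F i.
  rewrite /U -bigcup_seq; apply: eq_bigcupl; split => // i _ /=.
  by rewrite mem_index_enum.
have mU : measurable U by apply: bigsetU_measurable.
pose N' := Om `\` U.
have mN' : measurable N' by exact: measurableD.
have UO : U `<=` Om by rewrite UE => x [i _ /F_sub].
have N'0 : mu N' = 0%E.
  apply/eqP; rewrite eq_le measure_ge0 andbT -N0.
  apply: le_measure; rewrite ?inE// => x [Ox Ux]; apply: contrapT => Nx.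
  by apply: Ux; rewrite UE; apply: F_cover.
have If := L2_integrable_mul mO Lf Lg.
have IF i : mu.-integrable (F i) (EFin \o (fun x => f x * g x)).
  by apply: integrableS If.
apply: EFin_inj; rewrite /ip /Rintegral fineK; last exact: integrable_fin_num.
rewrite (negligible_integral mN' mO If N'0) setDD setIidr//.
rewrite integral_bigsetU_EFin//.
- rewrite -sumEFin; apply: eq_bigr => i _; rewrite fineK//.
  exact: integrable_fin_num.
- exact: index_enum_uniq.
- move=> i j _ _ [x Fij]; apply/eqP; apply/negPn/negP => /F_disj ij.
  by rewrite ij in Fij.
- apply: measurable_funS (measurable_int _ If) => //.
Qed.

Lemma ipv_partition p q : L2v Om p -> L2v Om q -> ipv Om p q = \sum_i ipv (F i) p q.
Proof.
move=> Lp Lq; rewrite ipvE//.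
under eq_bigr do rewrite ip_partition//.
rewrite exchange_big; apply: eq_bigr => i _.
by rewrite ipvE//; apply: (L2v_S (mF i) mO (@F_sub i)).
Qed.

End partition.
End restriction.

(** * Simplices in barycentric coordinates *)

Section simplices.
Variables (R : realType) (n : nat) (A : 'M[R]_(n.+2, n.+1)).
Hypothesis ndA : Defs.nondegenerate A.
Local Notation E := 'rV[R]_n.+1.

Let J := \matrix_(j < n.+1) (row (lift ord0 j) A - row ord0 A).

(** Barycentric coordinates as affine functions on the whole space; the rows of [J] are the edge
    vectors from vertex 0. *)
Definition bcoord (x : E) : 'rV[R]_n.+2 :=
  let v := (x - row ord0 A) *m invmx J in
  \row_k (if unlift ord0 k is Some j then v ord0 j else 1 - \sum_j v ord0 j).

Lemma bcoord0 x : bcoord x ord0 ord0 = 1 - \sum_j ((x - row ord0 A) *m invmx J) ord0 j.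
Proof. by rewrite [LHS]mxE unlift_none. Qed.

Lemma bcoordS x j : bcoord x ord0 (lift ord0 j) = ((x - row ord0 A) *m invmx J) ord0 j.
Proof. by rewrite [LHS]mxE liftK. Qed.

Lemma mulmx_bary (l : 'rV[R]_n.+2) : \sum_k l ord0 k = 1 ->
  l *m A = row ord0 A + (\row_j l ord0 (lift ord0 j)) *m J.
Proof.
move=> l1; apply/rowP => i; rewrite !mxE big_ord_recl.
under [in RHS]eq_bigr do rewrite !mxE mulrBr.
rewrite big_split/= sumrN -mulr_suml.
have -> : l ord0 ord0 = 1 - \sum_j l ord0 (lift ord0 j) by rewrite -l1 big_ord_recl addrK.
by set s := \sum_j l _ _; set t := \sum_j (_ * _); ring.
Qed.

Lemma bcoord_sum x : \sum_k bcoord x ord0 k = 1.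
Proof.
by rewrite big_ord_recl (eq_bigr _ (fun j _ => bcoordS x j)) bcoord0 subrK.
Qed.

Lemma bcoordK x : bcoord x *m A = x.
Proof.
rewrite mulmx_bary ?bcoord_sum// (_ : \row_j _ = (x - row ord0 A) *m invmx J).
  by rewrite mulmxKV// addrC subrK.
by apply/rowP => j; rewrite [LHS]mxE bcoordS.
Qed.

Lemma bcoord_mul (l : 'rV[R]_n.+2) : \sum_k l ord0 k = 1 -> bcoord (l *m A) = l.
Proof.
move=> l1; rewrite /bcoord mulmx_bary// addrC addKr mulmxK//.
apply/rowP => k; rewrite mxE; have [j ->|->] := unliftP ord0 k; rewrite ?mxE//.
by under eq_bigr do rewrite mxE; rewrite -l1 big_ord_recl addrK.
Qed.

Lemma simplexE : simplex A = [set x | forall k, 0 < bcoord x ord0 k].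
Proof.
apply/seteqP; split => x /=.
  by move=> [l [[l0 l1] lp] <-] k; rewrite bcoord_mul.
move=> xp; exists (bcoord x); last exact: bcoordK.
by split => //; split; [move=> k; exact: ltW|exact: bcoord_sum].
Qed.

(** The slope cannot vanish, because the coordinate is 1 at vertex [k] and 0 at any other vertex. A
    nonzero slope is what [hyperplane_null] asks for. *)
Lemma bcoord_affine k : exists (a : 'rV[R]_n.+1) (c : R), a != 0 /\
  forall x, bcoord x ord0 k = \sum_i a ord0 i * x ord0 i + c.
Proof.
have [a [c ac]] : exists (a : 'rV[R]_n.+1) (c : R),
    forall x, bcoord x ord0 k = \sum_i a ord0 i * x ord0 i + c.
  have vE x j : ((x - row ord0 A) *m invmx J) ord0 j =
      \sum_i invmx J i j * x ord0 i - \sum_i invmx J i j * A ord0 i.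
    by rewrite mxE -sumrB; apply: eq_bigr => i _; rewrite !mxE; ring.
  have [j ->|->] := unliftP ord0 k.
    exists (\row_i invmx J i j), (- \sum_i invmx J i j * A ord0 i) => x.
    by rewrite bcoordS vE; congr (_ - _); apply: eq_bigr => i _; rewrite mxE.
  exists (\row_i (- \sum_j invmx J i j)), (1 + \sum_j \sum_i invmx J i j * A ord0 i) => x.
  rewrite bcoord0; under eq_bigr do rewrite vE.
  rewrite sumrB exchange_big/=.
  under [in RHS]eq_bigr do rewrite mxE mulNr mulr_suml.
  by rewrite sumrN opprB addrA [RHS]addrC.
exists a, c; split => //; apply/eqP => a0.
have cE x : bcoord x ord0 k = c.
  by rewrite ac a0 big1 ?add0r// => i _; rewrite mxE mul0r.
have b j : bcoord (row j A) ord0 k = (j == k)%:R.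
  rewrite rowE bcoord_mul ?mxE ?eqxx//= 1?eq_sym//.
  rewrite (bigD1 j)//= big1 ?addr0 => [|i ij]; rewrite mxE ?eqxx//.
  by rewrite (negbTE ij) andbF.
have /eqP := cE (row k A); rewrite b eqxx => /eqP c1.
have [k' kk'] : exists k' : 'I_n.+2, k' != k.
  by have [->|k0] := eqVneq k ord0; [exists (lift ord0 ord0)|exists ord0; rewrite eq_sym].
have := cE (row k' A); rewrite b (negbTE kk') -c1 => /eqP.
by rewrite eq_sym oner_eq0.
Qed.

Lemma bcoord_continuous k : continuous (fun x => bcoord x ord0 k).
Proof.
have [a [c [_ ac]]] := bcoord_affine k.
rewrite (_ : (fun x => _) = (fun x : E => \sum_i a ord0 i * x ord0 i + c)); last exact/funext.
move=> x; apply: (@continuousD _ _ _ _ (fun=> c)); last exact: cst_continuous.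
exact: continuous_lin.
Qed.

Lemma simplex_open : open (simplex A).
Proof.
have -> : simplex A = \big[setI/setT]_(k : 'I_n.+2) [set x | 0 < bcoord x ord0 k].
  rewrite simplexE -bigcap_seq; apply/seteqP; split => x /= H; first by move=> k _; exact: H.
  by move=> k; apply: H; rewrite /= mem_index_enum.
apply: big_ind => [||k _]; [exact: openT|exact: openI|].
apply: (open_comp (f := fun x => bcoord x ord0 k) (D := [set y | 0 < y])); last exact: open_gt.
by move=> x _; exact: bcoord_continuous.
Qed.

(** On the closure all barycentric coordinates are nonnegative, so off the open simplex one of them
    is 0: [N] is the union of the hyperplanes that carry the facets. *)
Lemma closure_simplex_null : exists N : set E,
  [/\ measurable N, leb R n.+1 N = 0%E & closure (simplex A) `\` simplex A `<=` N].
Proof.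
pose H (k : 'I_n.+2) := [set x : E | bcoord x ord0 k = 0].
have HP k : measurable (H k) /\ leb R n.+1 (H k) = 0%E.
  have [a [c [a0 ac]]] := bcoord_affine k.
  have -> : H k = [set x : E | \sum_i a ord0 i * x ord0 i = - c].
    apply/seteqP; split => x; rewrite /H /= ac => /eqP; rewrite ?addr_eq0 => /eqP//.
    by move=> ->; rewrite addNr.
  by split; [exact: measurable_hyperplane|exact: hyperplane_null].
exists (\big[setU/set0]_(k : 'I_n.+2) H k); split.
- by apply: bigsetU_measurable => k _; exact: (HP k).1.
- have [] : measurable (\big[setU/set0]_(k : 'I_n.+2) H k) /\
     leb R n.+1 (\big[setU/set0]_(k : 'I_n.+2) H k) = 0%E => //.
  apply: (big_ind (fun B => measurable B /\ leb R n.+1 B = 0%E)).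
  + by split => //; exact: measure0.
  + move=> B C [mB B0] [mC C0]; split; first exact: measurableU.
    by apply: null_set_setU.
  + by move=> k _; exact: HP.
- move=> x [cx nx]; rewrite -bigcup_seq /=.
  have x0 k : 0 <= bcoord x ord0 k.
    have cl : closed [set y : E | 0 <= bcoord y ord0 k].
      apply: (closed_comp (f := fun x => bcoord x ord0 k) (D := [set y | 0 <= y])); last exact: closed_ge.
      by move=> y _; exact: bcoord_continuous.
    suff : closure [set y : E | 0 <= bcoord y ord0 k] x by rewrite -((closure_id _).1 cl).
    by apply: closureS cx => y; rewrite simplexE => /(_ k) /ltW.
  apply: contrapT => Nx; apply: nx; rewrite simplexE => k /=.
  rewrite lt_neqAle x0 andbT eq_sym; apply/eqP => xk.
  by apply: Nx; exists k => //=; rewrite mem_index_enum.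
Qed.

End simplices.

(** * The mesh fills the domain up to a null set *)

Section mesh_geometry.
Variables (R : realType) (n : nat) (Om : set 'rV[R]_n.+1).
Local Notation E := 'rV[R]_n.+1.

(** The mesh condition compares closures only, so that elements lie in [Om] requires [Om] to have no
    slits or punctures. At a boundary point, the points just below the Lipschitz graph are outside
    the closure of [Om]. *)
Lemma lipschitz_interior_closure : open Om -> lipschitz_boundary Om ->
  interior (closure Om) `<=` Om.
Proof.
move=> oO LO z zi; apply: contrapT => nz.
have bz : bdry Om z.
  by split; [exact: interior_subset zi|move/interior_subset].
have [Q [r [a [psi [QQ [r0 a0] _ _ H]]]]] := LO z bz.
have {}QQ : Q^T *m Q = 1%:M by exact: mulmx1C.
(* [e] is the vertical unit vector of the chart: [z - t e] has chart coordinates [(0, - t)]. *)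
pose e : E := delta_mx ord0 ord_max *m Q^T.
have yE (t : R) : (z - t *: e - z) *m Q = - t *: delta_mx ord0 ord_max.
  by rewrite addrAC subrr add0r -scaleNr -scalemxAl /e -mulmxA QQ mulmx1.
have y'E (t : R) : col' ord_max ((- t) *: delta_mx ord0 ord_max : E) = 0.
  apply/rowP => j; rewrite !mxE /=.
  by rewrite (negbTE (_ : lift ord_max j != ord_max)) ?mulr0// eq_sym neq_lift.
have ydE (t : R) : ((- t) *: delta_mx ord0 ord_max : E) ord0 ord_max = - t.
  by rewrite !mxE !eqxx mulr1.
have psi0 : psi 0 = 0.
  have := H (z - 0 *: e); rewrite /= yE y'E ydE normr0 oppr0 normr0 => -[]// _.
  by rewrite scale0r subr0 => -[/(_ bz)].
have ct : (fun t : R => z - t *: e) @ 0 --> z - 0 *: e.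
  apply: cvgB; first exact: cvg_cst.
  apply: cvgZr_tmp; exact: cvg_id.
rewrite scale0r subr0 in ct.
have : \forall t \near (0 : R), closure Om (z - t *: e).
  exact: ct.
move=> /nbhs_ballP[d /= d0 Hd].
pose t := Num.min d a / 2.
have m0 : 0 < Num.min d a by rewrite lt_min d0.
have t0 : 0 < t by rewrite divr_gt0.
have td : t < d /\ t < a.
  have : Num.min d a <= d /\ Num.min d a <= a by rewrite !ge_min !lexx orbT.
  by rewrite /t; move: m0; set m := Num.min d a => ? [? ?]; split; lra.
have /Hd : ball 0 d t by rewrite /ball/= sub0r normrN gtr0_norm//; exact: td.1.
have := H (z - t *: e); rewrite /= yE y'E ydE normr0 normrN gtr0_norm//.
move=> /(_ r0 td.2); rewrite psi0 => -[Om_iff bd_iff] cx.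
have nO : ~ Om (z - t *: e) by move/Om_iff.1; lra.
have : bdry Om (z - t *: e) by split => // /interior_subset.
by move/bd_iff.1; lra.
Qed.

Variable M : mesh R n.
Hypothesis oO : open Om.
Hypothesis LO : lipschitz_boundary Om.
Hypothesis cM : conforming_mesh Om M.

Lemma elt_open i : open (@elt _ _ M i).
Proof. by have [nd _ _ _] := cM; apply: simplex_open. Qed.

Lemma elt_sub i : @elt _ _ M i `<=` Om.
Proof.
apply: subset_trans (lipschitz_interior_closure oO LO).
rewrite -(open_subsetE _ (@elt_open i)); have [_ _ _ <-] := cM.
by apply: subset_trans (@subset_closure _ _) _ => x xi; exists i.
Qed.

Lemma elt_disj i j : i != j -> @elt _ _ M i `&` elt j = set0.
Proof. by have [_ H _ _] := cM; exact: H. Qed.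

Lemma mesh_cover : exists N : set E, [/\ measurable N, leb R n.+1 N = 0%E &
  Om `\` N `<=` \bigcup_(i in setT) @elt _ _ M i].
Proof.
have [nd _ _ cl] := cM.
have /choice[N NP] i := closure_simplex_null (nd i).
exists (\big[setU/set0]_(i < ntri M) N i); split.
- by apply: bigsetU_measurable => i _; have [] := NP i.
- have [] : measurable (\big[setU/set0]_(i < ntri M) N i) /\
     leb R n.+1 (\big[setU/set0]_(i < ntri M) N i) = 0%E => //.
  apply: (big_ind (fun B => measurable B /\ leb R n.+1 B = 0%E)).
  + by split => //; exact: measure0.
  + move=> B C [mB B0] [mC C0]; split; first exact: measurableU.
    by apply: null_set_setU.
  + by move=> i _; have [] := NP i.
- move=> x [/(@subset_closure _ Om)]; rewrite -cl => -[i _ ci] Nx.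
  exists i => //; apply: contrapT => nx; apply: Nx.
  rewrite -bigcup_seq; exists i; first by rewrite /= mem_index_enum.
  by have [_ _] := NP i; apply.
Qed.

Lemma ip_mesh f g : L2 Om f -> L2 Om g ->
  ip Om f g = \sum_(i < ntri M) ip (elt i) f g.
Proof.
have [N [mN N0 cov]] := mesh_cover.
apply: (ip_partition _ _ _ _ mN N0 cov).
- exact: open_measurable_rV.
- by move=> i; apply: open_measurable_rV; exact: elt_open.
- exact: elt_disj.
- exact: elt_sub.
Qed.

Lemma ipv_mesh p q : L2v Om p -> L2v Om q ->
  ipv Om p q = \sum_(i < ntri M) ipv (elt i) p q.
Proof.
have [N [mN N0 cov]] := mesh_cover.
apply: (ipv_partition _ _ _ _ mN N0 cov).
- exact: open_measurable_rV.
- by move=> i; apply: open_measurable_rV; exact: elt_open.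
- exact: elt_disj.
- exact: elt_sub.
Qed.

End mesh_geometry.

(** * Weak derivatives on subdomains *)

Section subdomain.
Variables (R : realType) (n : nat).
Local Notation E := 'rV[R]_n.+1.
Implicit Types (D Om : set E) (f g w : E -> R) (p q : E -> E).

(** Both functions have the same set of weak gradients, so [get] makes the same choice. The result
    is an identity of functions, not only almost everywhere. *)
Lemma wgrad_eq D w w' : (forall x, D x -> w x = w' x) -> wgrad D w = wgrad D w'.
Proof.
move=> ww; rewrite /wgrad; congr get; apply/funext => q; apply/propext.
split=> -[Lq Hq]; split => // phi T i; rewrite -Hq//; apply: ip_eq => // x Dx; rewrite ww//.
Qed.

Lemma wdiv_eq D q q' : (forall x, D x -> q x = q' x) -> wdiv D q = wdiv D q'.
Proof.
move=> qq; rewrite /wdiv; congr get; apply/funext => h; apply/propext.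
split=> -[Lq Hq]; split => // phi T; rewrite -Hq//; apply: ipv_eq => // x Dx; rewrite qq//.
Qed.

Lemma is_wgrad_eq D w w' q q' : (forall x, D x -> w x = w' x) ->
  (forall x, D x -> q x = q' x) -> is_wgrad D w q -> is_wgrad D w' q'.
Proof.
move=> ww qq [Lq Hq]; split; first exact: L2v_eq Lq.
move=> phi T i; transitivity (ip D w (pder i phi)).
  by apply: ip_eq => // x Dx; rewrite ww.
by rewrite Hq//; congr (- _); apply: ip_eq => // x Dx; rewrite qq.
Qed.

Lemma is_wdiv_eq D q q' h h' : (forall x, D x -> q x = q' x) ->
  (forall x, D x -> h x = h' x) -> is_wdiv D q h -> is_wdiv D q' h'.
Proof.
move=> qq hh [Lq Hq]; split; first exact: L2_eq Lq.
move=> phi T; transitivity (ipv D q (grad phi)).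
  by apply: ipv_eq => // x Dx; rewrite qq.
by rewrite Hq//; congr (- _); apply: ip_eq => // x Dx; rewrite hh.
Qed.

Lemma H1_eq D w w' : (forall x, D x -> w x = w' x) -> H1 D w -> H1 D w'.
Proof.
move=> ww [Lw [q wq]]; split; first exact: L2_eq Lw.
by exists q; apply: is_wgrad_eq wq.
Qed.

Lemma Hdiv_eq D q q' : (forall x, D x -> q x = q' x) -> Hdiv D q -> Hdiv D q'.
Proof.
move=> qq [Lq [h qh]]; split; first exact: L2v_eq Lq.
by exists h; apply: is_wdiv_eq qh.
Qed.

Lemma H1Delta_eq D w w' : (forall x, D x -> w x = w' x) -> H1Delta D w -> H1Delta D w'.
Proof.
by move=> ww [Hw Hd]; split; [exact: H1_eq Hw|rewrite -(wgrad_eq ww)].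
Qed.

Lemma H10_eq D w w' : (forall x, D x -> w x = w' x) -> H10 D w -> H10 D w'.
Proof.
move=> ww [Hw H]; split; first exact: H1_eq Hw.
move=> e e0; have [phi T] := H e e0; rewrite (wgrad_eq ww) => he; exists phi; first exact: T.
rewrite -(_ : ip D (w - phi) (w - phi) = ip D (w' - phi) (w' - phi)).
  exact: he.
by apply: ip_eq => x Dx; rewrite !fctE ww.
Qed.

Lemma duality_eq D q q' w w' : (forall x, D x -> q x = q' x) ->
  (forall x, D x -> w x = w' x) -> duality D q w = duality D q' w'.
Proof.
move=> qq ww; rewrite /duality (wgrad_eq ww) (wdiv_eq qq); congr (_ + _).
  by apply: ipv_eq.
by apply: ip_eq.
Qed.

Lemma ip_supp Om D f g : D `<=` Om -> (forall x, ~ D x -> g x = 0) ->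
  ip Om f g = ip D f g.
Proof.
move=> DO g0; rewrite ipC (ipC D) -(ip_indic _ _ DO); apply: ip_eq => // x _.
have [Dx|nD] := pselect (D x); first by rewrite indic_in ?mul1r.
by rewrite g0// mulr0.
Qed.

Lemma ipv_supp Om D p q : D `<=` Om -> (forall x, ~ D x -> q x = 0) ->
  ipv Om p q = ipv D p q.
Proof.
move=> DO q0; rewrite ipvC (ipvC D) -(ipv_indic _ _ DO); apply: ipv_eq => // x _.
have [Dx|nD] := pselect (D x); first by rewrite indic_in ?scale1r.
by rewrite q0// scaler0.
Qed.

Variables (Om D : set E).
Hypotheses (oO : open Om) (oD : open D) (DO : D `<=` Om).
Let mO : measurable Om. Proof. exact: open_measurable_rV. Qed.
Let mD : measurable D. Proof. exact: open_measurable_rV. Qed.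

Lemma is_wgrad_sub w q : is_wgrad Om w q -> is_wgrad D w q.
Proof.
move=> [Lq Hq]; split; first exact: (L2v_S mD mO).
move=> phi T i; have := Hq phi (test_functionS DO T) i.
by rewrite (ip_supp _ DO (fun x => test_out (test_pder i T))) (ip_supp _ DO (fun x => test_out T)).
Qed.

Lemma grad_out phi x : test_function D phi -> ~ D x -> grad phi x = 0.
Proof.
by move=> T nD; apply/rowP => i; rewrite !mxE (test_out (test_pder i T) nD).
Qed.

Lemma is_wdiv_sub q h : is_wdiv Om q h -> is_wdiv D q h.
Proof.
move=> [Lq Hq]; split; first exact: (L2_S mD mO).
move=> phi T; have := Hq phi (test_functionS DO T).
by rewrite (ip_supp _ DO (fun x => test_out T)) (ipv_supp _ DO (fun x => grad_out T)).
Qed.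

Lemma H1_sub w : H1 Om w -> H1 D w.
Proof.
move=> Hw; split; first exact: (L2_S mD mO DO (H1_L2 Hw)).
by exists (wgrad Om w); apply: is_wgrad_sub; exact: wgradP.
Qed.

Lemma Hdiv_sub q : Hdiv Om q -> Hdiv D q.
Proof.
move=> Hq; split; first exact: (L2v_S mD mO DO (Hdiv_L2v Hq)).
by exists (wdiv Om q); apply: is_wdiv_sub; exact: wdivP.
Qed.

Lemma ipv_wgrad_sub w p : H1 Om w -> L2v D p ->
  ipv D (wgrad D w) p = ipv D (wgrad Om w) p.
Proof.
by move=> Hw; apply: (ipv_wgrad oD (H1_sub Hw)); apply: is_wgrad_sub; exact: wgradP.
Qed.

Lemma ip_wdiv_sub q f : Hdiv Om q -> L2 D f ->
  ip D (wdiv D q) f = ip D (wdiv Om q) f.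
Proof.
by move=> Hq; apply: (ip_wdiv oD (Hdiv_sub Hq)); apply: is_wdiv_sub; exact: wdivP.
Qed.

End subdomain.

(** * Zero and scalar multiples *)

Section wgradZ.
Variables (R : realType) (n : nat) (D : set 'rV[R]_n.+1).
Hypothesis oD : open D.
Local Notation E := 'rV[R]_n.+1.
Let mD : measurable D. Proof. exact: open_measurable_rV. Qed.

Lemma H1_0 : H1 D (fun=> 0).
Proof. by split; [exact: L2_0|exists (fun=> 0); exact: is_wgrad0]. Qed.

Lemma is_wdiv0 : is_wdiv D (fun=> 0) (fun=> 0).
Proof.
split; first exact: L2_0.
move=> phi T; have Lg := test_grad_L2v oD T.
by rewrite ip0l oppr0 (ipv0l oD Lg).
Qed.

Lemma Hdiv_0 : Hdiv D (fun=> 0).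
Proof. by split; [exact: L2v_0|exists (fun=> 0); exact: is_wdiv0]. Qed.

Lemma ipv_wgrad0 (p : E -> E) : L2v D p -> ipv D (wgrad D (fun=> 0)) p = 0.
Proof. by move=> Lp; rewrite (ipv_wgrad oD H1_0 (is_wgrad0 D) Lp) (ipv0l oD Lp). Qed.

Lemma ip_wdiv0 (f : E -> R) : L2 D f -> ip D (wdiv D (fun=> 0)) f = 0.
Proof. by move=> Lf; rewrite (ip_wdiv oD Hdiv_0 is_wdiv0 Lf) ip0l. Qed.

Lemma is_wgradZ a w (q : E -> E) : L2 D w -> is_wgrad D w q ->
  is_wgrad D (fun x => a * w x) (fun x => a *: q x).
Proof.
move=> Lw wq; have := is_wgrad_lin oD a Lw (L2_0 D) wq (is_wgrad0 D).
by apply: is_wgrad_eq => x _; rewrite addr0.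
Qed.

Lemma is_wdivZ a (q : E -> E) h : L2v D q -> is_wdiv D q h ->
  is_wdiv D (fun x => a *: q x) (fun x => a * h x).
Proof.
move=> Lq qh; have := is_wdiv_lin oD a Lq (L2v_0 D) qh is_wdiv0.
by apply: is_wdiv_eq => x _; rewrite addr0.
Qed.

Lemma H1Z a w : H1 D w -> H1 D (fun x => a * w x).
Proof.
move=> Hw; split; first exact: (L2_Z mD a (H1_L2 Hw)).
by exists (fun x => a *: wgrad D w x); exact: is_wgradZ (H1_L2 Hw) (wgradP Hw).
Qed.

Lemma HdivZ a (q : E -> E) : Hdiv D q -> Hdiv D (fun x => a *: q x).
Proof.
move=> Hq; split; first exact: (L2v_Z mD a (Hdiv_L2v Hq)).
by exists (fun x => a * wdiv D q x); exact: is_wdivZ (Hdiv_L2v Hq) (wdivP Hq).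
Qed.

(** The chosen gradients of [w] and of its multiple correspond only almost everywhere, hence the
    test field [p]. *)
Lemma ipv_wgradZ a w (p : E -> E) : H1 D w -> L2v D p ->
  ipv D (wgrad D (fun x => a * w x)) p = a * ipv D (wgrad D w) p.
Proof.
move=> Hw Lp; rewrite (ipv_wgrad oD (H1Z a Hw) (is_wgradZ a (H1_L2 Hw) (wgradP Hw)) Lp).
by rewrite (ipvZl mD a (wgrad_L2v Hw) Lp).
Qed.

Lemma ip_wdivZ a (q : E -> E) f : Hdiv D q -> L2 D f ->
  ip D (wdiv D (fun x => a *: q x)) f = a * ip D (wdiv D q) f.
Proof.
move=> Hq Lf; rewrite (ip_wdiv oD (HdivZ a Hq) (is_wdivZ a (Hdiv_L2v Hq) (wdivP Hq)) Lf).
by rewrite (ipZl mD a (wdiv_L2 Hq) Lf).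
Qed.

Lemma is_wdiv_wgradZ a w : H1Delta D w ->
  is_wdiv D (wgrad D (fun x => a * w x)) (fun x => a * wdiv D (wgrad D w) x).
Proof.
move=> [Hw Hd]; apply: (wdiv_wgrad_is oD (H1Z a Hw) (is_wgradZ a (H1_L2 Hw) (wgradP Hw))).
exact: is_wdivZ (Hdiv_L2v Hd) (wdivP Hd).
Qed.

Lemma H1DeltaZ a w : H1Delta D w -> H1Delta D (fun x => a * w x).
Proof.
move=> Hw; split; first exact: H1Z Hw.1.
split; first exact: wgrad_L2v (H1Z a Hw.1).
by exists (fun x => a * wdiv D (wgrad D w) x); exact: is_wdiv_wgradZ.
Qed.

Lemma ip_lapZ a w f : H1Delta D w -> L2 D f ->
  ip D (wdiv D (wgrad D (fun x => a * w x))) f = a * ip D (wdiv D (wgrad D w)) f.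
Proof.
move=> Hw Lf; have [_ Hd] := H1DeltaZ a Hw; have [_ /wdiv_L2 Ld] := Hw.
have e := ip_wdiv oD Hd (is_wdiv_wgradZ a Hw) Lf.
apply: (etrans e).
exact: (ipZl mD a Ld Lf).
Qed.

Lemma H1Delta0 : H1Delta D (fun=> 0).
Proof.
split; first exact: H1_0.
split; first exact: wgrad_L2v H1_0.
exists (fun=> 0); exact: (wdiv_wgrad_is oD H1_0 (is_wgrad0 D) is_wdiv0).
Qed.

Lemma ip_lap0 f : L2 D f -> ip D (wdiv D (wgrad D (fun=> 0))) f = 0.
Proof.
move=> Lf; have [_ Hd] := H1Delta0; rewrite (ip_wdiv oD Hd (wdiv_wgrad_is oD H1_0 (is_wgrad0 D) is_wdiv0) Lf).
by rewrite ip0l.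
Qed.

End wgradZ.

(** * Piecewise derivatives and the skeleton *)

Section mesh_functions.
Variables (R : realType) (n : nat) (Om : set 'rV[R]_n.+1) (M : mesh R n).
Local Notation E := 'rV[R]_n.+1.

Definition mesh_on := [/\ open Om, lipschitz_boundary Om & conforming_mesh Om M].

Hypothesis OM : mesh_on.
Local Notation T i := (@elt _ _ M i).

Lemma mesh_open : open Om. Proof. by case: OM. Qed.
Let mO : measurable Om. Proof. exact: (open_measurable_rV mesh_open). Qed.
Lemma mesh_elt_open i : open (T i). Proof. by case: OM => _ _ /elt_open. Qed.
Lemma mesh_elt_measurable i : measurable (T i).
Proof. exact: (open_measurable_rV (@mesh_elt_open i)). Qed.
Lemma mesh_elt_sub i : T i `<=` Om. Proof. by case: OM => oO LO cM; exact: elt_sub. Qed.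

Lemma sum_indic (V : lmodType R) (F : 'I_(ntri M) -> E -> V) i x : T i x ->
  \sum_j \1_(T j) x *: F j x = F i x.
Proof.
have [_ _ cM] := OM.
move=> Tx; rewrite (bigD1 i)//= indic_in// scale1r big1 ?addr0// => j ji.
rewrite indic_out ?scale0r// => Tj.
by have : (T j `&` T i) x by []; rewrite (elt_disj cM ji).
Qed.

Lemma pgradE w i x : T i x -> pgrad M w x = wgrad (T i) w x.
Proof. exact: (sum_indic (fun j x => wgrad (T j) w x)). Qed.

Lemma pdivE q i x : T i x -> pdiv M q x = wdiv (T i) q x.
Proof. exact: (sum_indic (fun j x => (wdiv (T j) q x : R^o))). Qed.

Lemma L2_mesh (F : 'I_(ntri M) -> E -> R) : (forall i, L2 (T i) (F i)) ->
  L2 Om (fun x => \sum_i \1_(T i) x * F i x).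
Proof.
move=> LF; apply: (L2_sum mO) => i.
exact: (L2_indic mO (mesh_elt_measurable i) (@mesh_elt_sub i)).
Qed.

Lemma L2v_mesh (F : 'I_(ntri M) -> E -> E) : (forall i, L2v (T i) (F i)) ->
  L2v Om (fun x => \sum_i \1_(T i) x *: F i x).
Proof.
move=> LF j; have := L2_mesh (fun i => LF i j); apply: L2_eq => x _.
by rewrite summxE; apply: eq_bigr => i _; rewrite mxE.
Qed.

Lemma L2_elt f i : L2 Om f -> L2 (T i) f.
Proof. exact: (L2_S (mesh_elt_measurable i) mO (@mesh_elt_sub i)). Qed.

Lemma L2v_elt p i : L2v Om p -> L2v (T i) p.
Proof. exact: (L2v_S (mesh_elt_measurable i) mO (@mesh_elt_sub i)). Qed.

Lemma pgrad_L2v w : (forall i, H1 (T i) w) -> L2v Om (pgrad M w).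
Proof. by move=> Hw; apply: L2v_mesh => i; exact: wgrad_L2v. Qed.

Lemma pdiv_L2 q : (forall i, Hdiv (T i) q) -> L2 Om (pdiv M q).
Proof. by move=> Hq; apply: L2_mesh => i; exact: wdiv_L2. Qed.

Lemma H1_elt w i : H1 Om w -> H1 (T i) w.
Proof. exact: (H1_sub mesh_open (@mesh_elt_open i) (@mesh_elt_sub i)). Qed.

Lemma Hdiv_elt q i : Hdiv Om q -> Hdiv (T i) q.
Proof. exact: (Hdiv_sub mesh_open (@mesh_elt_open i) (@mesh_elt_sub i)). Qed.

Lemma ipE f g : L2 Om f -> L2 Om g -> ip Om f g = \sum_i ip (T i) f g.
Proof. by case: OM => oO LO cM; exact: ip_mesh. Qed.

Lemma ipvE_mesh p q : L2v Om p -> L2v Om q -> ipv Om p q = \sum_i ipv (T i) p q.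
Proof. by case: OM => oO LO cM; exact: ipv_mesh. Qed.

Lemma ipv_pgrad (p : E -> E) w : L2v Om p -> (forall i, H1 (T i) w) ->
  ipv Om p (pgrad M w) = \sum_i ipv (T i) p (wgrad (T i) w).
Proof.
move=> Lp Hw; rewrite (ipvE_mesh Lp (pgrad_L2v Hw)); apply: eq_bigr => i _.
by apply: ipv_eq => // x; exact: pgradE.
Qed.

Lemma ip_pdiv (f : E -> R) q : L2 Om f -> (forall i, Hdiv (T i) q) ->
  ip Om f (pdiv M q) = \sum_i ip (T i) f (wdiv (T i) q).
Proof.
move=> Lf Hq; rewrite (ipE Lf (pdiv_L2 Hq)); apply: eq_bigr => i _.
by apply: ip_eq => // x; exact: pdivE.
Qed.

Lemma Hdiv_pgrad w i : H1Delta (T i) w -> Hdiv (T i) (pgrad M w).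
Proof. by move=> [_]; apply: Hdiv_eq => x Tx; rewrite (pgradE _ Tx). Qed.

Lemma wdiv_pgrad w i : wdiv (T i) (pgrad M w) = wdiv (T i) (wgrad (T i) w).
Proof. by apply: wdiv_eq => x; exact: pgradE. Qed.

(** Only [w] has to be differentiated elementwise, since [q] has a divergence on all of [Om].
    Skeleton terms thereby become volume integrals, and [b] becomes a functional with square
    integrable coefficients. *)
Lemma skeleton_Hdiv q w : Hdiv Om q -> L2 Om w -> (forall i, H1 (T i) w) ->
  skeleton M q w = ipv Om q (pgrad M w) + ip Om (wdiv Om q) w.
Proof.
move=> Hq Lw Hw; rewrite (ipv_pgrad (Hdiv_L2v Hq) Hw) (ipE (wdiv_L2 Hq) Lw).
rewrite -big_split; apply: eq_bigr => i _; congr (_ + _).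
exact: (ip_wdiv_sub mesh_open (@mesh_elt_open i) (@mesh_elt_sub i) Hq (L2_elt i Lw)).
Qed.

Lemma skeleton_H1 q w : H1 Om w -> L2v Om q -> (forall i, Hdiv (T i) q) ->
  skeleton M q w = ipv Om (wgrad Om w) q + ip Om w (pdiv M q).
Proof.
move=> Hw Lq Hq; rewrite (ip_pdiv (H1_L2 Hw) Hq) (ipvE_mesh (wgrad_L2v Hw) Lq).
rewrite -big_split; apply: eq_bigr => i _; congr (_ + _); last exact: ipC.
rewrite ipvC.
exact: (ipv_wgrad_sub mesh_open (@mesh_elt_open i) (@mesh_elt_sub i) Hw (L2v_elt i Lq)).
Qed.

End mesh_functions.

(** * Functionals on the test space *)

Section data_forms.
Variables (R : realType) (n : nat).
Local Notation E := 'rV[R]_n.+1.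
Local Notation test := ((E -> R) * (E -> E) * (E -> R))%type.
Implicit Types (D : set E) (f g : E -> R) (p q : E -> E).

(* The coefficients of a functional on V, as applied by dform: b(w, .), L and
   (t, .)_V are all of this form, over Om as well as over a mesh element. *)
Record fdata := FData { d1 : E -> R; d2 : E -> E; d3 : E -> E; d4 : E -> R;
  d5 : E -> R; d6 : E -> E; d7 : E -> R }.

Definition dform D (gr : (E -> R) -> E -> E) (dv : (E -> E) -> E -> R) d (x : test) : R :=
  let: (mu, tau, v) := x in
  (ip D (d1 d) mu + ipv D (d2 d) (gr mu)) + (ipv D (d3 d) tau + ip D (d4 d) (dv tau))
  + (ip D (d5 d) v + ipv D (d6 d) (gr v) + ip D (d7 d) (dv (gr v))).

Definition L2_data D d := [/\ L2 D (d1 d), L2v D (d2 d), L2v D (d3 d) & L2 D (d4 d)] /\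
  [/\ L2 D (d5 d), L2v D (d6 d) & L2 D (d7 d)].

Definition rdata (eps : R) (gr : (E -> R) -> E -> E) (dv : (E -> E) -> E -> R) (t : test) :=
  let: (m, p, v) := t in
  FData (fun x => eps^-1 * m x) (gr m) (fun x => eps `^ (- (1 / 2)) *: p x) (dv p)
    v (fun x => (eps `^ (1 / 2) + eps) *: gr v x) (fun x => eps `^ (3 / 2) * dv (gr v) x).

Lemma ipV_gen_dform eps D gr dv m p v y : measurable D ->
  L2_data D (FData m (gr m) p (dv p) v (gr v) (dv (gr v))) ->
  L2_data D (let: (mu, tau, w) := y in FData mu (gr mu) tau (dv tau) w (gr w) (dv (gr w))) ->
  L2_data D (rdata eps gr dv (m, p, v)) /\
  ipV_gen eps D gr dv (m, p, v) y = dform D gr dv (rdata eps gr dv (m, p, v)) y.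
Proof.
case: y => [[mu tau] w] mD [[/= L1 L2' L3 L4] [/= L5 L6 L7]] [[/= K1 K2 K3 K4] [/= K5 K6 K7]].
split; first by split; split => //=;
  [exact: (L2_Z mD)|exact: (L2v_Z mD)|exact: (L2v_Z mD)|exact: (L2_Z mD)].
rewrite /dform /= (ipZl mD _ L1 K1) (ipvZl mD _ L3 K3) (ipvZl mD _ L6 K6) (ipZl mD _ L7 K7).
by absip; ring.
Qed.

Lemma ip_quad_ge0 D f g (t : R) : measurable D -> L2 D f -> L2 D g ->
  0 <= ip D f f + 2 * t * ip D f g + t ^+ 2 * ip D g g.
Proof.
move=> mD Lf Lg; have := ip_ge0 D (fun x => f x + t * g x); have Lt := L2_Z mD t Lg.
rewrite (ipDl mD Lf Lt (L2_D mD Lf Lt)) (ipDr mD Lf Lf Lt) (ipDr mD Lt Lf Lt).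
rewrite !(ipZl mD t Lg) ?(ipZr mD t Lf Lg) ?(ipZr mD t Lg Lg)//.
by rewrite (ipC D g f); absip => h; apply: le_trans h _; rewrite le_eqVlt; apply/orP; left; apply/eqP; ring.
Qed.

Lemma ipv_quad_ge0 D (p q : E -> E) (t : R) : measurable D -> L2v D p -> L2v D q ->
  0 <= ipv D p p + 2 * t * ipv D p q + t ^+ 2 * ipv D q q.
Proof.
move=> mD Lf Lg; have := ipv_ge0 D (fun x => p x + t *: q x); have Lt := L2v_Z mD t Lg.
rewrite (ipvDl mD Lf Lt (L2v_D mD Lf Lt)) (ipvDr mD Lf Lf Lt) (ipvDr mD Lt Lf Lt).
rewrite !(ipvZl mD t Lg) ?(ipvZr mD t Lf Lg) ?(ipvZr mD t Lg Lg)//.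
by rewrite (ipvC D q p); absip => h; apply: le_trans h _; rewrite le_eqVlt; apply/orP; left; apply/eqP; ring.
Qed.

Lemma quad_sum7 (c1 c2 c3 c4 a1 a2 a3 a4 a5 a6 a7 b1 b2 b3 b4 b5 b6 b7 t
  g1 g2 g3 g4 g5 g6 g7 : R) :
  0 <= c1 -> 0 <= c2 -> 0 <= c3 -> 0 <= c4 ->
  0 <= a1 + 2 * t * b1 + t ^+ 2 * g1 -> 0 <= a2 + 2 * t * b2 + t ^+ 2 * g2 ->
  0 <= a3 + 2 * t * b3 + t ^+ 2 * g3 -> 0 <= a4 + 2 * t * b4 + t ^+ 2 * g4 ->
  0 <= a5 + 2 * t * b5 + t ^+ 2 * g5 -> 0 <= a6 + 2 * t * b6 + t ^+ 2 * g6 ->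
  0 <= a7 + 2 * t * b7 + t ^+ 2 * g7 ->
  0 <= (c1 * a1 + a2 + c2 * a3 + a4 + a5 + c3 * a6 + c4 * a7)
     + 2 * t * (c1 * b1 + b2 + c2 * b3 + b4 + b5 + c3 * b6 + c4 * b7)
     + t ^+ 2 * (c1 * g1 + g2 + c2 * g3 + g4 + g5 + c3 * g6 + c4 * g7).
Proof.
move=> c10 c20 c30 c40 h1 h2 h3 h4 h5 h6 h7.
have := mulr_ge0 c10 h1; have := mulr_ge0 c20 h3; have := mulr_ge0 c30 h6.
have := mulr_ge0 c40 h7; lra.
Qed.

Lemma ipV_gen_quad eps D gr dv (x y : test) t : measurable D -> 0 < eps ->
  L2_data D (let: (mu, tau, w) := x in FData mu (gr mu) tau (dv tau) w (gr w) (dv (gr w))) ->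
  L2_data D (let: (mu, tau, w) := y in FData mu (gr mu) tau (dv tau) w (gr w) (dv (gr w))) ->
  0 <= ipV_gen eps D gr dv x x + 2 * t * ipV_gen eps D gr dv x y
       + t ^+ 2 * ipV_gen eps D gr dv y y.
Proof.
case: x => [[m p] v]; case: y => [[mu tau] w] mD e0.
move=> [[/= L1 L2' L3 L4] [/= L5 L6 L7]] [[/= K1 K2 K3 K4] [/= K5 K6 K7]].
apply: quad_sum7.
- by rewrite invr_ge0 ltW.
- exact: powR_ge0.
- by rewrite addr_ge0 ?powR_ge0 ?(ltW e0).
- exact: powR_ge0.
- exact: (ip_quad_ge0 t mD L1 K1).
- exact: (ipv_quad_ge0 t mD L2' K2).
- exact: (ipv_quad_ge0 t mD L3 K3).
- exact: (ip_quad_ge0 t mD L4 K4).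
- exact: (ip_quad_ge0 t mD L5 K5).
- exact: (ipv_quad_ge0 t mD L6 K6).
- exact: (ip_quad_ge0 t mD L7 K7).
Qed.

Lemma ipV_gen_sym eps D gr dv (x y : test) :
  ipV_gen eps D gr dv x y = ipV_gen eps D gr dv y x.
Proof.
case: x => [[m p] v]; case: y => [[mu tau] w] /=.
by rewrite (ipC D m) (ipvC D (gr m)) (ipvC D p) (ipC D (dv p)) (ipC D v)
  (ipvC D (gr v)) (ipC D (dv (gr v))).
Qed.

End data_forms.

Lemma sum7Z (R : comRingType) (a x1 x2 x3 x4 x5 x6 x7 y1 y2 y3 y4 y5 y6 y7 : R) :
  x1 = a * y1 -> x2 = a * y2 -> x3 = a * y3 -> x4 = a * y4 -> x5 = a * y5 ->
  x6 = a * y6 -> x7 = a * y7 ->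
  (x1 + x2) + (x3 + x4) + (x5 + x6 + x7) = a * ((y1 + y2) + (y3 + y4) + (y5 + y6 + y7)).
Proof. by do !move=> ->; ring. Qed.

Lemma sum7E (R : comRingType) (c1 c2 c3 c4 x1 x2 x3 x4 x5 x6 x7 y1 y2 y3 : R) :
  c1 * x1 + 1 * x2 = y1 -> c2 * x3 + 1 * x4 = y2 -> 1 * x5 + c3 * x6 + c4 * x7 = y3 ->
  c1 * x1 + x2 + c2 * x3 + x4 + x5 + c3 * x6 + c4 * x7 = y1 + y2 + y3.
Proof. by do !move=> <-; ring. Qed.

(** * Functionals on one element *)

Section local_forms.
Variables (R : realType) (n : nat) (D : set 'rV[R]_n.+1).
Hypothesis oD : open D.
Local Notation E := 'rV[R]_n.+1.
Local Notation test := ((E -> R) * (E -> E) * (E -> R))%type.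
Let mD : measurable D. Proof. exact: open_measurable_rV. Qed.
Local Notation dL := (dform D (wgrad D) (wdiv D)).

Definition tdata (gr : (E -> R) -> E -> E) (dv : (E -> E) -> E -> R) (x : test) :=
  let: (mu, tau, w) := x in FData mu (gr mu) tau (dv tau) w (gr w) (dv (gr w)).

Definition test_eq (A : set E) (x y : test) := let: (mu, tau, v) := x in
  let: (mu', tau', v') := y in
  forall z, A z -> [/\ mu z = mu' z, tau z = tau' z & v z = v' z].

Lemma V_loc_tdata x : V_loc D x -> L2_data D (tdata (wgrad D) (wdiv D) x).
Proof.
case: x => [[mu tau] v] [Hm Ht [Hv Hd]]; split; split => /=.
- exact: H1_L2.
- exact: wgrad_L2v.
- exact: Hdiv_L2v.
- exact: wdiv_L2.
- exact: H1_L2.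
- exact: wgrad_L2v.
- exact: wdiv_L2.
Qed.

Lemma V_loc_eq x y : test_eq D x y -> V_loc D x -> V_loc D y.
Proof.
case: x => [[mu tau] v]; case: y => [[mu' tau'] v'] e [Hm Ht Hv]; split.
- by apply: H1_eq Hm => z /e[].
- by apply: Hdiv_eq Ht => z /e[].
- by apply: H1Delta_eq Hv => z /e[].
Qed.

Lemma dform_loc_eq d x y : test_eq D x y -> dL d x = dL d y.
Proof.
case: x => [[mu tau] v]; case: y => [[mu' tau'] v'] e /=.
have em : forall z, D z -> mu z = mu' z by move=> z /e[].
have et : forall z, D z -> tau z = tau' z by move=> z /e[].
have ev : forall z, D z -> v z = v' z by move=> z /e[].
rewrite (wgrad_eq em) (wgrad_eq ev) (wdiv_eq et).
congr (_ + _ + (_ + _) + (_ + _ + _)).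
- exact: ip_eq.
- exact: ipv_eq.
- exact: ip_eq.
Qed.

Lemma dform_data_eq gr dv d d' x : (forall z, D z ->
    [/\ d1 d z = d1 d' z, d2 d z = d2 d' z, d3 d z = d3 d' z & d4 d z = d4 d' z]) ->
  (forall z, D z -> [/\ d5 d z = d5 d' z, d6 d z = d6 d' z & d7 d z = d7 d' z]) ->
  dform D gr dv d x = dform D gr dv d' x.
Proof.
case: x => [[mu tau] v] e1 e2 /=; congr (_ + _ + (_ + _) + (_ + _ + _)).
- by apply: ip_eq => // z /e1[].
- by apply: ipv_eq => // z /e1[].
- by apply: ipv_eq => // z /e1[].
- by apply: ip_eq => // z /e1[].
- by apply: ip_eq => // z /e2[].
- by apply: ipv_eq => // z /e2[].
- by apply: ip_eq => // z /e2[].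
Qed.

Lemma ip_wdiv0r f : L2 D f -> ip D f (wdiv D (fun=> 0)) = 0.
Proof. by move=> Lf; rewrite ipC (ip_wdiv0 oD Lf). Qed.

Lemma ipv_wgrad0r p : L2v D p -> ipv D p (wgrad D (fun=> 0)) = 0.
Proof. by move=> Lp; rewrite ipvC (ipv_wgrad0 oD Lp). Qed.

Lemma ip_lap0r f : L2 D f -> ip D f (wdiv D (wgrad D (fun=> 0))) = 0.
Proof. by move=> Lf; rewrite ipC (ip_lap0 oD Lf). Qed.

Lemma ipv0r (p : E -> E) : L2v D p -> ipv D p (fun=> 0) = 0.
Proof. by move=> Lp; rewrite ipvC (ipv0l oD Lp). Qed.

Lemma dform_loc_mu d mu : L2_data D d ->
  dL d (mu, (fun=> 0), (fun=> 0)) = ip D (d1 d) mu + ipv D (d2 d) (wgrad D mu).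
Proof.
move=> [[L1 L2' L3 L4] [L5 L6 L7]] /=.
rewrite (ipv0r L3) (ip_wdiv0r L4) ip0r (ipv_wgrad0r L6) (ip_lap0r L7).
by rewrite !addr0.
Qed.

Lemma dform_loc_tau d tau : L2_data D d ->
  dL d ((fun=> 0), tau, (fun=> 0)) = ipv D (d3 d) tau + ip D (d4 d) (wdiv D tau).
Proof.
move=> [[L1 L2' L3 L4] [L5 L6 L7]] /=.
rewrite !ip0r (ipv_wgrad0r L2') (ipv_wgrad0r L6) (ip_lap0r L7).
by rewrite !addr0 add0r.
Qed.

Lemma dform_loc_v d v : L2_data D d ->
  dL d ((fun=> 0), (fun=> 0), v) =
  ip D (d5 d) v + ipv D (d6 d) (wgrad D v) + ip D (d7 d) (wdiv D (wgrad D v)).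
Proof.
move=> [[L1 L2' L3 L4] [L5 L6 L7]] /=.
rewrite !ip0r (ipv_wgrad0r L2') (ipv0r L3) (ip_wdiv0r L4).
by rewrite !addr0 add0r.
Qed.

Lemma dform_loc0 d : L2_data D d -> dL d ((fun=> 0), (fun=> 0), (fun=> 0)) = 0.
Proof.
move=> Ld; rewrite dform_loc_mu//; have [[L1 L2' _ _] _] := Ld.
by rewrite ip0r (ipv_wgrad0r L2') addr0.
Qed.

Lemma V_locZ a x : V_loc D x -> V_loc D (a *: x).
Proof.
case: x => [[mu tau] v] [Hm Ht Hv]; split.
- exact: (H1Z oD a Hm).
- exact: (HdivZ oD a Ht).
- exact: (H1DeltaZ oD a Hv).
Qed.

Lemma dform_locZ a d x : L2_data D d -> V_loc D x -> dL d (a *: x) = a * dL d x.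
Proof.
case: x => [[mu tau] v] [[L1 L2' L3 L4] [L5 L6 L7]] [Hm Ht Hv] /=.
have [e1 e2 e3] : [/\ a *: mu = (fun x => a * mu x), a *: tau = (fun x => a *: tau x)
  & a *: v = (fun x => a * v x)] by [].
have fC f g h (b : R) : ip D f h = b * ip D g h -> ip D h f = b * ip D h g.
  by move=> e; rewrite (ipC D h f) (ipC D h g).
have vC f g h (b : R) : ipv D f h = b * ipv D g h -> ipv D h f = b * ipv D h g.
  by move=> e; rewrite (ipvC D h f) (ipvC D h g).
rewrite e1 e2 e3; apply: sum7Z.
- exact: (ipZr mD a L1 (H1_L2 Hm)).
- exact: (vC _ _ _ _ (ipv_wgradZ oD a Hm L2')).
- exact: (ipvZr mD a L3 (Hdiv_L2v Ht)).
- exact: (fC _ _ _ _ (ip_wdivZ oD a Ht L4)).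
- exact: (ipZr mD a L5 (H1_L2 Hv.1)).
- exact: (vC _ _ _ _ (ipv_wgradZ oD a Hv.1 L6)).
- exact: (fC _ _ _ _ (ip_lapZ oD a Hv L7)).
Qed.

(** The inner product does not couple the three components, so three separate Riesz problems
    suffice. *)
Lemma ipV_loc_riesz eps d : 0 < eps -> L2_data D d ->
  exists r, V_loc D r /\ forall x, V_loc D x -> ipV_loc eps D r x = dL d x.
Proof.
move=> e0 [[L1 L2' L3 L4] [L5 L6 L7]].
have c0 : 0 < eps^-1 by rewrite invr_gt0.
have c1 a : 0 < eps `^ a by exact: powR_gt0.
have c2 : 0 < eps `^ (1 / 2) + eps by rewrite addr_gt0.
have [m Hm mP] := riesz_H1 oD c0 ltr01 L1 L2'.
have [p Hp pP] := riesz_Hdiv oD (c1 (- (1 / 2))) ltr01 L3 L4.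
have [v Hv vP] := riesz_H1Delta oD ltr01 c2 (c1 (3 / 2)) L5 L6 L7.
exists (m, p, v); split; first by [].
case=> [[mu tau] w] [Km Kt Kv].
exact: (sum7E (mP _ Km) (pP _ Kt) (vP _ Kv)).
Qed.

End local_forms.

(** * Functionals on the broken test space *)

Section global_forms.
Variables (R : realType) (n : nat) (Om : set 'rV[R]_n.+1) (M : mesh R n).
Local Notation E := 'rV[R]_n.+1.
Local Notation test := ((E -> R) * (E -> E) * (E -> R))%type.
Hypothesis OM : mesh_on Om M.
Local Notation T i := (@elt _ _ M i).
Let oT i : open (T i). Proof. exact: (@mesh_elt_open _ _ _ _ OM i). Qed.
Let mT i : measurable (T i). Proof. exact: (open_measurable_rV (@oT i)). Qed.
Let mO : measurable Om. Proof. exact: (open_measurable_rV (mesh_open OM)). Qed.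
Let TO i : T i `<=` Om. Proof. exact: (@mesh_elt_sub _ _ _ _ OM i). Qed.
Local Notation dG := (dform Om (pgrad M) (pdiv M)).
Local Notation dL i := (dform (T i) (wgrad (T i)) (wdiv (T i))).

Lemma V_space_tdata x : V_space Om M x -> L2_data Om (tdata (pgrad M) (pdiv M) x).
Proof.
case: x => [[mu tau] v] [Lm Lt Lv H].
have Hm i : H1 (T i) mu by have [] := H i.
have Ht i : Hdiv (T i) tau by have [] := H i.
have Hv i : H1Delta (T i) v by have [] := H i.
split; split => //=.
- exact: (pgrad_L2v OM Hm).
- exact: (pdiv_L2 OM Ht).
- exact: (pgrad_L2v OM (fun i => (Hv i).1)).
- exact: (pdiv_L2 OM (fun i => Hdiv_pgrad OM (Hv i))).
Qed.

Lemma L2_data_elt d i : L2_data Om d -> L2_data (T i) d.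
Proof.
move=> [[L1 L2' L3 L4] [L5 L6 L7]]; split; split.
- exact: (L2_elt OM i L1).
- exact: (L2v_elt OM i L2').
- exact: (L2v_elt OM i L3).
- exact: (L2_elt OM i L4).
- exact: (L2_elt OM i L5).
- exact: (L2v_elt OM i L6).
- exact: (L2_elt OM i L7).
Qed.

Lemma dform_mesh d x : L2_data Om d -> V_space Om M x -> dG d x = \sum_i dL i d x.
Proof.
case: x => [[mu tau] v] [[L1 L2' L3 L4] [L5 L6 L7]] [Lm Lt Lv H].
have Hm i : H1 (T i) mu by have [] := H i.
have Ht i : Hdiv (T i) tau by have [] := H i.
have Hv i : H1Delta (T i) v by have [] := H i.
rewrite /= (ipE OM L1 Lm) (ipE OM L5 Lv) (ipv_pgrad OM L2' Hm) (ipvE_mesh OM L3 Lt).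
rewrite (ip_pdiv OM L4 Ht) (ipv_pgrad OM L6 (fun i => (Hv i).1)).
rewrite (ip_pdiv OM L7 (fun i => Hdiv_pgrad OM (Hv i))).
rewrite -!big_split; apply: eq_bigr => i _ /=.
by rewrite (wdiv_pgrad OM).
Qed.

Lemma ext0_test_eq i x : test_eq (T i) x (ext0 (T i) x).
Proof.
case: x => [[mu tau] v] z Tz /=.
by rewrite !indic_in// scale1r !mul1r.
Qed.

Lemma ext0_test_eq0 i j x : j != i ->
  test_eq (T j) ((fun=> 0), (fun=> 0), (fun=> 0)) (ext0 (T i) x).
Proof.
have [_ _ cM] := OM.
case: x => [[mu tau] v] ji z Tz /=; rewrite !indic_out ?scale0r ?mul0r// => Tiz.
by have : (T j `&` T i) z by []; rewrite (elt_disj cM ji).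
Qed.

Lemma V_space_ext0 i x : V_loc (T i) x -> V_space Om M (ext0 (T i) x).
Proof.
move=> Vx; have Vj j : V_loc (T j) (ext0 (T i) x).
  have [->|ji] := eqVneq j i; first exact: V_loc_eq (ext0_test_eq i x) Vx.
  apply: V_loc_eq (ext0_test_eq0 x ji) _.
  by split; [exact: (H1_0 (T j))|exact: (Hdiv_0 (@oT j))|exact: (H1Delta0 (@oT j))].
case: x Vx Vj => [[mu tau] v] [Hm Ht Hv] Vj; split => //.
- exact: (L2_indic mO (mT i) (@TO i) (H1_L2 Hm)).
- exact: (L2v_indic mO (mT i) (@TO i) (Hdiv_L2v Ht)).
- exact: (L2_indic mO (mT i) (@TO i) (H1_L2 Hv.1)).
Qed.

(** Extension by zero is admissible because test functions may jump across element boundaries. It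
    isolates the contribution of one element. *)
Lemma dform_ext0 i d x : L2_data Om d -> V_loc (T i) x ->
  dG d (ext0 (T i) x) = dL i d x.
Proof.
move=> Ld Vx; rewrite (dform_mesh Ld (V_space_ext0 Vx)) (bigD1 i)//=.
rewrite -(dform_loc_eq d (ext0_test_eq i x)) big1 ?addr0// => j ji.
by rewrite -(dform_loc_eq d (ext0_test_eq0 x ji)) (dform_loc0 (@oT j) (L2_data_elt j Ld)).
Qed.

Lemma V_spaceZ a x : V_space Om M x -> V_space Om M (a *: x).
Proof.
case: x => [[mu tau] v] [Lm Lt Lv H]; split.
- exact: (L2_Z mO a Lm).
- exact: (L2v_Z mO a Lt).
- exact: (L2_Z mO a Lv).
- by move=> i; exact: (V_locZ (@oT i) a (H i)).
Qed.

Lemma V_space_loc x i : V_space Om M x -> V_loc (T i) x.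
Proof. by case: x => [[mu tau] v] [_ _ _]. Qed.

Lemma dformZ a d x : L2_data Om d -> V_space Om M x -> dG d (a *: x) = a * dG d x.
Proof.
move=> Ld Vx; rewrite (dform_mesh Ld (V_spaceZ a Vx)) (dform_mesh Ld Vx) mulr_sumr.
apply: eq_bigr => i _.
exact: (dform_locZ (@oT i) a (L2_data_elt i Ld) (V_space_loc i Vx)).
Qed.

Lemma ipV_dform eps t x : V_space Om M t -> V_space Om M x ->
  L2_data Om (rdata eps (pgrad M) (pdiv M) t) /\
  ipV eps Om M t x = dG (rdata eps (pgrad M) (pdiv M) t) x.
Proof.
move=> Vt Vx; have Lt := V_space_tdata Vt; have Lx := V_space_tdata Vx.
by case: t Vt Lt => [[m p] v] _ Lt; exact: ipV_gen_dform.
Qed.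

Lemma rdata_data eps t : V_space Om M t -> L2_data Om (rdata eps (pgrad M) (pdiv M) t).
Proof. by move=> Vt; have [] := ipV_dform eps Vt Vt. Qed.

Lemma rdata_loc eps t i x : V_loc (T i) t -> V_loc (T i) x ->
  dL i (rdata eps (pgrad M) (pdiv M) t) x = ipV_loc eps (T i) t x.
Proof.
move=> Vt Vx; have Lt := V_loc_tdata Vt; have Lx := V_loc_tdata Vx.
case: t Vt Lt => [[m p] v] Vt Lt.
have [_ ] := ipV_gen_dform eps (mT i) Lt Lx; rewrite /ipV_loc => ->.
apply: dform_data_eq => z Tz; split => //=.
- exact: pgradE OM _ _ _ Tz.
- exact: pdivE OM _ _ _ Tz.
- by rewrite (pgradE OM _ Tz).
- by rewrite (pdivE OM _ Tz) (wdiv_pgrad OM).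
Qed.

Lemma ipV_mesh eps t x : V_space Om M t -> V_space Om M x ->
  ipV eps Om M t x = \sum_i ipV_loc eps (T i) t x.
Proof.
move=> Vt Vx; have [Lt ->] := ipV_dform eps Vt Vx; rewrite (dform_mesh Lt Vx).
by apply: eq_bigr => i _; apply: rdata_loc; exact: V_space_loc.
Qed.

Lemma ipV_ext0 eps t i x : V_space Om M t -> V_loc (T i) x ->
  ipV eps Om M t (ext0 (T i) x) = ipV_loc eps (T i) t x.
Proof.
move=> Vt Vx; have [Lt ->] := ipV_dform eps Vt (V_space_ext0 Vx).
by rewrite (dform_ext0 Lt Vx) rdata_loc//; exact: V_space_loc.
Qed.

Lemma ipVZr eps a t x : V_space Om M t -> V_space Om M x ->
  ipV eps Om M t (a *: x) = a * ipV eps Om M t x.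
Proof.
move=> Vt Vx; have [Lt ->] := ipV_dform eps Vt (V_spaceZ a Vx).
by have [_ ->] := ipV_dform eps Vt Vx; exact: dformZ.
Qed.

Lemma ipV_quad eps x y s : 0 < eps -> V_space Om M x -> V_space Om M y ->
  0 <= ipV eps Om M x x + 2 * s * ipV eps Om M x y + s ^+ 2 * ipV eps Om M y y.
Proof.
move=> e0 /V_space_tdata Lx /V_space_tdata Ly.
exact: (ipV_gen_quad s mO e0 Lx Ly).
Qed.

Lemma ipV_loc_quad eps i x y s : 0 < eps -> V_loc (T i) x -> V_loc (T i) y ->
  0 <= ipV_loc eps (T i) x x + 2 * s * ipV_loc eps (T i) x y + s ^+ 2 * ipV_loc eps (T i) y y.
Proof.
move=> e0 /V_loc_tdata Lx /V_loc_tdata Ly.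
exact: (ipV_gen_quad s (mT i) e0 Lx Ly).
Qed.

Lemma ipV_sym eps x y : ipV eps Om M x y = ipV eps Om M y x.
Proof. exact: ipV_gen_sym. Qed.

(** The broken test space is a product over the elements, and its inner product is a sum over them.
    Local representers, put together with indicators, therefore form a global one. *)
Lemma ipV_riesz eps d : 0 < eps -> L2_data Om d ->
  exists t, V_space Om M t /\ forall x, V_space Om M x -> ipV eps Om M t x = dG d x.
Proof.
move=> e0 Ld.
have /choice[r rP] i := ipV_loc_riesz (@oT i) e0 (L2_data_elt i Ld).
pose t : test := ((fun z => \sum_i \1_(T i) z * (r i).1.1 z),
  (fun z => \sum_i \1_(T i) z *: (r i).1.2 z), (fun z => \sum_i \1_(T i) z * (r i).2 z)).
have te i : test_eq (T i) (r i) t.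
  rewrite /t /test_eq; case E : (r i) => [[m p] v] z Tz; split.
  - by rewrite (sum_indic OM (fun j z => ((r j).1.1 z : R^o)) Tz) E.
  - by rewrite (sum_indic OM (fun j z => (r j).1.2 z) Tz) E.
  - by rewrite (sum_indic OM (fun j z => ((r j).2 z : R^o)) Tz) E.
have rH i : [/\ H1 (T i) (r i).1.1, Hdiv (T i) (r i).1.2 & H1Delta (T i) (r i).2].
  by have [] := rP i; case: (r i) => [[m p] v].
have Vt : V_space Om M t.
  split; last by move=> i; apply: V_loc_eq (te i) _; have [] := rP i.
  - by apply: (L2_mesh OM) => i; have [/H1_L2] := rH i.
  - by apply: (L2v_mesh OM) => i; have [_ /Hdiv_L2v] := rH i.
  - by apply: (L2_mesh OM) => i; have [_ _ [/H1_L2]] := rH i.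
exists t; split => // x Vx; rewrite (ipV_mesh eps Vt Vx) (dform_mesh Ld Vx).
apply: eq_bigr => i _; have Vxi := V_space_loc i Vx.
have [Vr <-//] := rP i.
rewrite -(rdata_loc eps (V_space_loc i Vt) Vxi) -(rdata_loc eps Vr Vxi).
have : test_eq (T i) (r i) t := te i.
case: (r i) => [[m p] v]; move: t {Vt te} => [[m' p'] v'] e.
have em : forall z, T i z -> m z = m' z by move=> z /e[].
have ep : forall z, T i z -> p z = p' z by move=> z /e[].
have ev : forall z, T i z -> v z = v' z by move=> z /e[].
apply: dform_data_eq => z Tz /=; split.
- by rewrite em.
- by rewrite !(pgradE OM _ Tz) (wgrad_eq em).
- by rewrite ep.
- by rewrite !(pdivE OM _ Tz) (wdiv_eq ep).
- by rewrite ev.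
- by rewrite !(pgradE OM _ Tz) (wgrad_eq ev).
- by rewrite !(pdivE OM _ Tz) !(wdiv_pgrad OM) (wgrad_eq ev).
Qed.

End global_forms.

(** Pure rearrangement, kept apart from the integrals so that [ring] sees variables only. The twelve
    terms are those of [b_form], in order. *)
Lemma b_lin12 (R : comRingType) (c1 c2 c3 c4 c5 x1 x2 x3 x4 x5 x6 x7 x8 x9 x10 x11 x12
  y1 y2 y3 y4 y5 y6 y7 y8 y9 y10 y11 y12
  z1 z2 z3 z4 z5 z6 z7 z8 z9 z10 z11 z12 : R) :
  x1 = y1 - z1 -> x2 = y2 - z2 -> x3 = y3 - z3 -> x4 = y4 - z4 -> x5 = y5 - z5 ->
  x6 = y6 - z6 -> x7 = y7 - z7 -> x8 = y8 - z8 -> x9 = y9 - z9 -> x10 = y10 - z10 ->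
  x11 = y11 - z11 -> x12 = y12 - z12 ->
  x1 + x2 - x3 + c1 * x4 + x5 - x6 + c2 * x7 - c2 * x8 + x9 + c3 * x10 + c4 * x11 - c5 * x12
  = (y1 + y2 - y3 + c1 * y4 + y5 - y6 + c2 * y7 - c2 * y8 + y9 + c3 * y10 + c4 * y11 - c5 * y12)
  - (z1 + z2 - z3 + c1 * z4 + z5 - z6 + c2 * z7 - c2 * z8 + z9 + c3 * z10 + c4 * z11 - c5 * z12).
Proof. by do !move=> ->; ring. Qed.

Lemma b_data12 (R : comRingType) (c1 c2 c3 c4 c5 x1 x2 x3 x3' x4 x5 x6 x6' x7 x8 x8' x9 x10
  x12 x12' w1 w2 w3 w4 w5 w6 w7 : R) :
  w1 = x1 - x3' -> w2 = x2 - x3 -> w3 = c1 * x4 - x6 -> w4 = x5 - x6' ->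
  w5 = x9 - c2 * x8' -> w6 = (c2 + c4) * x7 - c2 * x8 - c5 * x12 ->
  w7 = c3 * x10 - c5 * x12' ->
  x1 + x2 - (x3 + x3') + c1 * x4 + x5 - (x6 + x6') + c2 * x7 - c2 * (x8 + x8') + x9
    + c3 * x10 + c4 * x7 - c5 * (x12 + x12') = (w1 + w2) + (w3 + w4) + (w5 + w6 + w7).
Proof. by do !move=> ->; ring. Qed.

Lemma sum7B (R : comRingType) (x1 x2 x3 x4 x5 x6 x7 y1 y2 y3 y4 y5 y6 y7
   z1 z2 z3 z4 z5 z6 z7 : R) :
  x1 = y1 - z1 -> x2 = y2 - z2 -> x3 = y3 - z3 -> x4 = y4 - z4 -> x5 = y5 - z5 ->
  x6 = y6 - z6 -> x7 = y7 - z7 ->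
  (x1 + x2) + (x3 + x4) + (x5 + x6 + x7) = ((y1 + y2) + (y3 + y4) + (y5 + y6 + y7))
   - ((z1 + z2) + (z3 + z4) + (z5 + z6 + z7)).
Proof. by do !move=> ->; ring. Qed.

(** * The forms [b] and [L], the residual and the dual norm *)

Section dpg.
Variables (R : realType) (n : nat) (Om : set 'rV[R]_n.+1) (M : mesh R n) (eps : R).
Local Notation E := 'rV[R]_n.+1.
Local Notation test := ((E -> R) * (E -> E) * (E -> R))%type.
Hypothesis OM : mesh_on Om M.
Hypothesis eps0 : 0 < eps.
Local Notation T i := (@elt _ _ M i).
Let oO : open Om. Proof. exact: mesh_open OM. Qed.
Let oT i : open (T i). Proof. exact: (@mesh_elt_open _ _ _ _ OM i). Qed.
Let mO : measurable Om. Proof. exact: (open_measurable_rV oO). Qed.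
Local Notation dG := (dform Om (pgrad M) (pdiv M)).
Local Notation dL i := (dform (T i) (wgrad (T i)) (wdiv (T i))).
Local Notation b := (b_form eps Om M).
Local Notation L := (L_form eps Om M).
Implicit Types uu vv : trial R n.

(** Coefficients of [b(uu, .)] against [mu], its gradient, [tau], its divergence, [v], its gradient
    and its Laplacian, once the skeleton terms are volume integrals. *)
Definition bdata uu : fdata R n :=
  FData (fun x => trho uu x - wdiv Om (tsa uu) x)
    (fun x => tsigma uu x - tsa uu x)
    (fun x => eps `^ (- (1 / 4)) *: tsigma uu x - wgrad Om (tua uu) x)
    (fun x => tu uu x - tua uu x)
    (fun x => tu uu x - eps `^ (3 / 4) * wdiv Om (tsb uu) x)
    (fun x => (eps `^ (3 / 4) + eps `^ (1 / 4)) *: tsigma uu x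
       - eps `^ (3 / 4) *: tsb uu x - eps `^ (1 / 2) *: wgrad Om (tub uu) x)
    (fun x => eps `^ (5 / 4) * trho uu x - eps `^ (1 / 2) * tub uu x).

Lemma bdata_L2 uu : U_space Om uu -> L2_data Om (bdata uu).
Proof.
move=> [[Lu Ls Lr] [Ha Hb Hsa Hsb _]]; split; split.
- exact: (L2_B mO Lr (wdiv_L2 Hsa)).
- exact: (L2v_B mO Ls (Hdiv_L2v Hsa)).
- exact: (L2v_B mO (L2v_Z mO _ Ls) (wgrad_L2v Ha)).
- exact: (L2_B mO Lu (H1_L2 Ha)).
- exact: (L2_B mO Lu (L2_Z mO _ (wdiv_L2 Hsb))).
- exact: (L2v_B mO (L2v_B mO (L2v_Z mO _ Ls) (L2v_Z mO _ (Hdiv_L2v Hsb)))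
    (L2v_Z mO _ (wgrad_L2v Hb))).
- exact: (L2_B mO (L2_Z mO _ Lr) (L2_Z mO _ (H1_L2 Hb))).
Qed.

Lemma b_form_dform uu x : U_space Om uu -> V_space Om M x -> b uu x = dG (bdata uu) x.
Proof.
move=> Uu Vx; have [_ [/= K5 K6 K7]] := V_space_tdata OM Vx.
case: x Vx K5 K6 K7 => [[mu tau] v] Vx K5 K6 K7.
have [[/= K1 K2 K3 K4] [/= {}K5 {}K6 {}K7]] := V_space_tdata OM Vx.
have [[Lu Ls Lr] [Ha Hb Hsa Hsb _]] := Uu.
have [Lm Lt Lv H] := Vx.
have Hm i : H1 (T i) mu by have [] := H i.
have Ht i : Hdiv (T i) tau by have [] := H i.
have Hv i : H1Delta (T i) v by have [] := H i.
rewrite /b_form (skeleton_Hdiv OM Hsa Lm Hm) (skeleton_H1 OM Ha Lt Ht).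
rewrite (skeleton_Hdiv OM Hsb Lv (fun i => (Hv i).1)).
rewrite (skeleton_H1 OM Hb K6 (fun i => Hdiv_pgrad OM (Hv i))).
apply: b_data12.
- exact: (ipBl mO Lr (wdiv_L2 Hsa) K1).
- exact: (ipvBl mO Ls (Hdiv_L2v Hsa) K2).
- rewrite (ipvBl mO (L2v_Z mO _ Ls) (wgrad_L2v Ha) K3); congr (_ - _).
  exact: (ipvZl mO _ Ls K3).
- exact: (ipBl mO Lu (H1_L2 Ha) K4).
- rewrite (ipBl mO Lu (L2_Z mO _ (wdiv_L2 Hsb)) K5); congr (_ - _).
  exact: (ipZl mO _ (wdiv_L2 Hsb) K5).
- rewrite (ipvBl mO (L2v_B mO (L2v_Z mO _ Ls) (L2v_Z mO _ (Hdiv_L2v Hsb)))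
    (L2v_Z mO _ (wgrad_L2v Hb)) K6).
  rewrite (ipvBl mO (L2v_Z mO _ Ls) (L2v_Z mO _ (Hdiv_L2v Hsb)) K6).
  congr (_ - _ - _).
  + exact: (ipvZl mO _ Ls K6).
  + exact: (ipvZl mO _ (Hdiv_L2v Hsb) K6).
  + exact: (ipvZl mO _ (wgrad_L2v Hb) K6).
- rewrite (ipBl mO (L2_Z mO _ Lr) (L2_Z mO _ (H1_L2 Hb)) K7); congr (_ - _).
  + exact: (ipZl mO _ Lr K7).
  + exact: (ipZl mO _ (H1_L2 Hb) K7).
Qed.

Lemma skeletonBl q q' w : (forall i, Hdiv (T i) q) -> (forall i, Hdiv (T i) q') ->
  (forall i, H1 (T i) w) -> skeleton M (q - q') w = skeleton M q w - skeleton M q' w.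
Proof.
move=> Hq Hq' Hw; rewrite -sumrB; apply: eq_bigr => i _.
have e := duality_linl (@oT i) (-1) (Hq' i) (Hq i) (Hw i).
apply: etrans (etrans _ e) _.
  by apply: duality_eq => // x _; rewrite scaleN1r addrC.
by rewrite mulN1r addrC.
Qed.

Lemma skeletonBr q w w' : (forall i, Hdiv (T i) q) -> (forall i, H1 (T i) w) ->
  (forall i, H1 (T i) w') -> skeleton M q (w - w') = skeleton M q w - skeleton M q w'.
Proof.
move=> Hq Hw Hw'; rewrite -sumrB; apply: eq_bigr => i _.
have e := duality_linr (@oT i) (-1) (Hq i) (Hw' i) (Hw i).
apply: etrans (etrans _ e) _.
  by apply: duality_eq => // x _; rewrite mulN1r addrC.
by rewrite mulN1r addrC.
Qed.

Lemma b_formB uu vv x : U_space Om uu -> U_space Om vv -> V_space Om M x ->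
  b (uu - vv) x = b uu x - b vv x.
Proof.
case: uu => [[[[[[u s] r] ua] ub] sa] sb]; case: vv => [[[[[[u' s'] r'] ua'] ub'] sa'] sb'].
case: x => [[mu tau] v] [[Lu Ls Lr] [Ha Hb Hsa Hsb _]] [[Lu' Ls' Lr'] [Ha' Hb' Hsa' Hsb' _]] Vx.
have [[/= K1 K2 K3 K4] [/= K5 K6 K7]] := V_space_tdata OM Vx.
have [Lm Lt Lv H] := Vx.
have Hm i : H1 (T i) mu by have [] := H i.
have Ht i : Hdiv (T i) tau by have [] := H i.
have Hv i : H1Delta (T i) v by have [] := H i.
have h1 i (w : E -> R) : H1 Om w -> H1 (T i) w by move=> /(H1_elt OM i).
have hd i (w : E -> E) : Hdiv Om w -> Hdiv (T i) w by move=> /(Hdiv_elt OM i).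
apply: b_lin12.
- exact: (ipBl mO Lr Lr' K1).
- exact: (ipvBl mO Ls Ls' K2).
- exact: (skeletonBl (fun i => hd i _ Hsa) (fun i => hd i _ Hsa') Hm).
- exact: (ipvBl mO Ls Ls' K3).
- exact: (ipBl mO Lu Lu' K4).
- exact: (skeletonBr Ht (fun i => h1 i _ Ha) (fun i => h1 i _ Ha')).
- exact: (ipvBl mO Ls Ls' K6).
- exact: (skeletonBl (fun i => hd i _ Hsb) (fun i => hd i _ Hsb') (fun i => (Hv i).1)).
- exact: (ipBl mO Lu Lu' K5).
- exact: (ipBl mO Lr Lr' K7).
- exact: (ipvBl mO Ls Ls' K6).
- exact: (skeletonBr (fun i => Hdiv_pgrad OM (Hv i)) (fun i => h1 i _ Hb) (fun i => h1 i _ Hb')).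
Qed.

Lemma ThetaP uu : U_space Om uu -> V_space Om M (Theta eps Om M uu) /\
  forall x, V_space Om M x -> ipV eps Om M (Theta eps Om M uu) x = b uu x.
Proof.
move=> Uu; apply: (getPex (P := [set t : test | V_space Om M t /\
    forall x, V_space Om M x -> ipV eps Om M t x = b_form eps Om M uu x])).
have [t [Vt tP]] := ipV_riesz OM eps0 (bdata_L2 Uu).
by exists t; split => // x Vx; rewrite tP// b_form_dform.
Qed.

Definition Ldata (f : E -> R) : fdata R n :=
  FData (fun=> 0) (fun=> 0) (fun=> 0) (fun=> 0) f (fun=> 0) (fun x => - (eps `^ (1 / 2)) * f x).

Lemma Ldata_L2 f : L2 Om f -> L2_data Om (Ldata f).
Proof.
move=> Lf; split; split => /=.
- exact: L2_0.
- exact: L2v_0.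
- exact: L2v_0.
- exact: L2_0.
- exact: Lf.
- exact: L2v_0.
- exact: (L2_Z mO _ Lf).
Qed.

Lemma L_form_dform f x : L2 Om f -> V_space Om M x -> L f x = dG (Ldata f) x.
Proof.
case: x => [[mu tau] v] Lf Vx; have [[/= K1 K2 K3 K4] [/= K5 K6 K7]] := V_space_tdata OM Vx.
rewrite /L_form /dform /=.
rewrite (ip0l Om mu) (ip0l Om (pdiv M tau)) (ipv0l oO K2) (ipv0l oO K3) (ipv0l oO K6).
rewrite (ipBr mO Lf K5 (L2_Z mO _ K7)) (ipZr mO _ Lf K7) (ipZl mO _ Lf K7).
by rewrite !addr0 !add0r mulNr.
Qed.

Definition dsub (d d' : fdata R n) : fdata R n :=
  FData (fun x => d1 d x - d1 d' x) (fun x => d2 d x - d2 d' x) (fun x => d3 d x - d3 d' x)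
   (fun x => d4 d x - d4 d' x) (fun x => d5 d x - d5 d' x) (fun x => d6 d x - d6 d' x)
   (fun x => d7 d x - d7 d' x).

Lemma dsub_L2 d d' : L2_data Om d -> L2_data Om d' -> L2_data Om (dsub d d').
Proof.
move=> [[L1 L2' L3 L4] [L5 L6 L7]] [[K1 K2 K3 K4] [K5 K6 K7]]; split; split.
- exact: (L2_B mO L1 K1).
- exact: (L2v_B mO L2' K2).
- exact: (L2v_B mO L3 K3).
- exact: (L2_B mO L4 K4).
- exact: (L2_B mO L5 K5).
- exact: (L2v_B mO L6 K6).
- exact: (L2_B mO L7 K7).
Qed.

Lemma dform_sub d d' x : L2_data Om d -> L2_data Om d' -> V_space Om M x ->
  dG (dsub d d') x = dG d x - dG d' x.
Proof.
case: x => [[mu tau] v] [[L1 L2' L3 L4] [L5 L6 L7]] [[N1 N2 N3 N4] [N5 N6 N7]] Vx.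
have [[/= K1 K2 K3 K4] [/= K5 K6 K7]] := V_space_tdata OM Vx.
apply: sum7B.
- exact: (ipBl mO L1 N1 K1).
- exact: (ipvBl mO L2' N2 K2).
- exact: (ipvBl mO L3 N3 K3).
- exact: (ipBl mO L4 N4 K4).
- exact: (ipBl mO L5 N5 K5).
- exact: (ipvBl mO L6 N6 K6).
- exact: (ipBl mO L7 N7 K7).
Qed.

(** On each element the residual is the product with its local representer [r], and [0 <= |r + x|^2]
    bounds twice its negative by [|r|^2 + |x|^2]. Summation over the elements loses no constant. *)
Lemma residual_bound f uu x : L2 Om f -> U_space Om uu -> V_space Om M x ->
  2 * (b uu x - L f x) <= ipV eps Om M x x +
    \sum_i (let r := riesz_inv eps (T i) (fun y => L f (ext0 (T i) y) - b uu (ext0 (T i) y)) in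
            ipV_loc eps (T i) r r).
Proof.
move=> Lf Uu Vx; have Ld := dsub_L2 (Ldata_L2 Lf) (bdata_L2 Uu).
set r := fun i => riesz_inv eps (T i) (fun y => L f (ext0 (T i) y) - b uu (ext0 (T i) y)).
have rP i : V_loc (T i) (r i) /\ forall y, V_loc (T i) y -> ipV_loc eps (T i) (r i) y =
    dL i (dsub (Ldata f) (bdata uu)) y.
  have dE y : V_loc (T i) y -> dL i (dsub (Ldata f) (bdata uu)) y =
      L f (ext0 (T i) y) - b uu (ext0 (T i) y).
    move=> Vy; have Ve := V_space_ext0 OM Vy.
    rewrite -(dform_ext0 OM Ld Vy) (dform_sub (Ldata_L2 Lf) (bdata_L2 Uu) Ve).
    by rewrite (L_form_dform Lf Ve) (b_form_dform Uu Ve).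
  have [|Vr rE] := getPex (P := [set r : test | V_loc (T i) r /\
    forall y, V_loc (T i) y -> ipV_loc eps (T i) r y = L f (ext0 (T i) y) - b uu (ext0 (T i) y)]).
    have [t [Vt tP]] := ipV_loc_riesz (@oT i) eps0 (L2_data_elt OM i Ld).
    by exists t; split => // y Vy; rewrite tP// dE.
  by split => // y Vy; rewrite dE//; exact: rE.
rewrite (L_form_dform Lf Vx) (b_form_dform Uu Vx) -opprB.
rewrite -(dform_sub (Ldata_L2 Lf) (bdata_L2 Uu) Vx) (dform_mesh OM Ld Vx).
rewrite (ipV_mesh OM eps Vx Vx) -big_split -sumrN mulr_sumr; apply: ler_sum => i _.
have [Vr rE] := rP i; have Vxi := V_space_loc i Vx.
rewrite -rE// -/(r i) /=.
have := ipV_loc_quad OM 1 eps0 Vr Vxi.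
set A := ipV_loc _ _ _ _; set B := ipV_loc _ _ _ _; set C := ipV_loc _ _ _ _.
by clearbody A B C; lra.
Qed.

Lemma ipV_ge0 x : V_space Om M x -> 0 <= ipV eps Om M x x.
Proof.
move=> Vx; have := ipV_quad OM 0 eps0 Vx Vx.
by rewrite mulr0 mul0r expr0n mul0r !addr0.
Qed.

(** Cauchy-Schwarz gives the upper bound, which is attained at [t / |t|]. If [|t| = 0], the
    admissible test [0 *: t] gives the lower bound. *)
Lemma dual_norm_riesz t (l : test -> R) : V_space Om M t ->
  (forall x, V_space Om M x -> ipV eps Om M t x = l x) ->
  dual_norm_V eps Om M l = Num.sqrt (ipV eps Om M t t).
Proof.
move=> Vt tP; have t0 := ipV_ge0 Vt.
rewrite /dual_norm_V; set S := (X in sup X).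
have ubS : ubound S (Num.sqrt (ipV eps Om M t t)).
  move=> _ [x [Vx x1] <-]; rewrite -tP//.
  have x0 := ipV_ge0 Vx.
  have CS : ipV eps Om M t x ^+ 2 <= ipV eps Om M t t * ipV eps Om M x x.
    by apply: discr_le => s; exact: ipV_quad.
  rewrite -sqrtr_sqr ler_wsqrtr//; apply: le_trans CS _.
  by rewrite ler_piMr// -[leLHS]sqr_sqrtr// expr_le1// sqrtr_ge0.
have S0 : S !=set0.
  exists `|l (0 *: t)|, (0 *: t) => //; split; first exact: V_spaceZ.
  by rewrite (ipVZr OM eps 0 (V_spaceZ OM 0 Vt) Vt) mul0r sqrtr0.
apply/le_anti/andP; split; first exact: ge_sup.
have [D0|D0] := eqVneq (ipV eps Om M t t) 0.
  rewrite D0 sqrtr0; apply: le_trans (normr_ge0 (l (0 *: t))) _.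
  apply: ub_le_sup; first by exists (Num.sqrt (ipV eps Om M t t)).
  exists (0 *: t) => //; split; first exact: V_spaceZ.
  by rewrite (ipVZr OM eps 0 (V_spaceZ OM 0 Vt) Vt) mul0r sqrtr0.
have Dp : 0 < ipV eps Om M t t by rewrite lt_neqAle eq_sym D0.
set s := Num.sqrt (ipV eps Om M t t).
have s0 : 0 < s by rewrite sqrtr_gt0.
have sE : ipV eps Om M t t = s ^+ 2 by rewrite sqr_sqrtr.
apply: ub_le_sup; first by exists (Num.sqrt (ipV eps Om M t t)).
exists (s^-1 *: t); last first.
  rewrite -tP; last exact: V_spaceZ.
  rewrite (ipVZr OM eps s^-1 Vt Vt) sE expr2 mulKf ?gt_eqF// gtr0_norm//.
split; first exact: V_spaceZ.
rewrite (ipVZr OM eps s^-1 (V_spaceZ OM s^-1 Vt) Vt) ipV_sym (ipVZr OM eps s^-1 Vt Vt).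
by rewrite sE expr2 mulKf ?gt_eqF// mulVf ?gt_eqF// sqrtr1.
Qed.

End dpg.

(** * Strong form of the representer *)

Section divergence_from_duality.
Variables (R : realType) (n : nat) (D : set 'rV[R]_n.+1).
Hypothesis oD : open D.
Local Notation E := 'rV[R]_n.+1.

(** The right-hand side vanishes on test functions, which identifies [h] as the divergence of [q];
    the identity then compares two normal traces. *)
Lemma is_wdiv_of_duality (q s : E -> E) h : L2v D q -> L2 D h -> Hdiv D s ->
  (forall v, H1 D v -> ipv D q (wgrad D v) + ip D h v = duality D s v) ->
  is_wdiv D q h /\ forall v, H1 D v -> duality D q v = duality D s v.
Proof.
move=> Lq Lh Hs H.
have qh : is_wdiv D q h.
  split => // phi T; have Hp := test_H10 oD T.
  have := H _ (H10_H1 Hp); rewrite (duality_H10 oD Hs Hp).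
  have -> : ipv D q (wgrad D phi) = ipv D q (grad phi).
    by rewrite ipvC (ipv_wgrad oD (H10_H1 Hp) (test_is_wgrad oD T) Lq) ipvC.
  by move/eqP; rewrite addr_eq0 => /eqP.
have Hq : Hdiv D q by split; [exact: Lq|exists h].
split; first exact: qh.
move=> v Hv; exact: etrans (dualityE oD Hq qh Hv (wgradP Hv)) (H _ Hv).
Qed.

End divergence_from_duality.

(** * Gluing traces across elements *)

Section gluing.
Variables (R : realType) (n : nat) (Om : set 'rV[R]_n.+1) (M : mesh R n).
Local Notation E := 'rV[R]_n.+1.
Hypothesis OM : mesh_on Om M.
Local Notation T i := (@elt _ _ M i).
Let oO : open Om. Proof. exact: mesh_open OM. Qed.
Let oT i : open (T i). Proof. exact: (@mesh_elt_open _ _ _ _ OM i). Qed.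
Let mO : measurable Om. Proof. exact: (open_measurable_rV oO). Qed.
Let TO i : T i `<=` Om. Proof. exact: (@mesh_elt_sub _ _ _ _ OM i). Qed.

Lemma test_elt_eq0 (phi : E -> R) i j x : test_function (T j) phi -> i != j -> T i x -> phi x = 0.
Proof.
have [_ _ cM] := OM.
move=> Tp ij Tx; apply: (test_out Tp) => Tjx.
by have : (T i `&` T j) x by []; rewrite (elt_disj cM ij).
Qed.

(** Test functions of the elements are test functions of [Om], so approximations on the elements add
    up to one on [Om]. That [a] is a weak gradient on [Om] follows from the pairing of [c] with the
    fields [psi e_j], which vanishes on each element. *)
Lemma glue_H10 c (a : E -> E) : L2 Om c -> L2v Om a ->
  (forall i, is_wgrad (T i) c a /\ H10 (T i) c) -> is_wgrad Om c a /\ H10 Om c.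
Proof.
move=> Lc La H.
have ca : is_wgrad Om c a.
  split => // psi Tp j.
  have Lp := test_L2 mO Tp; have Lpj := test_L2 mO (test_pder j Tp).
  rewrite (ipE OM Lc Lpj) (ipE OM (La j) Lp) -sumrN; apply: eq_bigr => i _.
  have [wa Hc] := H i; have Hq := test_Hdiv (@oT i) j Tp.
  have := duality_H10 (@oT i) Hq Hc.
  rewrite (dualityE (@oT i) Hq (test_is_wdiv (@oT i) j Tp) (H10_H1 Hc) wa).
  rewrite addrC (ipC _ _ c) => /eqP; rewrite addr_eq0 => /eqP ->; congr (- _).
  rewrite ipC; apply: eq_Rintegral => x _; rewrite /dot (bigD1 j)//= big1 ?addr0.
    by rewrite !mxE !eqxx mulr1.
  by move=> k kj; rewrite !mxE (negbTE kj) andbF !(mulr0, mul0r).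
split => //; apply: (H10_closure oO Lc ca) => e e0.
(* The successor avoids a division by zero for a mesh without elements. *)
have m0 : 0 < (ntri M).+1%:R :> R by rewrite ltr0n.
have /choice[phi phiP] : forall i, exists phi, test_function (T i) phi /\
    h1sq (T i) (fun x => c x - phi x) (fun x => a x - grad phi x) < e / (ntri M).+1%:R.
  move=> i; have [wa Hc] := H i.
  have [phi Tp he] := (H10P (@oT i) (L2_elt OM i Lc) wa).1 Hc _ (divr_gt0 e0 m0).
  by exists phi.
have Tp i : test_function (T i) (phi i) by case: (phiP i).
pose v x := \sum_i phi i x; pose p x := \sum_i grad (phi i) x.
have vi i x : T i x -> v x = phi i x.
  move=> Tx; rewrite /v (bigD1 i)//= big1 ?addr0// => j ji.
  by apply: (test_elt_eq0 (Tp j) _ Tx); rewrite eq_sym.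
have pi i x : T i x -> p x = grad (phi i) x.
  move=> Tx; rewrite /p (bigD1 i)//= big1 ?addr0// => j ji.
  apply/rowP => k; rewrite !mxE.
  by apply: (test_elt_eq0 (test_pder k (Tp j)) _ Tx); rewrite eq_sym.
have [Hv vp] : H10 Om v /\ is_wgrad Om v p.
  rewrite /v /p; elim: (index_enum _) => [|i s [IH1 IH2]].
    split.
      by apply: H10_eq (test_H10 oO (test_function_0 Om)) => x _; rewrite big_nil.
    by apply: is_wgrad_eq (is_wgrad0 Om) => x _; rewrite big_nil.
  have TO' := test_functionS (@TO i) (Tp i).
  have Hi := test_H10 oO TO'.
  split.
    apply: H10_eq (H10_lin oO 1 Hi IH1) => x _.
    by rewrite big_cons mul1r.
  apply: is_wgrad_eq (is_wgrad_lin oO 1 (test_L2 mO TO') (H1_L2 (H10_H1 IH1)) (test_is_wgrad oO TO') IH2) => x _.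
    by rewrite big_cons mul1r.
  by rewrite big_cons scale1r.
exists v, p; split => //.
have Lv := L2_B mO Lc (H1_L2 (H10_H1 Hv)); have Lp := L2v_B mO La vp.1.
rewrite /h1sq (ipE OM Lv Lv) (ipvE_mesh OM Lp Lp) -big_split/=.
apply: (@le_trans _ _ (\sum_(i < ntri M) e / (ntri M).+1%:R)).
  apply: ler_sum => i _; have [_ /ltW] := phiP i.
  rewrite /h1sq; apply: le_trans; rewrite le_eqVlt; apply/orP; left; apply/eqP.
  congr (_ + _); first by apply: ip_eq => x Tx; rewrite (vi i x Tx).
  by apply: ipv_eq => x Tx; rewrite (pi i x Tx).
rewrite sumr_const card_ord -[leLHS]mulr_natr mulrAC ler_pdivrMr// ler_wpM2l ?(ltW e0)//.
by rewrite ler_nat.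
Qed.

Lemma skeleton_duality q w : Hdiv Om q -> H1 Om w -> skeleton M q w = duality Om q w.
Proof.
move=> Hq Hw; rewrite /duality (ipvE_mesh OM (Hdiv_L2v Hq) (wgrad_L2v Hw)).
rewrite (ipE OM (wdiv_L2 Hq) (H1_L2 Hw)) -big_split; apply: eq_bigr => i _ /=.
congr (_ + _); last first.
  exact: (ip_wdiv_sub oO (@oT i) (@TO i) Hq (L2_elt OM i (H1_L2 Hw))).
rewrite ipvC [RHS]ipvC.
exact: (ipv_wgrad_sub oO (@oT i) (@TO i) Hw (L2v_elt OM i (Hdiv_L2v Hq))).
Qed.

(** Summed over the elements, the local identities give the same identity on [Om], so
    [is_wdiv_of_duality] applies both locally and globally. *)
Lemma glue_Hdiv (q s : E -> E) h : L2v Om q -> L2 Om h -> Hdiv Om s ->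
  (forall i v, H1 (T i) v -> ipv (T i) q (wgrad (T i) v) + ip (T i) h v = duality (T i) s v) ->
  [/\ is_wdiv Om q h, same_ntrace M q s & forall v, H1 Om v -> duality Om q v = duality Om s v].
Proof.
move=> Lq Lh Hs H.
have loc i := is_wdiv_of_duality (@oT i) (L2v_elt OM i Lq) (L2_elt OM i Lh) (Hdiv_elt OM i Hs) (@H i).
have [qh dq] : is_wdiv Om q h /\ forall v, H1 Om v -> duality Om q v = duality Om s v.
  apply: (is_wdiv_of_duality oO Lq Lh Hs) => v Hv.
  rewrite -(skeleton_duality Hs Hv) (ipvE_mesh OM Lq (wgrad_L2v Hv)).
  rewrite (ipE OM Lh (H1_L2 Hv)) -big_split; apply: eq_bigr => i _ /=.
  rewrite -(H i v (H1_elt OM i Hv)); congr (_ + _).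
  rewrite ipvC [RHS]ipvC.
  by rewrite (ipv_wgrad_sub oO (@oT i) (@TO i) Hv (L2v_elt OM i Lq)).
split; [exact: qh| |exact: dq].
by move=> i v Hv; have [_ H'] := loc i; exact: H'.
Qed.

End gluing.

(** Every exponent of [eps] in the problem is a multiple of 1/4; as powers of [e] they are integral,
    which [ring] and [field] can handle. *)
Lemma powR4E (R : realType) (e : R) : 0 < e ->
  [/\ (e ^+ 4) `^ (1 / 4) = e, (e ^+ 4) `^ (1 / 2) = e ^+ 2, (e ^+ 4) `^ (3 / 4) = e ^+ 3 &
      (e ^+ 4) `^ (5 / 4) = e ^+ 5] /\
  [/\ (e ^+ 4) `^ (3 / 2) = e ^+ 6, (e ^+ 4) `^ (5 / 2) = e ^+ 10,
      (e ^+ 4) `^ (- (1 / 4)) = e^-1 & (e ^+ 4) `^ (- (1 / 2)) = e ^- 2].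
Proof.
move=> e0; have P (k : nat) : (e ^+ 4) `^ (k%:R / 4) = e ^+ k.
  rewrite -powR_mulrn ?(ltW e0)// -powRrM -powR_mulrn ?(ltW e0)//; congr (_ `^ _).
  by field.
have h1 : 1 / 2 = 2%:R / 4 :> R by field.
have h2 : 3 / 2 = 6%:R / 4 :> R by field.
have h3 : 5 / 2 = 10%:R / 4 :> R by field.
split; split.
- by rewrite (P 1%N) expr1.
- by rewrite h1 (P 2%N).
- exact: (P 3%N).
- exact: (P 5%N).
- by rewrite h2 (P 6%N).
- by rewrite h3 (P 10%N).
- by rewrite powRN (P 1%N) expr1.
- by rewrite powRN h1 (P 2%N).
Qed.

Lemma flux_arith (R : comRingType) (A B r1 r2 s1 s2 l1 l2 k1 k2 d dv : R) :
  l1 + l2 = k1 + k2 -> k1 = r1 - r2 -> k2 = s1 - s2 -> A = s1 - l2 -> B = r1 - l1 ->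
  d = s2 + dv -> dv = r2 -> A + B = d.
Proof.
move=> h k1E k2E -> -> -> ->.
have -> : s1 - l2 + (r1 - l1) = s1 + r1 - (l1 + l2) by ring.
by rewrite h k1E k2E; ring.
Qed.

Lemma trace_form_arith (R : comRingType) (A B l1 l2 k1 k2 : R) :
  l1 + l2 = k1 + k2 -> A = k1 - l1 -> B = k2 - l2 -> A + B = 0.
Proof.
move=> h -> ->; have -> : k1 - l1 + (k2 - l2) = (k1 + k2) - (l1 + l2) by ring.
by rewrite h subrr.
Qed.

Lemma laplacian_form_arith (R : comRingType) (A B C l1 l2 l3 k1 k2 k3 : R) :
  l1 + l2 + l3 = k1 + k2 + k3 -> A = k1 - l1 -> B = k2 - l2 -> C = k3 - l3 ->
  A + B + C = 0.
Proof.
move=> h -> -> ->.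
have -> : k1 - l1 + (k2 - l2) + (k3 - l3) = (k1 + k2 + k3) - (l1 + l2 + l3) by ring.
by rewrite h subrr.
Qed.

Lemma normal_trace_arith (R : comRingType) (A B a h g p s d dd u : R) :
  h + g - p = 0 -> A = a * (g - p) + s -> B = a * h + d -> u = s + dd -> dd = d -> A + B = u.
Proof.
move=> e -> -> -> ->.
have -> : a * (g - p) + s + (a * h + d) = a * (h + g - p) + (s + d) by ring.
by rewrite e mulr0 add0r.
Qed.

(** * The element equations *)

Section strong_form.
Variables (R : realType) (n : nat) (Om : set 'rV[R]_n.+1) (M : mesh R n) (eps e : R).
Local Notation E := 'rV[R]_n.+1.
Hypothesis OM : mesh_on Om M.
Hypothesis e0 : 0 < e.
Hypothesis epsE : eps = e ^+ 4.
Local Notation T i := (@elt _ _ M i).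
Let oO : open Om. Proof. exact: mesh_open OM. Qed.
Let oT i : open (T i). Proof. exact: (@mesh_elt_open _ _ _ _ OM i). Qed.
Let mT i : measurable (T i). Proof. exact: (open_measurable_rV (@oT i)). Qed.
Let mO : measurable Om. Proof. exact: (open_measurable_rV oO). Qed.
Let TO i : T i `<=` Om. Proof. exact: (@mesh_elt_sub _ _ _ _ OM i). Qed.
Local Notation dL i := (dform (T i) (wgrad (T i)) (wdiv (T i))).
Local Notation b := (b_form eps Om M).

Variable uu : trial R n.
Hypothesis Uu : U_space Om uu.
Variables (m : E -> R) (p : E -> E) (v : E -> R).
Hypothesis Vt : V_space Om M (m, p, v).
Hypothesis tP : forall x, V_space Om M x -> ipV eps Om M (m, p, v) x = b uu x.
Local Notation gm := (pgrad M m).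
Local Notation dp := (pdiv M p).
Local Notation gv := (pgrad M v).
Local Notation lv := (pdiv M (pgrad M v)).

Lemma representer_L2 : [/\ L2 Om m, L2v Om gm, L2v Om p & L2 Om dp] /\
  [/\ L2 Om v, L2v Om gv & L2 Om lv].
Proof. exact: (V_space_tdata OM Vt). Qed.

(** Extension by zero turns the global equation for the representer into one equation per element,
    in which the three test components can be varied separately. *)
Lemma representer_loc i y : V_loc (T i) y ->
  dL i (rdata eps (pgrad M) (pdiv M) (m, p, v)) y = dL i (bdata Om eps uu) y.
Proof.
move=> Vy; rewrite (rdata_loc OM eps (V_space_loc i Vt) Vy).
rewrite -(ipV_ext0 OM eps Vt Vy) (tP (V_space_ext0 OM Vy)).
rewrite (b_form_dform eps OM Uu (V_space_ext0 OM Vy)).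
exact: (dform_ext0 OM (bdata_L2 eps OM Uu) Vy).
Qed.

Let Lr i : L2_data (T i) (rdata eps (pgrad M) (pdiv M) (m, p, v)).
Proof. exact: (L2_data_elt OM i (rdata_data OM eps Vt)). Qed.

Let Lb i : L2_data (T i) (bdata Om eps uu).
Proof. exact: (L2_data_elt OM i (bdata_L2 eps OM Uu)). Qed.

(** Tests of the form (w, 0, 0): the local equation says that [q], paired with its would-be
    divergence, acts on [w] like [tsa uu]. *)
Lemma representer_flux : let q := fun x => tsigma uu x - gm x in
  [/\ is_wdiv Om q (fun x => trho uu x - eps^-1 * m x), same_ntrace M q (tsa uu)
    & forall w, H1 Om w -> duality Om q w = duality Om (tsa uu) w].
Proof.
move=> q; have [[Lu Ls Lrho] [Ha Hb Hsa Hsb _]] := Uu.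
have [[Lm Lgm Lp Ldp] [Lv Lgv Llv]] := representer_L2.
have Lem := L2_Z mO eps^-1 Lm.
apply: (glue_Hdiv OM (L2v_B mO Ls Lgm) (L2_B mO Lrho Lem) Hsa) => i w Hw.
have Vy : V_loc (T i) (w, (fun=> 0), (fun=> 0)).
  by split; [exact: Hw|exact: (Hdiv_0 (@oT i))|exact: (H1Delta0 (@oT i))].
have := representer_loc Vy.
rewrite (dform_loc_mu (@oT i) w (Lr i)) (dform_loc_mu (@oT i) w (Lb i)) => h.
have [Kw Kg] := (H1_L2 Hw, wgrad_L2v Hw).
apply: (flux_arith h).
- exact: (ipBl (mT i) (L2_elt OM i Lrho) (L2_elt OM i (wdiv_L2 Hsa)) Kw).
- exact: (ipvBl (mT i) (L2v_elt OM i Ls) (L2v_elt OM i (Hdiv_L2v Hsa)) Kg).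
- exact: (ipvBl (mT i) (L2v_elt OM i Ls) (L2v_elt OM i Lgm) Kg).
- exact: (ipBl (mT i) (L2_elt OM i Lrho) (L2_elt OM i Lem) Kw).
- by [].
- exact: (ip_wdiv_sub oO (@oT i) (@TO i) Hsa Kw).
Qed.

(** Tests of the form (0, tau, 0): the differences [a] and [c'] of the coefficients annihilate all
    of H(div), as [zero_trace_of_duality] requires. *)
Lemma representer_trace : let c := fun x => (tu uu x - dp x) - tua uu x in
  [/\ forall i, H10 (T i) c, H10 Om c
    & is_wgrad Om (fun x => tu uu x - dp x)
       (fun x => eps `^ (- (1 / 4)) *: tsigma uu x - eps `^ (- (1 / 2)) *: p x)].
Proof.
move=> c; have [[Lu Ls Lrho] [Ha Hb Hsa Hsb _]] := Uu.
have [[Lm Lgm Lp Ldp] [Lv Lgv Llv]] := representer_L2.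
have [La Lga] := (H1_L2 Ha, wgrad_L2v Ha).
set c1 := eps `^ (- (1 / 4)); set c2 := eps `^ (- (1 / 2)).
pose a x := (c1 *: tsigma uu x - wgrad Om (tua uu) x) - c2 *: p x.
have Ls1 := L2v_Z mO c1 Ls; have Lp1 := L2v_Z mO c2 Lp.
have LG := L2v_B mO Ls1 Lga.
pose c' x := (tu uu x - tua uu x) - dp x.
have Lc : L2 Om c' by exact: (L2_B mO (L2_B mO Lu La) Ldp).
have La' : L2v Om a by exact: (L2v_B mO LG Lp1).
have loc i : is_wgrad (T i) c' a /\ H10 (T i) c'.
  apply: (zero_trace_of_duality (@oT i) (L2_elt OM i Lc) (L2v_elt OM i La')) => tau Ht.
  have Vy : V_loc (T i) ((fun=> 0), tau, (fun=> 0)).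
    by split; [exact: (H1_0 (T i))|exact: Ht|exact: (H1Delta0 (@oT i))].
  have := representer_loc Vy.
  rewrite (dform_loc_tau (@oT i) tau (Lr i)) (dform_loc_tau (@oT i) tau (Lb i)) => h.
  have [Kt Kd] := (Hdiv_L2v Ht, wdiv_L2 Ht).
  apply: (trace_form_arith h).
  - exact: (ipvBl (mT i) (L2v_elt OM i LG) (L2v_elt OM i Lp1) Kt).
  - exact: (ipBl (mT i) (L2_elt OM i (L2_B mO Lu La)) (L2_elt OM i Ldp) Kd).
have [ca Hc] := glue_H10 OM Lc La' loc.
have cE x : c' x = c x by rewrite /c' /c addrAC.
split.
- by move=> i; apply: H10_eq (loc i).2 => x _; exact: cE.
- by apply: H10_eq Hc => x _; exact: cE.
have := is_wgrad_lin oO 1 Lc La ca (wgradP Ha).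
apply: is_wgrad_eq => x _.
  by rewrite mul1r cE /c subrK.
by rewrite scale1r /a addrAC subrK.
Qed.

(** Tests of the form (0, 0, w). From them [zero_trace_of_laplacian] extracts two facts:
    [g = e^2 (X - ub)] has zero trace, and [G - grad g = e^3 (Q - sb)] has zero normal trace. *)
Lemma representer_laplacian : let X := fun x => e ^+ 3 * trho uu x - e ^+ 4 * lv x in
  exists gX, [/\ is_wgrad Om X gX, forall i, H10 (T i) (fun x => X x - tub uu x),
     H10 Om (fun x => X x - tub uu x) &
    let Q := fun x => e ^- 3 *: ((e ^+ 3 + e) *: tsigma uu x - e ^+ 2 *: gX x
        - (e ^+ 2 + e ^+ 4) *: gv x) in
    [/\ L2v Om Q, is_wdiv Om Q (fun x => e ^- 3 * (tu uu x - v x)) & same_ntrace M Q (tsb uu)]].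
Proof.
move=> X; have [[Lu Ls Lrho] [Ha Hb Hsa Hsb _]] := Uu.
have [[Lm Lgm Lp Ldp] [Lv Lgv Llv]] := representer_L2.
have [Lub Lgb] := (H1_L2 Hb, wgrad_L2v Hb).
have [[p1 p2 p3 p5] [p6 p10 pm1 pm2]] := powR4E e0.
have en0 : e != 0 by rewrite gt_eqF.
have [_ [/= B5 B6 B7]] := bdata_L2 eps OM Uu.
have [_ [/= R5 R6 R7]] := rdata_data OM eps Vt.
(* The coefficients of [b(uu, .)] minus those of the representer, against a test function, its
   gradient and its Laplacian. *)
pose h x := (tu uu x - eps `^ (3 / 4) * wdiv Om (tsb uu) x) - v x.
pose G x := ((eps `^ (3 / 4) + eps `^ (1 / 4)) *: tsigma uu x
       - eps `^ (3 / 4) *: tsb uu x - eps `^ (1 / 2) *: wgrad Om (tub uu) x)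
       - (eps `^ (1 / 2) + eps) *: gv x.
pose g x := (eps `^ (5 / 4) * trho uu x - eps `^ (1 / 2) * tub uu x)
       - eps `^ (3 / 2) * lv x.
have Lh : L2 Om h by exact: (L2_B mO B5 R5).
have LG : L2v Om G by exact: (L2v_B mO B6 R6).
have Lg : L2 Om g by exact: (L2_B mO B7 R7).
have loc i : H10 (T i) g /\ forall w, H1 (T i) w ->
     ip (T i) h w + ipv (T i) G (wgrad (T i) w) - ipv (T i) (wgrad (T i) g) (wgrad (T i) w) = 0.
  apply: (zero_trace_of_laplacian (@oT i) (L2_elt OM i Lh) (L2v_elt OM i LG) (L2_elt OM i Lg)) => w Hw.
  have Vy : V_loc (T i) ((fun=> 0), (fun=> 0), w).
    by split; [exact: (H1_0 (T i))|exact: (Hdiv_0 (@oT i))|exact: Hw].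
  have := representer_loc Vy.
  rewrite (dform_loc_v (@oT i) w (Lr i)) (dform_loc_v (@oT i) w (Lb i)) => hh.
  have [Hw1 Hw2] := Hw.
  apply: (laplacian_form_arith hh).
  - exact: (ipBl (mT i) (L2_elt OM i B5) (L2_elt OM i R5) (H1_L2 Hw1)).
  - exact: (ipvBl (mT i) (L2v_elt OM i B6) (L2v_elt OM i R6) (wgrad_L2v Hw1)).
  - exact: (ipBl (mT i) (L2_elt OM i B7) (L2_elt OM i R7) (wdiv_L2 Hw2)).
have Hgi i : H1 (T i) g by exact: H10_H1 (loc i).1.
have Lpg : L2v Om (pgrad M g) by exact: (pgrad_L2v OM Hgi).
have [gP Hg] : is_wgrad Om g (pgrad M g) /\ H10 Om g.
  apply: (glue_H10 OM Lg Lpg) => i; split; last exact: (loc i).1.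
  by apply: is_wgrad_eq (wgradP (Hgi i)) => // x Tx; rewrite (pgradE OM _ Tx).
pose gX x := e ^- 2 *: pgrad M g x + wgrad Om (tub uu) x.
have XE x : e ^- 2 * g x = X x - tub uu x.
  by rewrite /g /X epsE p5 p2 p6; field.
have H0 (D : set E) : open D -> H10 D (fun=> 0).
  by move=> oD; exact: (test_H10 oD (test_function_0 D)).
exists gX; split.
- have := is_wgrad_lin oO (e ^- 2) Lg Lub gP (wgradP Hb).
  by apply: is_wgrad_eq => // x _; rewrite XE subrK.
- move=> i; have Hl := H10_lin (@oT i) (e ^- 2) (loc i).1 (H0 _ (@oT i)).
  apply: (H10_eq _ Hl) => x _.
  by rewrite addr0 XE.
- have Hl := H10_lin oO (e ^- 2) Hg (H0 _ oO).
  apply: (H10_eq _ Hl) => x _.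
  by rewrite addr0 XE.
pose Q x := e ^- 3 *: ((e ^+ 3 + e) *: tsigma uu x - e ^+ 2 *: gX x
        - (e ^+ 2 + e ^+ 4) *: gv x).
rewrite -/Q.
have QE x : Q x = e ^- 3 *: (G x - pgrad M g x) + tsb uu x.
  rewrite /Q /G /gX epsE p3 p1 p2; apply/rowP => j; rewrite !mxE.
  by field.
have hE x : e ^- 3 * (tu uu x - v x) = e ^- 3 * h x + wdiv Om (tsb uu) x.
  by rewrite /h epsE p3; field.
have LGg := L2v_Z mO (e ^- 3) (L2v_B mO LG Lpg).
have LQ : L2v Om Q.
  by apply: L2v_eq (L2v_D mO LGg (Hdiv_L2v Hsb)) => x _; rewrite QE.
have Lh' : L2 Om (fun x => e ^- 3 * (tu uu x - v x)).
  exact: (L2_Z mO (e ^- 3) (L2_B mO Lu Lv)).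
have [] := @glue_Hdiv _ _ _ _ OM Q _ _ LQ Lh' Hsb; last by move=> k1 k2 _; split.
move=> i w Hw; have [Kw Kg] := (H1_L2 Hw, wgrad_L2v Hw).
apply: (normal_trace_arith (a := e ^- 3) ((loc i).2 w Hw)).
- apply: etrans (ipv_eq (D := T i) (fun x _ => QE x) (fun x _ => erefl)) _.
  rewrite (ipvDl (mT i) (L2v_elt OM i LGg) (L2v_elt OM i (Hdiv_L2v Hsb)) Kg); congr (_ + _).
  rewrite (ipvZl (mT i) _ (L2v_elt OM i (L2v_B mO LG Lpg)) Kg); congr (_ * _).
  rewrite (ipvBl (mT i) (L2v_elt OM i LG) (L2v_elt OM i Lpg) Kg); congr (_ - _).
  by apply: ipv_eq => // x Tx; rewrite (pgradE OM _ Tx).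
- apply: etrans (ip_eq (D := T i) (fun x _ => hE x) (fun x _ => erefl)) _.
  rewrite (ipDl (mT i) (L2_elt OM i (L2_Z mO _ Lh)) (L2_elt OM i (wdiv_L2 Hsb)) Kw); congr (_ + _).
  exact: (ipZl (mT i) _ (L2_elt OM i Lh) Kw).
- by [].
- exact: (ip_wdiv_sub oO (@oT i) (@TO i) Hsb Kw).
Qed.

End strong_form.

(** * Estimates *)

Lemma convex_ge0 (R : realFieldType) (t x y : R) : 0 <= t -> t <= 1 -> 0 <= x -> 0 <= y ->
  0 <= (1 - t) * x + t * y.
Proof. by move=> t0 t1 x0 y0; rewrite addr_ge0// mulr_ge0// subr_ge0. Qed.

(* affine in t, hence it suffices to complete squares for t = 0 and t = 1 *)
Lemma vector_form_ge0 (R : realFieldType) (t a s M P T : R) : 0 <= t -> t <= 1 ->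
  0 <= (a - M) * s - 1 / 2 * ((s - a + P) * ((1 + t) * (a - T) - s))
    + M * M + P * P + (1 + t) * (T * T) - 1 / 20 * (a * a) - 1 / 20 * (s * s).
Proof.
move=> t0 t1.
have sq (c x : R) : 0 <= c -> 0 <= c * x ^+ 2 by move=> c0; rewrite mulr_ge0 ?sqr_ge0.
have := @convex_ge0 R t ((M - 1 / 2 * s) ^+ 2 + (P - 1 / 4 * a + 1 / 4 * T + 1 / 4 * s) ^+ 2
    + 15 / 16 * (T + 1 / 5 * s - 1 / 5 * a) ^+ 2 + 7 / 20 * (a + 2 / 7 * s) ^+ 2
    + 1 / 14 * s ^+ 2)
  ((M - 1 / 2 * s) ^+ 2 + (P - 1 / 2 * a + 1 / 2 * T + 1 / 4 * s) ^+ 2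
    + 7 / 4 * (T + 3 / 14 * s - 1 / 7 * a) ^+ 2 + 93 / 140 * (a - 10 / 93 * s) ^+ 2
    + 23 / 465 * s ^+ 2) t0 t1.
move=> H; apply: le_trans (H _ _) _.
- by rewrite !addr_ge0 ?sqr_ge0 ?sq//; lra.
- by rewrite !addr_ge0 ?sqr_ge0 ?sq//; lra.
- by rewrite le_eqVlt; apply/orP; left; apply/eqP; field.
Qed.

(** Again the form is affine in [t], with explicit sums of squares at both ends. Here [t] stands for
    [e], in the vector form for [e^2]. *)
Lemma scalar_form_ge0 (R : realFieldType) (t r u m p v z : R) : 0 <= t -> t <= 1 ->
  0 <= (r - m) * (r - z) - 1 / 2 * ((t * (r - z) - u + p) * (u - v))
    + m * m + p * p + v * v + z * z - 1 / 20 * (r * r) - 1 / 20 * (u * u).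
Proof.
move=> t0 t1.
have sq (c x : R) : 0 <= c -> 0 <= c * x ^+ 2 by move=> c0; rewrite mulr_ge0 ?sqr_ge0.
have := @convex_ge0 R t ((m - 1 / 2 * r + 1 / 2 * z) ^+ 2 + (p - 1 / 4 * u + 1 / 4 * v) ^+ 2
    + 15 / 16 * (v - 1 / 5 * u) ^+ 2 + 3 / 4 * (z - 1 / 3 * r) ^+ 2
    + 37 / 60 * r ^+ 2 + 7 / 20 * u ^+ 2)
  ((m - 1 / 2 * r + 1 / 2 * z) ^+ 2
    + 2 / 5 * (u - 5 / 8 * r + 5 / 8 * z - 5 / 8 * v - 5 / 8 * p) ^+ 2
    + 27 / 32 * (v + 1 / 9 * r - 1 / 9 * z + 1 / 9 * p) ^+ 2
    + 29 / 60 * (r - 5 / 29 * z - 10 / 29 * p) ^+ 2 + 33 / 58 * (z + 8 / 33 * p) ^+ 2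
    + 49 / 66 * p ^+ 2 + 1 / 20 * r ^+ 2 + 1 / 20 * u ^+ 2) t0 t1.
move=> H; apply: le_trans (H _ _) _.
- by rewrite !addr_ge0 ?sqr_ge0 ?sq//; lra.
- by rewrite !addr_ge0 ?sqr_ge0 ?sq//; lra.
- by rewrite le_eqVlt; apply/orP; left; apply/eqP; field.
Qed.

(** * Integrated quadratic forms *)

Section quadratic_forms.
Variables (R : realType) (n : nat) (D : set 'rV[R]_n.+1).
Local Notation E := 'rV[R]_n.+1.
Hypothesis mD : measurable D.
Implicit Types (f g : E -> R) (p q : E -> E).

(** A quadratic form is listed as coefficients and pairs of functions, so that a pointwise
    inequality is integrated in one step. *)
Fixpoint L2_terms (l : seq (R * (E -> R) * (E -> R))) : Prop :=
  if l is (_, f, g) :: l' then [/\ L2 D f, L2 D g & L2_terms l'] else True.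

Lemma ip_form (l : seq (R * (E -> R) * (E -> R))) : L2_terms l ->
  (leb R n.+1).-integrable D (EFin \o (fun x => \sum_(k <- l) k.1.1 * (k.1.2 x * k.2 x))) /\
  \int[leb R n.+1]_(x in D) (\sum_(k <- l) k.1.1 * (k.1.2 x * k.2 x))
  = \sum_(k <- l) k.1.1 * ip D k.1.2 k.2.
Proof.
elim: l => [_|[[c f] g] l IH /= [Lf Lg /IH[I1 I2]]].
  split; first by under eq_fun do rewrite big_nil; exact: integrable0.
  rewrite big_nil /Rintegral; under eq_integral do rewrite big_nil.
  by rewrite integral0.
have If := L2_integrable_mul mD Lf Lg.
have Ic : (leb R n.+1).-integrable D (EFin \o (fun x => c * (f x * g x))).
  rewrite (_ : EFin \o _ = (fun x => c%:E * (f x * g x)%:E)%E); last by apply/funext.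
  exact: (integrableZl mD c If).
split.
  rewrite (_ : EFin \o _ = ((EFin \o (fun x => (c * (f x * g x))%R)) \+
    (EFin \o (fun x => \sum_(k <- l) k.1.1 * (k.1.2 x * k.2 x))%R))%E).
    exact: (integrableD mD Ic I1).
  by apply/funext => x /=; rewrite big_cons EFinD.
rewrite big_cons -I2 /ip -RintegralZl// -RintegralD//.
by apply: eq_Rintegral => x _; rewrite big_cons.
Qed.

Lemma ip_form_ge0 (l : seq (R * (E -> R) * (E -> R))) : L2_terms l ->
  (forall x, 0 <= \sum_(k <- l) k.1.1 * (k.1.2 x * k.2 x)) ->
  0 <= \sum_(k <- l) k.1.1 * ip D k.1.2 k.2.
Proof. by move=> Ll H; have [_ <-] := ip_form Ll; exact: Rintegral_ge0. Qed.

Fixpoint L2v_terms (l : seq (R * (E -> E) * (E -> E))) : Prop :=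
  if l is (_, p, q) :: l' then [/\ L2v D p, L2v D q & L2v_terms l'] else True.

Lemma ipv_form_ge0 (l : seq (R * (E -> E) * (E -> E))) : L2v_terms l ->
  (forall x j, 0 <= \sum_(k <- l) k.1.1 * (k.1.2 x ord0 j * k.2 x ord0 j)) ->
  0 <= \sum_(k <- l) k.1.1 * ipv D k.1.2 k.2.
Proof.
move=> Ll H.
pose cmp j (k : R * (E -> E) * (E -> E)) : R * (E -> R) * (E -> R) :=
  (k.1.1, (fun x => k.1.2 x ord0 j), (fun x => k.2 x ord0 j)).
have Lc j : L2_terms (map (cmp j) l).
  by elim: l Ll {H} => // -[[c p] q] l IH [Lp Lq /IH] /=.
have -> : \sum_(k <- l) k.1.1 * ipv D k.1.2 k.2 =
    \sum_j \sum_(k <- map (cmp j) l) k.1.1 * ip D k.1.2 k.2.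
  under [RHS]eq_bigr do rewrite big_map.
  rewrite exchange_big/=; elim: l Ll {H Lc} => [|[[c p] q] l IH].
    by rewrite !big_nil.
  move=> [Lp Lq /IH e]; rewrite !big_cons e; congr (_ + _).
  by rewrite /= (ipvE mD Lp Lq) mulr_sumr.
apply: sumr_ge0 => j _; apply: ip_form_ge0; first exact: Lc.
by move=> x; rewrite big_map; exact: H.
Qed.

(** The purpose is to absorb powers of [e] into rescaled functions. *)
Lemma ip_rescale c f g f' g' : L2 D f -> L2 D g ->
  (forall x, c * (f x * g x) = f' x * g' x) -> c * ip D f g = ip D f' g'.
Proof.
move=> Lf Lg H; rewrite /ip -RintegralZl//; last exact: L2_integrable_mul.
by apply: eq_Rintegral => x _; exact: H.
Qed.

Lemma ipv_rescale c p q p' q' : L2v D p -> L2v D q ->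
  (forall x i, c * (p x ord0 i * q x ord0 i) = p' x ord0 i * q' x ord0 i) ->
  c * ipv D p q = ipv D p' q'.
Proof.
move=> Lp Lq H; rewrite /ipv -RintegralZl//; last first.
  have [|I1 _] := @ip_form (map (fun j => (1, (fun x => p x ord0 j), (fun x => q x ord0 j)))
    (index_enum 'I_n.+1)).
    by elim: (index_enum _) => //= j l IH; split.
  move: I1; congr (integrable _ _ _); apply/funext => x /=; congr (_%:E).
  by rewrite big_map; apply: eq_bigr => j _; rewrite mul1r.
apply: eq_Rintegral => x _; rewrite /dot mulr_sumr; apply: eq_bigr => i _; exact: H.
Qed.

Lemma ip_sub_le f g : L2 D f -> L2 D g ->
  ip D (fun x => f x - g x) (fun x => f x - g x) <= 2 * ip D f f + 2 * ip D g g.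
Proof.
move=> Lf Lg; have Lfg := L2_B mD Lf Lg.
have := @ip_form_ge0 [:: (2, f, f); (2, g, g); (-1, (fun x => f x - g x), (fun x => f x - g x))].
rewrite !big_cons big_nil /= => /(_ (And3 Lf Lf (And3 Lg Lg (And3 Lfg Lfg I)))) H.
lapply H => [{}H|x]; first by move: H; absip; lra.
rewrite !big_cons big_nil /=; have := sqr_ge0 (f x + g x); rewrite expr2; lra.
Qed.

Lemma ipv_sub_le p q : L2v D p -> L2v D q ->
  ipv D (fun x => p x - q x) (fun x => p x - q x) <= 2 * ipv D p p + 2 * ipv D q q.
Proof.
move=> Lp Lq; have Lpq := L2v_B mD Lp Lq.
have := @ipv_form_ge0 [:: (2, p, p); (2, q, q); (-1, (fun x => p x - q x), (fun x => p x - q x))].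
rewrite !big_cons big_nil /= => /(_ (And3 Lp Lp (And3 Lq Lq (And3 Lpq Lpq I)))) H.
lapply H => [{}H|x j]; first by move: H; absip; lra.
rewrite !big_cons big_nil /= !mxE.
have := sqr_ge0 (p x ord0 j + q x ord0 j); rewrite expr2; lra.
Qed.

(** In the application [t = e], [a] is sigma, [s] is [e grad X], [r] is [e^2 rho], and [M], [P],
    [T], [m], [p], [v], [z] are the rescaled components of the representer, whose weighted squares
    in the last line add up to [D^2]. The bracket with factor 1/2 vanishes there; without it [u]
    would not occur on the right at all. *)
Lemma coercive (t : R) (a s M P T : E -> E) (r u m p v z : E -> R) :
  0 <= t -> t <= 1 ->
  L2v D a -> L2v D s -> L2v D M -> L2v D P -> L2v D T ->
  L2 D r -> L2 D u -> L2 D m -> L2 D p -> L2 D v -> L2 D z ->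
  1 / 20 * (ipv D a a + ipv D s s + ip D r r + ip D u u) <=
  ipv D (fun x => a x - M x) s + ip D (fun x => r x - m x) (fun x => r x - z x)
  - 1 / 2 * (ipv D (fun x => s x - a x + P x) (fun x => (1 + t ^+ 2) *: (a x - T x) - s x)
    + ip D (fun x => t * (r x - z x) - u x + p x) (fun x => u x - v x))
  + (ip D m m + ipv D M M + ipv D P P + ip D p p + ip D v v + (1 + t ^+ 2) * ipv D T T
    + ip D z z).
Proof.
move=> t0 t1 La Ls LM LP LT Lr Lu Lm Lp Lv Lz.
have t20 : 0 <= t ^+ 2 by exact: sqr_ge0.
have t21 : t ^+ 2 <= 1 by rewrite expr_le1.
have LaM := L2v_B mD La LM.
have Lsa := L2v_D mD (L2v_B mD Ls La) LP.
have LaT := L2v_B mD (L2v_Z mD (1 + t ^+ 2) (L2v_B mD La LT)) Ls.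
have Lrm := L2_B mD Lr Lm; have Lrz := L2_B mD Lr Lz.
have Lt := L2_D mD (L2_B mD (L2_Z mD t Lrz) Lu) Lp; have Luv := L2_B mD Lu Lv.
have hv := @ipv_form_ge0 [:: (1, fun x => a x - M x, s);
  (- (1 / 2), fun x => s x - a x + P x, fun x => (1 + t ^+ 2) *: (a x - T x) - s x);
  (1, M, M); (1, P, P); (1 + t ^+ 2, T, T); (- (1 / 20), a, a); (- (1 / 20), s, s)].
have hs := @ip_form_ge0 [:: (1, fun x => r x - m x, fun x => r x - z x);
  (- (1 / 2), fun x => t * (r x - z x) - u x + p x, fun x => u x - v x);
  (1, m, m); (1, p, p); (1, v, v); (1, z, z); (- (1 / 20), r, r); (- (1 / 20), u, u)].
rewrite !big_cons !big_nil /= in hv hs.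
have {}hv := hv (And3 LaM Ls (And3 Lsa LaT (And3 LM LM (And3 LP LP (And3 LT LT
  (And3 La La (And3 Ls Ls I))))))).
have {}hs := hs (And3 Lrm Lrz (And3 Lt Luv (And3 Lm Lm (And3 Lp Lp (And3 Lv Lv
  (And3 Lz Lz (And3 Lr Lr (And3 Lu Lu I)))))))).
lapply hv => [{}hv|x j]; last first.
  rewrite !big_cons big_nil /= !mxE; have := @vector_form_ge0 R (t ^+ 2) (a x ord0 j) (s x ord0 j) (M x ord0 j)
    (P x ord0 j) (T x ord0 j) t20 t21; lra.
lapply hs => [{}hs|x]; last first.
  rewrite !big_cons big_nil /=; have := @scalar_form_ge0 R t (r x) (u x) (m x) (p x) (v x) (z x) t0 t1; lra.
by move: hv hs; absip; lra.
Qed.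

End quadratic_forms.

(** * Norms defined as infima *)

Section infima.
Variables (R : realType) (T : Type) (A : set T) (F : T -> R).

Lemma inf_sqrt_sqr_le w : A w -> 0 <= F w -> inf [set Num.sqrt (F x) | x in A] ^+ 2 <= F w.
Proof.
move=> Aw Fw; rewrite -[leRHS]sqr_sqrtr// ler_pXn2r ?nnegrE ?sqrtr_ge0//.
  apply: ge_inf; last by exists w.
  by exists 0 => _ [x _ <-]; exact: sqrtr_ge0.
apply: lb_le_inf; first by exists (Num.sqrt (F w)), w.
by move=> _ [x _ <-]; exact: sqrtr_ge0.
Qed.

Lemma inf_sqrt_sqr_ge K : A !=set0 -> (forall x, A x -> K <= F x) ->
  K <= inf [set Num.sqrt (F x) | x in A] ^+ 2.
Proof.
move=> [w Aw] H; have [K0|K0] := leP K 0; first exact: le_trans K0 (sqr_ge0 _).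
rewrite -[leLHS](sqr_sqrtr (ltW K0)).
have h : Num.sqrt K <= inf [set Num.sqrt (F x) | x in A].
  apply: lb_le_inf; first by exists (Num.sqrt (F w)), w.
  by move=> _ [x Ax <-]; rewrite ler_wsqrtr// H.
by rewrite ler_pXn2r ?nnegrE ?sqrtr_ge0// (le_trans _ h) ?sqrtr_ge0.
Qed.

End infima.

Section norms_of_representatives.
Variables (R : realType) (n : nat) (D : set 'rV[R]_n.+1).
Hypothesis oD : open D.
Local Notation E := 'rV[R]_n.+1.

Lemma ipv_wgrad_sqr w (q : E -> E) : H1 D w -> is_wgrad D w q ->
  ipv D (wgrad D w) (wgrad D w) = ipv D q q.
Proof.
move=> Hw wq; apply: etrans (ipv_wgrad oD Hw wq (wgrad_L2v Hw)) _.
by rewrite ipvC; exact: (ipv_wgrad oD Hw wq wq.1).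
Qed.

Lemma ip_wdiv_sqr (q : E -> E) h : Hdiv D q -> is_wdiv D q h ->
  ip D (wdiv D q) (wdiv D q) = ip D h h.
Proof.
move=> Hq qh; apply: etrans (ip_wdiv oD Hq qh (wdiv_L2 Hq)) _.
by rewrite ipC; exact: (ip_wdiv oD Hq qh qh.1).
Qed.

Lemma duality_same_trace (q : E -> E) w w' : Hdiv D q -> H1 D w -> H1 D w' ->
  H10 D (fun x => w x - w' x) -> duality D q w = duality D q w'.
Proof.
move=> Hq Hw Hw' H0; have e1 := duality_H10 oD Hq H0.
have e2 := duality_linr oD (-1) Hq Hw' Hw.
have e3 : duality D q (fun x => -1 * w' x + w x) = duality D q (fun x => w x - w' x).
  by apply: duality_eq => // x _; rewrite mulN1r addrC.
move: (etrans (esym e2) (etrans e3 e1)).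
set A := duality D q w; set B := duality D q w'; clearbody A B.
by rewrite mulN1r addrC => /eqP; rewrite subr_eq0 => /eqP.
Qed.

End norms_of_representatives.

Lemma mul_le1l (R : realDomainType) (c x : R) : 0 <= x -> c <= 1 -> c * x <= x.
Proof. by move=> x0 c1; rewrite -subr_ge0 -[X in X - _]mul1r -mulrBl mulr_ge0// subr_ge0. Qed.

(** Here [w] and [g] are the squared norms of an arbitrary extension of the trace and of its
    gradient, and [z = e^2], so that [w + z^2 g] is the weighted norm. Splitting [S] by Young's
    inequality with weight 40 returns at most [N / 40 + D / 40], half of the [N] on the left. What
    remains is [N <= 41 D + 800 (z g + w / z)]. *)
Lemma trace_arith (R : realFieldType) (z N D S S1 S2 Q H g w a c d f : R) :
  0 < z -> 1 / 20 * N <= S + D -> S = S1 + S2 -> 80 * S1 <= Q + 1600 * (z * g) ->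
  80 * S2 <= H + 1600 * (z^-1 * w) -> Q <= 2 * a + 2 * c -> H <= 2 * d + 2 * f ->
  a + d <= N -> c + f <= D -> z * (1 / 800 * (N - 41 * D)) <= w + z ^+ 2 * g.
Proof.
move=> z0 h1 h2 h3 h4 h5 h6 h7 h8.
have : 1 / 800 * (N - 41 * D) <= z * g + z^-1 * w by lra.
rewrite -(ler_pM2l z0) => /le_trans; apply; rewrite le_eqVlt; apply/orP; left; apply/eqP.
by field; rewrite gt_eqF.
Qed.

Lemma U1_arith (R : realFieldType) (e a s r u mh M P Pi v T1 T2 na nb nsa nsb
    w sP x q h y Y z Qn hq : R) :
  0 < e -> e <= 1 ->
  [/\ 0 <= a, 0 <= s, 0 <= r & 0 <= u] -> [/\ 0 <= mh, 0 <= M, 0 <= P & 0 <= Pi] ->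
  [/\ 0 <= v, 0 <= T1 & 0 <= T2] ->
  [/\ 0 <= w, 0 <= sP, 0 <= x & 0 <= q] -> [/\ 0 <= h, 0 <= y, 0 <= Y & 0 <= z] ->
  [/\ w <= 2 * u + 2 * Pi, sP <= 2 * a + 2 * P, x <= 2 * r + 2 * T2 & q <= 2 * a + 2 * M] ->
  [/\ h <= 2 * r + 2 * mh, y <= 2 * a + 2 * T1, Y <= 2 * ((1 + e ^+ 2) ^+ 2 * y) + 2 * s
    & z <= 2 * u + 2 * v] ->
  [/\ na <= w + sP, nb <= e ^+ 2 * x + s, nsa <= q + h & nsb <= Qn + e ^+ 4 * hq] ->
  e ^+ 4 * Qn = Y -> e ^+ 6 * hq = z ->
  u + a + r + e ^+ 6 * na + e ^+ 4 * nb + e ^+ 6 * nsa + e ^+ 10 * nsb <=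
  40 * ((a + s + r + u) + (mh + M + P + Pi + v + (1 + e ^+ 2) * T1 + T2)).
Proof.
move=> e0 e1 [a0 s0 r0 u0] [mh0 M0 P0 Pi0] [v0 T10 T20] [w0 sP0 x0 q0] [h0 y0 Y0 z0].
move=> [ww sPP xx qq] [hh yy YY zz] [naa nbb nsaa nsbb] QY hz.
have ek k : 0 <= e ^+ k /\ e ^+ k <= 1.
  by rewrite exprn_ge0 ?(ltW e0)// exprn_ile1 ?(ltW e0).
have [e20 e21] := ek 2%N; have [e40 e41] := ek 4%N; have [e60 e61] := ek 6%N.
have [e80 e81] := ek 8%N; have [e100 e101] := ek 10%N.
have b1 : e ^+ 6 * na <= w + sP.
  by apply: le_trans (mul_le1l _ e61); [rewrite ler_wpM2l|rewrite addr_ge0].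
have b2 : e ^+ 4 * nb <= x + s.
  apply: le_trans (mul_le1l _ e41); last by rewrite addr_ge0.
  by rewrite ler_wpM2l// (le_trans nbb)// lerD2r mul_le1l.
have b3 : e ^+ 6 * nsa <= q + h.
  by apply: le_trans (mul_le1l _ e61); [rewrite ler_wpM2l|rewrite addr_ge0].
have b4 : e ^+ 10 * nsb <= Y + z.
  apply: (@le_trans _ _ (e ^+ 6 * Y + e ^+ 8 * z)); last by rewrite lerD// mul_le1l.
  rewrite (_ : e ^+ 6 * Y + e ^+ 8 * z = e ^+ 10 * (Qn + e ^+ 4 * hq)); first by rewrite ler_wpM2l.
  by rewrite -QY -hz; ring.
have k4 : (1 + e ^+ 2) ^+ 2 <= 4.
  by move: (e ^+ 2) e20 e21 => t t0 t1; nra.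
have b5 := ler_wpM2r y0 k4; have b6 := mulr_ge0 e20 T10.
lra.
Qed.

(** * Bounds by the norm of the representer *)

Section estimates.
Variables (R : realType) (n : nat) (Om : set 'rV[R]_n.+1) (M : mesh R n) (eps e : R).
Local Notation E := 'rV[R]_n.+1.
Hypothesis OM : mesh_on Om M.
Hypothesis e0 : 0 < e.
Hypothesis e1 : e <= 1.
Hypothesis epsE : eps = e ^+ 4.
Let oO : open Om. Proof. exact: mesh_open OM. Qed.
Let mO : measurable Om. Proof. exact: (open_measurable_rV oO). Qed.
Local Notation b := (b_form eps Om M).

Variable uu : trial R n.
Hypothesis Uu : U_space Om uu.
Variables (m : E -> R) (p : E -> E) (v : E -> R).
Hypothesis Vt : V_space Om M (m, p, v).
Hypothesis tP : forall x, V_space Om M x -> ipV eps Om M (m, p, v) x = b uu x.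
Local Notation gm := (pgrad M m).
Local Notation dp := (pdiv M p).
Local Notation gv := (pgrad M v).
Local Notation lv := (pdiv M (pgrad M v)).
Local Notation u := (tu uu).
Local Notation sg := (tsigma uu).
Local Notation rho := (trho uu).

Definition U1sq : R := ip Om u u + ipv Om sg sg + eps * ip Om rho rho
    + eps `^ (3 / 2) * norm_half_S eps Om M (tua uu) ^+ 2
    + eps * norm_half_S eps Om M (tub uu) ^+ 2
    + eps `^ (3 / 2) * norm_mhalf_S eps Om M (tsa uu) ^+ 2
    + eps `^ (5 / 2) * norm_mhalf_S eps Om M (tsb uu) ^+ 2.

Lemma representer_estimates : exists N : R, let D2 := ipV eps Om M (m, p, v) (m, p, v) in
  [/\ 0 <= N, 1 / 20 * N <= e * duality Om (tsa uu) (tua uu) + D2,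
    e ^- 2 * norm_half_Gamma eps Om (tua uu) ^+ 2 <= 2 * (N + D2),
    U1sq <= 40 * (N + D2)
  & N <= 41 * D2 + 800 * (e ^- 2 * norm_half_Gamma eps Om (tua uu) ^+ 2)].
Proof.
have en0 : e != 0 by rewrite gt_eqF.
have eps0 : 0 < eps by rewrite epsE exprn_gt0.
have [[p1 p2 p3 p5] [p6 p10 pm1 pm2]] := powR4E e0.
have [[Lu Ls Lrho] [Ha Hb Hsa Hsb Hab]] := Uu.
have [[Lm Lgm Lp Ldp] [Lv Lgv Llv]] := representer_L2 OM Vt.
have [qdiv qtr qdual] := representer_flux OM Uu Vt tP.
have [Wloc W0 Wg] := representer_trace OM Uu Vt tP.
have [gX [Xg Xloc X0 [LQ Qdiv Qtr]]] := representer_laplacian OM e0 epsE Uu Vt tP.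
set q := (fun x => sg x - gm x) in qdiv qtr qdual.
set X := (fun x => e ^+ 3 * rho x - e ^+ 4 * lv x) in Xg Xloc X0.
set Q := (fun x => e ^- 3 *: _) in LQ Qdiv Qtr.
set W := (fun x => u x - dp x) in Wg.
set h := (fun x => rho x - _) in qdiv.
set gW := (fun x => _ - _) in Wg.
set hQ := (fun x => e ^- 3 * _) in Qdiv.
have [LX LgX] : L2 Om X /\ L2v Om gX.
  by split; [exact: (L2_B mO (L2_Z mO _ Lrho) (L2_Z mO _ Llv))|case: Xg].
have HX : H1 Om X by split; [exact: LX|exists gX].
have LW : L2 Om W by exact: (L2_B mO Lu Ldp).
have HW : H1 Om W by split; [exact: LW|exists gW].
have LgW : L2v Om gW by case: Wg.
have Lq : L2v Om q by exact: (L2v_B mO Ls Lgm).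
have Hq : Hdiv Om q by split; [exact: Lq|exists h].
have Lh : L2 Om h by case: qdiv.
have HQ : Hdiv Om Q by split; [exact: LQ|exists hQ].
have LhQ : L2 Om hQ by case: Qdiv.
pose r x := e ^+ 2 * rho x; have Lr : L2 Om r by exact: (L2_Z mO).
pose s x := e *: gX x; have Lss : L2v Om s by exact: (L2v_Z mO).
pose mh x := e ^- 2 * m x; have Lmh : L2 Om mh by exact: (L2_Z mO).
pose P x := e^-1 *: p x; have LP : L2v Om P by exact: (L2v_Z mO).
pose T1 x := e *: gv x; have LT1 : L2v Om T1 by exact: (L2v_Z mO).
pose T2 x := e ^+ 3 * lv x; have LT2 : L2 Om T2 by exact: (L2_Z mO).
(* [X] has the trace of [ub] on the boundary of [Om], where [ua] and [ub] agree: the coupling of the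
   two traces in [U] enters here. *)
have XaH : H10 Om (fun x => X x - tua uu x).
  have Hl := H10_lin oO (-1) Hab X0; apply: (H10_eq _ Hl) => x _.
  by rewrite -[(tua uu - tub uu) x]/(tua uu x - tub uu x) /X; ring.
have XWH : H10 Om (fun x => 1 * X x + -1 * W x).
  have Hl := H10_lin oO (-1) W0 XaH; apply: (H10_eq _ Hl) => x _.
  by rewrite /W /X; ring.
have D2E : ipV eps Om M (m, p, v) (m, p, v) = ip Om mh mh + ipv Om gm gm + ipv Om P P
    + ip Om dp dp + ip Om v v + (1 + e ^+ 2) * ipv Om T1 T1 + ip Om T2 T2.
  have k1 : eps^-1 * ip Om m m = ip Om mh mh.
    by apply: (ip_rescale mO Lm Lm) => x; rewrite /mh epsE; field.
  have k2 : eps `^ (- (1 / 2)) * ipv Om p p = ipv Om P P.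
    apply: (ipv_rescale mO Lp Lp) => x i; rewrite /P !mxE epsE pm2; by field.
  have k3 : e ^+ 2 * ipv Om gv gv = ipv Om T1 T1.
    by apply: (ipv_rescale mO Lgv Lgv) => x i; rewrite /T1 !mxE; ring.
  have k4 : eps `^ (3 / 2) * ip Om lv lv = ip Om T2 T2.
    by apply: (ip_rescale mO Llv Llv) => x; rewrite /T2 epsE p6; ring.
  have k5 : (eps `^ (1 / 2) + eps) * ipv Om gv gv = (1 + e ^+ 2) * ipv Om T1 T1.
    by rewrite -k3 epsE p2; set z := ipv _ _ _; clearbody z; ring.
  rewrite /ipV /ipV_gen k1 k2 k4 k5; congr (_ + _ + _ + _); absip; ring.
have SE : e * duality Om (tsa uu) (tua uu) = ipv Om (fun x => sg x - gm x) s
    + ip Om (fun x => r x - mh x) (fun x => r x - T2 x).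
  rewrite -(qdual _ Ha) -(duality_same_trace oO Hq HX Ha XaH).
  rewrite (dualityE oO Hq qdiv HX Xg) mulrDr; congr (_ + _).
    by apply: (ipv_rescale mO Lq LgX) => x i; rewrite /q /s !mxE; ring.
  apply: (ip_rescale mO Lh LX) => x; rewrite /h /X /r /mh /T2 epsE; by field.
(* This is [<Q . n, X - W> = 0] multiplied by [e^3]. In the first product the factor splits into
   [e^2 Q] and [e grad (X - W)]; in the second it goes entirely to the divergence of [Q]. *)
have IE : ipv Om (fun x => s x - sg x + P x) (fun x => (1 + e ^+ 2) *: (sg x - T1 x) - s x)
    + ip Om (fun x => e * (r x - T2 x) - u x + dp x) (fun x => u x - v x) = 0.
  have gXW : is_wgrad Om (fun x => 1 * X x + -1 * W x) (fun x => 1 *: gX x + -1 *: gW x).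
    by apply: (is_wgrad_lin oO 1 LX (L2_Z mO (-1) LW) Xg); exact: (is_wgradZ oO (-1) LW Wg).
  have := duality_H10 oO HQ XWH; rewrite (dualityE oO HQ Qdiv (H10_H1 XWH) gXW).
  move=> /(congr1 (fun z => e ^+ 3 * z)); rewrite mulr0 mulrDr => <-.
  have LgXW := gXW.1; have LXW := H1_L2 (H10_H1 XWH).
  congr (_ + _); apply: esym.
    rewrite [RHS]ipvC; apply: (ipv_rescale mO LQ LgXW) => x i.
    by rewrite /Q /gW /s /P /T1 !mxE epsE pm1 pm2; field.
  rewrite [RHS]ipC; apply: (ip_rescale mO LhQ LXW) => x.
  by rewrite /hQ /X /W /r /T2; field.
have eN k : 0 <= e ^+ k <= 1 by rewrite exprn_ge0 ?(ltW e0)//= exprn_ile1 ?(ltW e0).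
have co := coercive mO (ltW e0) e1 Ls Lss Lgm LP LT1 Lr Lu Lmh Ldp Lv LT2.
rewrite IE mulr0 subr0 -SE in co.
pose N := ipv Om sg sg + ipv Om s s + ip Om r r + ip Om u u.
have N1 := ipv_ge0 Om sg; have N2 := ipv_ge0 Om s; have N3 := ip_ge0 Om r.
have N4 := ip_ge0 Om u.
have M1 := ip_ge0 Om mh; have M2 := ipv_ge0 Om gm; have M3 := ipv_ge0 Om P.
have M4 := ip_ge0 Om dp; have M5 := ip_ge0 Om v; have M6 := ipv_ge0 Om T1.
have M7 := ip_ge0 Om T2; have M8 := mulr_ge0 (sqr_ge0 e) M6.
have co' : 1 / 20 * N <= e * duality Om (tsa uu) (tua uu) + ipV eps Om M (m, p, v) (m, p, v).
  by rewrite D2E /N; move: co; set z := duality _ _ _; clearbody z; absip; lra.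
have rT : ip Om (fun x => r x - T2 x) (fun x => r x - T2 x) <= 2 * ip Om r r + 2 * ip Om T2 T2.
  exact: (ip_sub_le mO Lr LT2).
have XX : ip Om X X = e ^+ 2 * ip Om (fun x => r x - T2 x) (fun x => r x - T2 x).
  apply: esym; apply: (ip_rescale mO (L2_B mO Lr LT2) (L2_B mO Lr LT2)) => x.
  by rewrite /X /r /T2; ring.
have gXX : e ^+ 2 * ipv Om gX gX = ipv Om s s.
  by apply: (ipv_rescale mO LgX LgX) => x i; rewrite /s !mxE; ring.
exists N; split.
- by rewrite /N; absip; lra.
- exact: co'.
- rewrite ler_pdivrMl ?exprn_gt0//.
  have := @inf_sqrt_sqr_le R (E -> R) [set w | H1 Om w /\ H10 Om (w - tua uu)]
    (fun w => ip Om w w + eps * ipv Om (wgrad Om w) (wgrad Om w)) X (conj HX XaH).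
  rewrite (ipv_wgrad_sqr oO HX Xg) => h1; apply: le_trans (h1 _) _.
    by rewrite addr_ge0 ?ip_ge0// mulr_ge0 ?(ltW eps0) ?ipv_ge0.
  have e4 : eps * ipv Om gX gX = e ^+ 2 * ipv Om s s.
    by rewrite -gXX epsE mulrA -exprD.
  rewrite e4 XX -mulrDr.
  rewrite ler_pM2l ?exprn_gt0// D2E /N.
  by move: rT; absip; lra.
- have q2 := ipv_sub_le mO Ls Lgm; have W2 := ip_sub_le mO Lu Ldp.
  have h2 := ip_sub_le mO Lr Lmh; have s2 := ipv_sub_le mO Ls LP.
  have Y1 := ipv_sub_le mO Ls LT1; have LY := L2v_B mO Ls LT1.
  have Y2 := ipv_sub_le mO (L2v_Z mO (1 + e ^+ 2) LY) Lss.
  have uv := ip_sub_le mO Lu Lv.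
  have gWW : e ^+ 2 * ipv Om gW gW = ipv Om (fun x => sg x - P x) (fun x => sg x - P x).
    apply: (ipv_rescale mO LgW LgW) => x i.
    by rewrite /gW /P !mxE epsE pm1 pm2; field.
  have hh : eps * ip Om h h = ip Om (fun x => r x - mh x) (fun x => r x - mh x).
    by apply: (ip_rescale mO Lh Lh) => x; rewrite /h /r /mh epsE; field.
  have rr : eps * ip Om rho rho = ip Om r r.
    by apply: (ip_rescale mO Lrho Lrho) => x; rewrite /r epsE; ring.
  have QQ : e ^+ 4 * ipv Om Q Q = ipv Om (fun x => (1 + e ^+ 2) *: (sg x - T1 x) - s x)
      (fun x => (1 + e ^+ 2) *: (sg x - T1 x) - s x).
    by apply: (ipv_rescale mO LQ LQ) => x i; rewrite /Q /s /T1 !mxE; field.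
  have hQQ : e ^+ 6 * ip Om hQ hQ = ip Om (fun x => u x - v x) (fun x => u x - v x).
    by apply: (ip_rescale mO LhQ LhQ) => x; rewrite /hQ; field.
  have YY : ipv Om (fun x => (1 + e ^+ 2) *: (sg x - T1 x)) (fun x => (1 + e ^+ 2) *: (sg x - T1 x))
      = (1 + e ^+ 2) ^+ 2 * ipv Om (fun x => sg x - T1 x) (fun x => sg x - T1 x).
    by apply: esym; apply: (ipv_rescale mO LY LY) => x i; rewrite !mxE; ring.
  have p2' : eps `^ (1 / 2) = e ^+ 2 by rewrite epsE.
  have p6' : eps `^ (3 / 2) = e ^+ 6 by rewrite epsE.
  have p10' : eps `^ (5 / 2) = e ^+ 10 by rewrite epsE.
  have na : norm_half_S eps Om M (tua uu) ^+ 2 <= ip Om W W + e ^+ 2 * ipv Om gW gW.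
    have := @inf_sqrt_sqr_le R (E -> R) [set w | H1 Om w /\ same_trace M w (tua uu)]
      (fun w => ip Om w w + eps `^ (1 / 2) * ipv Om (wgrad Om w) (wgrad Om w)) W (conj HW Wloc).
    rewrite (ipv_wgrad_sqr oO HW Wg) -p2' => h1; apply: h1.
    by rewrite addr_ge0 ?ip_ge0// mulr_ge0 ?powR_ge0 ?ipv_ge0.
  have nb : norm_half_S eps Om M (tub uu) ^+ 2 <= ip Om X X + e ^+ 2 * ipv Om gX gX.
    have := @inf_sqrt_sqr_le R (E -> R) [set w | H1 Om w /\ same_trace M w (tub uu)]
      (fun w => ip Om w w + eps `^ (1 / 2) * ipv Om (wgrad Om w) (wgrad Om w)) X (conj HX Xloc).
    rewrite (ipv_wgrad_sqr oO HX Xg) -p2' => h1; apply: h1.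
    by rewrite addr_ge0 ?ip_ge0// mulr_ge0 ?powR_ge0 ?ipv_ge0.
  have nsa : norm_mhalf_S eps Om M (tsa uu) ^+ 2 <= ipv Om q q + eps * ip Om h h.
    have := @inf_sqrt_sqr_le R (E -> E) [set w | Hdiv Om w /\ same_ntrace M w (tsa uu)]
      (fun w => ipv Om w w + eps * ip Om (wdiv Om w) (wdiv Om w)) q (conj Hq qtr).
    rewrite (ip_wdiv_sqr oO Hq qdiv); apply.
    by rewrite addr_ge0 ?ipv_ge0// mulr_ge0 ?(ltW eps0) ?ip_ge0.
  have nsb : norm_mhalf_S eps Om M (tsb uu) ^+ 2 <= ipv Om Q Q + eps * ip Om hQ hQ.
    have := @inf_sqrt_sqr_le R (E -> E) [set w | Hdiv Om w /\ same_ntrace M w (tsb uu)]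
      (fun w => ipv Om w w + eps * ip Om (wdiv Om w) (wdiv Om w)) Q (conj HQ Qtr).
    rewrite (ip_wdiv_sqr oO HQ Qdiv); apply.
    by rewrite addr_ge0 ?ipv_ge0// mulr_ge0 ?(ltW eps0) ?ip_ge0.
  rewrite gWW in na; rewrite XX gXX in nb; rewrite hh in nsa.
  rewrite YY in Y2; rewrite /U1sq rr p6' p10' D2E /N.
  move: na nb nsa nsb; set A := norm_half_S _ _ _ _; set B := norm_half_S _ _ _ _.
  set C := norm_mhalf_S _ _ _ _; set F := norm_mhalf_S _ _ _ _.
  clearbody A B C F; rewrite epsE => na nb nsa nsb.
  apply: (U1_arith e0 e1 _ _ _ _ _ (And4 W2 s2 rT q2) (And4 h2 Y1 Y2 uv) (And4 na nb nsa nsb) QQ hQQ).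
  + by split.
  + by split.
  + by split.
  + by split; [exact: ip_ge0|exact: ipv_ge0|exact: ip_ge0|exact: ipv_ge0].
  + by split; [exact: ip_ge0|exact: ipv_ge0|exact: ipv_ge0|exact: ip_ge0].
- have key : e ^+ 2 * (1 / 800 * (N - 41 * ipV eps Om M (m, p, v) (m, p, v))) <=
    norm_half_Gamma eps Om (tua uu) ^+ 2.
    (* A lower bound for the infimum is a bound for every extension [w] of the trace; [X] shows that
       there is one. *)
    have := @inf_sqrt_sqr_ge R (E -> R) [set w | H1 Om w /\ H10 Om (w - tua uu)]
      (fun w => ip Om w w + eps * ipv Om (wgrad Om w) (wgrad Om w))
      (e ^+ 2 * (1 / 800 * (N - 41 * ipV eps Om M (m, p, v) (m, p, v))))
      (ex_intro _ X (conj HX XaH)).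
    move=> ge; apply: ge => w [Hw Hwa]; have [Lw Lgw] := (H1_L2 Hw, wgrad_L2v Hw).
    rewrite [X in _ + X * _](_ : eps = (e ^+ 2) ^+ 2); last by rewrite epsE -exprM.
    have q2 := ipv_sub_le mO Ls Lgm; have h2 := ip_sub_le mO Lr Lmh.
    have S1 := ipv_quad_ge0 (- (40 * e)) mO Lq Lgw.
    have Lrm := L2_B mO Lr Lmh.
    have S2 := ip_quad_ge0 (- (40 * e^-1)) mO Lrm Lw.
    have dS : e * duality Om (tsa uu) (tua uu) = e * ipv Om q (wgrad Om w)
        + e^-1 * ip Om (fun x => r x - mh x) w.
      rewrite -(qdual _ Ha) -(duality_same_trace oO Hq Hw Ha Hwa).
      rewrite (dualityE oO Hq qdiv Hw (wgradP Hw)) mulrDr; congr (_ + _).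
      have k1 : e * ip Om h w = ip Om (fun x => e^-1 * (r x - mh x)) w.
        by apply: (ip_rescale mO Lh Lw) => x; rewrite /h /r /mh epsE; field.
      by rewrite k1; exact: (ipZl mO _ Lrm Lw).
    apply: (trace_arith _ co' dS _ _ q2 h2).
    + exact: exprn_gt0.
    + move: S1; rewrite /q; set A := ipv _ _ _; set B := ipv _ _ _; set C := ipv _ _ _.
      by clearbody A B C => hs; rewrite -subr_ge0; apply: le_trans hs _; rewrite le_eqVlt; apply/orP; left; apply/eqP; ring.
    + move: S2; set A := ip _ _ _; set B := ip _ _ _; set C := ip _ _ _.
      by clearbody A B C => hs; rewrite -subr_ge0; apply: le_trans hs _; rewrite le_eqVlt; apply/orP; left; apply/eqP; field.
    + by rewrite /N; absip; lra.
    + by rewrite D2E; absip; lra.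
  move: key; set A := ipV _ _ _ _ _; set B := norm_half_Gamma _ _ _; clearbody A B => key.
  have : 1 / 800 * (N - 41 * A) <= e ^- 2 * B ^+ 2 by rewrite ler_pdivlMl ?exprn_gt0.
  by lra.
Qed.

End estimates.

(** The variational inequality and the residual bound give [S + (beta/2) Dz <= (beta/2) T + Er], the
    mixed pairings [duh] and [dhu] being dropped by their sign. As [beta/2 >= 3/2] and [Dz >= Dw],
    the [Dw] in [N / 20 <= S + Dw] is paid for and one half of [Dw] is left:
    [N / 20 + Dw / 2 <= eta^2]. Therefore [Dw + g <= 2 N + 3 Dw <= 40 eta^2], and 49 is the next
    square. *)
Lemma vi_arith (R : realFieldType) (beta e Dz Dw N bh Lx bu duu duh dhu dhh S T Er g eta : R) :
  3 <= beta -> 0 < e -> 0 <= N -> bh - bu = Dz ->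
  beta * Lx <= beta * bu + 1 / 2 * e * (duh - duu + (dhu - duu)) ->
  2 * (bh - Lx) <= Dz + T -> 0 <= T -> 0 <= duh -> 0 <= dhu ->
  S = e * (duu - duh - dhu + dhh) -> Er = e * dhh -> 0 <= Dw -> Dw <= Dz ->
  1 / 20 * N <= S + Dw -> g <= 2 * (N + Dw) -> eta ^+ 2 = beta * T + Er ->
  Dw + g <= 49 * eta ^+ 2.
Proof.
move=> b3 e0 N0 hb hvi hres T0 uh0 hu0 SE ErE Dw0 Dwz hN hg ->.
have b0 : 0 <= beta by lra.
have h1 := ler_wpM2l b0 hres.
have h2 := mulr_ge0 (ltW e0) uh0; have h3 := mulr_ge0 (ltW e0) hu0.
have h4 : 3 * Dz <= beta * Dz by rewrite ler_wpM2r// (le_trans Dw0).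
have h5 := mulr_ge0 b0 T0.
have h6 : beta * bh - beta * bu = beta * Dz by rewrite -hb; ring.
have h7 : beta * (2 * (bh - Lx)) = 2 * (beta * bh) - 2 * (beta * Lx) by ring.
have h8 : beta * (Dz + T) = beta * Dz + beta * T by ring.
have h9 : S = e * duu - e * duh - e * dhu + e * dhh by rewrite SE; ring.
have h10 : 1 / 2 * e * (duh - duu + (dhu - duu)) = 1 / 2 * (e * duh) + 1 / 2 * (e * dhu) - e * duu.
  by field.
rewrite h7 h8 in h1; rewrite h10 in hvi; rewrite ErE; lra.
Qed.

(** Used for the representers [x] and [t] of opposite functionals, with [a = (x, x)], [b = (x, t)]
    and [c = (t, t)]. Both are chosen by [get], so [x = - t] is not at hand, but [b = - c] turns
    [0 <= |x + t|^2] into [c <= a]. *)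
Lemma opposite_arith (R : realFieldType) (a b c f g : R) :
  0 <= a + 2 * 1 * b + 1 ^+ 2 * c -> c = f - g -> b = g - f -> c <= a.
Proof. by rewrite expr1n => h cE bE; lra. Qed.

Lemma ipV_gen_ge0 (R : realType) (n : nat) (eps : R) D gr dv
    (x : ('rV[R]_n.+1 -> R) * ('rV[R]_n.+1 -> 'rV[R]_n.+1) * ('rV[R]_n.+1 -> R)) :
  0 < eps -> 0 <= ipV_gen eps D gr dv x x.
Proof.
case: x => [[mu tau] v] e0 /=; rewrite !addr_ge0 ?ip_ge0 ?ipv_ge0//; apply: mulr_ge0;
  rewrite ?ip_ge0 ?ipv_ge0 ?powR_ge0 ?invr_ge0 ?(ltW e0)//.
by rewrite addr_ge0 ?powR_ge0 ?(ltW e0).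
Qed.

(** * Differences of trial functions and boundary pairings *)

Section trial_space.
Variables (R : realType) (n : nat) (Om : set 'rV[R]_n.+1).
Hypothesis oO : open Om.
Local Notation E := 'rV[R]_n.+1.
Let mO : measurable Om. Proof. exact: (open_measurable_rV oO). Qed.

Lemma H1B w w' : H1 Om w -> H1 Om w' -> H1 Om (w - w').
Proof.
move=> Hw Hw'; apply: (H1_eq _ (H1_lin oO (-1) Hw' Hw)) => x _.
by rewrite mulN1r addrC.
Qed.

Lemma HdivB (q q' : E -> E) : Hdiv Om q -> Hdiv Om q' -> Hdiv Om (q - q').
Proof.
move=> Hq Hq'; apply: (Hdiv_eq _ (Hdiv_lin oO (-1) Hq' Hq)) => x _.
by rewrite scaleN1r addrC.
Qed.

Lemma dualityBl (q q' : E -> E) w : Hdiv Om q -> Hdiv Om q' -> H1 Om w ->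
  duality Om (q - q') w = duality Om q w - duality Om q' w.
Proof.
move=> Hq Hq' Hw; have h := duality_linl oO (-1) Hq' Hq Hw.
apply: etrans (etrans _ h) _.
  by apply: duality_eq => // x _; rewrite scaleN1r addrC.
by rewrite mulN1r addrC.
Qed.

Lemma dualityBr (q : E -> E) w w' : Hdiv Om q -> H1 Om w -> H1 Om w' ->
  duality Om q (w - w') = duality Om q w - duality Om q w'.
Proof.
move=> Hq Hw Hw'; have h := duality_linr oO (-1) Hq Hw' Hw.
apply: etrans (etrans _ h) _.
  by apply: duality_eq => // x _; rewrite mulN1r addrC.
by rewrite mulN1r addrC.
Qed.

Lemma tuaB (uu vv : trial R n) : tua (uu - vv) = tua uu - tua vv.
Proof. by case: uu => [[[[[[? ?] ?] ?] ?] ?] ?]; case: vv => [[[[[[? ?] ?] ?] ?] ?] ?]. Qed.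

Lemma tsaB (uu vv : trial R n) : tsa (uu - vv) = tsa uu - tsa vv.
Proof. by case: uu => [[[[[[? ?] ?] ?] ?] ?] ?]; case: vv => [[[[[[? ?] ?] ?] ?] ?] ?]. Qed.

Lemma U_spaceB uu vv : U_space Om uu -> U_space Om vv -> U_space Om (uu - vv).
Proof.
case: uu => [[[[[[u s] r] ua] ub] sa] sb]; case: vv => [[[[[[u' s'] r'] ua'] ub'] sa'] sb'].
move=> [[Lu Ls Lr] [Ha Hb Hsa Hsb Hab]] [[Lu' Ls' Lr'] [Ha' Hb' Hsa' Hsb' Hab']].
split; split.
- exact: (L2_B mO Lu Lu').
- exact: (L2v_B mO Ls Ls').
- exact: (L2_B mO Lr Lr').
- exact: (H1B Ha Ha').
- exact: (H1B Hb Hb').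
- exact: (HdivB Hsa Hsa').
- exact: (HdivB Hsb Hsb').
- apply: (H10_eq _ (H10_lin oO (-1) Hab' Hab)) => x _.
  rewrite mulN1r -[LHS]/(- (ua' x - ub' x) + (ua x - ub x)).
  by rewrite -[RHS]/(ua x - ua' x - (ub x - ub' x)); ring.
Qed.

(** [w] may be replaced by the Lipschitz function [G] with the same trace, for which [has_ntrace]
    expresses the pairing as a surface integral; on the boundary [G] is [g]. This identifies the
    boundary part of the estimator with [e <gn uh, g0 uh>]. *)
Lemma duality_traces (M : mesh R n) q w s g : Hdiv Om q -> H1 Om w ->
  has_ntrace Om M q s -> has_trace Om w g ->
  duality Om q w = \sum_(i < ntri M) edge_integral Om i (fun x => s x * g x).
Proof.
move=> Hq Hw [_ HG] [G [GL Gg H0]].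
have HG1 : H1 Om G.
  apply: (H1_eq _ (H1B Hw (H10_H1 H0))) => x _.
  by rewrite -[LHS]/(w x - (w x - G x)) opprB addrC subrK.
rewrite (duality_same_trace oO Hq Hw HG1 H0) (HG _ GL).
apply: eq_bigr => i _; apply: eq_bigr => k _; congr (_ * _).
apply: eq_Rintegral => y _; set x := facet_param _ _ _.
have [Bx|nB] := pselect (bdry Om x); first by rewrite (Gg x (mem_set Bx)).
by rewrite indic_out ?mul0r.
Qed.

End trial_space.

(** * Reliability in the energy norm *)

Section reliability.
Variables (R : realType) (n : nat) (Om : set 'rV[R]_n.+1) (M : mesh R n) (eps : R).
Hypothesis OM : mesh_on Om M.
Hypothesis eps01 : 0 < eps <= 1.
Let oO : open Om. Proof. exact: mesh_open OM. Qed.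
Let eps0 : 0 < eps. Proof. by case/andP: eps01. Qed.
Let e := eps `^ (1 / 4).
Let e0 : 0 < e. Proof. exact: powR_gt0. Qed.
Let epsE : eps = e ^+ 4.
Proof.
rewrite /e -powR_mulrn ?powR_ge0// -powRrM.
by rewrite (_ : 1 / 4 * 4%:R = 1) ?powRr1 ?ltW//; field.
Qed.
Let e1 : e <= 1.
Proof. by have := eps01; rewrite epsE expr_le1 ?(ltW e0)// => /andP[]. Qed.

Lemma energy_estimates uu : U_space Om uu ->
  exists N : R, let t := Theta eps Om M uu in let D2 := ipV eps Om M t t in
    let g := e ^- 2 * norm_half_Gamma eps Om (tua uu) ^+ 2 in
  [/\ 0 <= N, 1 / 20 * N <= e * duality Om (tsa uu) (tua uu) + D2, g <= 2 * (N + D2),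
    norm_U1 eps Om M uu ^+ 2 <= 40 * (N + D2) & N <= 41 * D2 + 800 * g]
  /\ energy_norm eps Om M uu ^+ 2 = D2 + g.
Proof.
move=> Uu; have [Vt tP] := ThetaP OM eps0 Uu.
have D0 := ipV_ge0 OM eps0 Vt; have dn := dual_norm_riesz OM eps0 Vt tP.
move: Vt tP D0 dn; case: (Theta _ _ _ _) => [[m p] v] Vt tP D0 dn.
have [N [N0 NS Ng NU Nl]] := representer_estimates OM e0 e1 epsE Uu Vt tP.
have [_ [_ _ _ pm2]] := powR4E e0; rewrite -epsE in pm2.
exists N; split.
  split => //; rewrite /norm_U1 sqr_sqrtr//.
  by rewrite !addr_ge0 ?ip_ge0 ?ipv_ge0//; apply: mulr_ge0;
    rewrite ?powR_ge0 ?sqr_ge0 ?ip_ge0 ?(ltW eps0).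
rewrite /energy_norm dn (sqr_sqrtr D0) pm2 sqr_sqrtr//; apply: addr_ge0; first exact: D0.
by apply: mulr_ge0; [rewrite invr_ge0 exprn_ge0 ?(ltW e0)|exact: sqr_ge0].
Qed.

(** With [g] the boundary term of the energy norm, [40 (N + D2) <= 1680 D2 + 32000 g <= 200^2 (D2 +
    g)]. *)
Lemma norm_U1_le_energy uu : U_space Om uu ->
  norm_U1 eps Om M uu <= 200 * energy_norm eps Om M uu.
Proof.
move=> Uu; have [N [[N0 _ _ NU Nl] En]] := energy_estimates Uu.
have n0 : 0 <= norm_U1 eps Om M uu by exact: sqrtr_ge0.
have E0 : 0 <= energy_norm eps Om M uu by exact: sqrtr_ge0.
rewrite -(ler_pXn2r (n := 2))// ?nnegrE ?mulr_ge0// exprMn En.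
have Vt := (ThetaP OM eps0 Uu).1; have D0 := ipV_ge0 OM eps0 Vt.
have g0 : 0 <= e ^- 2 * norm_half_Gamma eps Om (tua uu) ^+ 2.
  by rewrite mulr_ge0 ?sqr_ge0// invr_ge0 exprn_ge0 ?(ltW e0).
move: NU Nl D0 g0; set D2 := ipV _ _ _ _ _; set g := _ * norm_half_Gamma _ _ _ ^+ 2.
set A := norm_U1 _ _ _ _ ^+ 2; clearbody A D2 g; rewrite expr2; lra.
Qed.

Lemma energy_reliability beta f (u uh : trial R n) eta : 3 <= beta -> L2 Om f ->
  solves_vi beta eps Om M f (K_cone eps Om) u -> K_cone eps Om uh ->
  estimator beta eps Om M f uh eta ->
  energy_norm eps Om M (u - uh) <= 7 * eta.
Proof.
move=> b3 Lf [Ku VI] Kh [eta0 [s [g [Hs Hg etaE]]]].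
have [Uu gu nu] := Ku; have [Uh gh nh] := Kh.
have [[_ _ _] [Hau _ Hsu _ _]] := Uu; have [[_ _ _] [Hah _ Hsh _ _]] := Uh.
have Uz := U_spaceB oO Uh Uu; have Uw := U_spaceB oO Uu Uh.
have [Vx xP] := ThetaP OM eps0 Uz; have [Vt tP] := ThetaP OM eps0 Uw.
have [N [[N0 NS Ng _ _] En]] := energy_estimates Uw.
have Dw0 := ipV_ge0 OM eps0 Vt.
(* [uh] lies in the cone, hence is an admissible test in the continuous inequality; the test
   function in both forms is then [beta Theta (uh - u)]. *)
have hvi := VI _ Kh.
rewrite /F_form /a_form (L_form_dform eps OM Lf (V_spaceZ OM beta Vx)) in hvi.
rewrite (b_form_dform eps OM Uu (V_spaceZ OM beta Vx)) in hvi.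
rewrite (dformZ OM beta (Ldata_L2 eps OM Lf) Vx) (dformZ OM beta (bdata_L2 eps OM Uu) Vx) in hvi.
rewrite -(L_form_dform eps OM Lf Vx) -(b_form_dform eps OM Uu Vx) in hvi.
rewrite tuaB tsaB (dualityBr oO Hsu Hah Hau) (dualityBl oO Hsh Hsu Hau) in hvi.
have hz := b_formB eps OM Uh Uu Vx; rewrite -(xP _ Vx) in hz.
have hres := residual_bound OM eps0 Lf Uh Vx.
have hS : e * duality Om (tsa (u - uh)) (tua (u - uh)) =
    e * (duality Om (tsa u) (tua u) - duality Om (tsa u) (tua uh)
      - duality Om (tsa uh) (tua u) + duality Om (tsa uh) (tua uh)).
  rewrite tuaB tsaB (dualityBl oO Hsu Hsh (H1B oO Hau Hah)).
  rewrite (dualityBr oO Hsu Hau Hah) (dualityBr oO Hsh Hau Hah).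
  by rewrite opprB addrA addrAC.
have hE : \sum_(i < ntri M) eps `^ (1 / 4) * edge_integral Om i (fun x => s x * g x) =
    e * duality Om (tsa uh) (tua uh).
  by rewrite -mulr_sumr (duality_traces oO Hsh Hah Hs Hg).
have hD : ipV eps Om M (Theta eps Om M (u - uh)) (Theta eps Om M (u - uh)) <=
    ipV eps Om M (Theta eps Om M (uh - u)) (Theta eps Om M (uh - u)).
  have h1 := b_formB eps OM Uu Uh Vt; rewrite -(tP _ Vt) in h1.
  have h2 := b_formB eps OM Uh Uu Vt; rewrite -(xP _ Vt) in h2.
  exact: (opposite_arith (ipV_quad OM 1 eps0 Vx Vt) h1 h2).
have hT : 0 <= \sum_(i < ntri M) (let r := riesz_inv eps (elt i) (fun y => L_form eps Om M f (ext0 (elt i) y)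
      - b_form eps Om M uh (ext0 (elt i) y)) in ipV_loc eps (elt i) r r).
  apply: sumr_ge0 => i _ /=; exact: (ipV_gen_ge0 _ _ _ _ eps0).
have hT' : \sum_(i < ntri M) eta_elt2 beta eps Om f uh i = beta *
   \sum_(i < ntri M) (let r := riesz_inv eps (elt i) (fun y => L_form eps Om M f (ext0 (elt i) y)
      - b_form eps Om M uh (ext0 (elt i) y)) in ipV_loc eps (elt i) r r).
  by rewrite mulr_sumr.
rewrite hT' in etaE.
(* The cone conditions enter crosswise: the flux of [u] against the trace of [uh], and the flux of
   [uh] against the trace of [u], both pair nonnegatively. *)
have := vi_arith b3 e0 N0 (esym hz) hvi hres hT (nu _ Hah gh) (nh _ Hau gu) hS hE Dw0 hD NS Ng etaE.
rewrite -En => h.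
rewrite -(ler_pXn2r (n := 2))// ?nnegrE ?sqrtr_ge0 ?mulr_ge0//.
by apply: le_trans h _; rewrite exprMn (_ : 7 ^+ 2 = 49 :> R)//; ring.
Qed.

End reliability.

Theorem theorem15 (R : realType) :
  exists Crel : R, 0 < Crel /\
  forall (n : nat) (Om : set 'rV[R]_n.+1),
    (n.+1 = 2 \/ n.+1 = 3)%N -> lipschitz_domain Om ->
  exists C1 : R,
    [/\ 0 < C1,
      (forall (M : mesh R n) (eps : R) (w : trial R n),
         conforming_mesh Om M -> 0 < eps <= 1 -> U_space Om w ->
         norm_U1 eps Om M w <= C1 * energy_norm eps Om M w)
    & forall (M : mesh R n) (eps beta : R) (f : 'rV[R]_n.+1 -> R)
        (u uh : trial R n) (eta : R),
        conforming_mesh Om M -> 0 < eps <= 1 -> 3 <= beta -> L2 Om f ->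
        solves_vi beta eps Om M f (K_cone eps Om) u ->
        solves_vi beta eps Om M f (K_cone_h eps Om M) uh ->
        estimator beta eps Om M f uh eta ->
        energy_norm eps Om M (u - uh) <= Crel * eta /\
        norm_U1 eps Om M (u - uh) <= Crel * C1 * eta].
Proof.
(* [7^2 = 49] is the factor of [eta^2] in [vi_arith]. *)
exists 7; split => // n Om _ [[_ oO] _ _ _ LO].
have bound M eps w : conforming_mesh Om M -> 0 < eps <= 1 -> U_space Om w ->
    norm_U1 eps Om M w <= 200 * energy_norm eps Om M w.
  move=> cM eps01 Uw; have OM : mesh_on Om M by split.
  exact: (norm_U1_le_energy OM eps01 Uw).
(* The constant of [norm_U1_le_energy], the same for every [Om]. *)
exists 200; split; first by [].
  exact: bound.
move=> M eps beta f u uh eta cM eps01 b3 Lf Su Sh He.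
have OM : mesh_on Om M by split.
have [[Kh _] _] := Sh; have [Ku _] := Su.
have rel := energy_reliability OM eps01 b3 Lf Su Kh He.
split; first exact: rel.
have [Uu _ _] := Ku; have [Uh _ _] := Kh.
apply: le_trans (bound _ _ _ cM eps01 (U_spaceB oO Uu Uh)) _.
by rewrite mulrAC mulrC ler_wpM2r.
Qed.
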